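(* Fix natural numbers $n$ and $i$. The $\mathcal{T}^{\mathrm{op}}$-module (over $\mathbb{Z}$) $$T\mapsto H_i\big(\operatorname{UConf}_n(T);\mathbb{Z}\big)$$ is $(n+i)$-small. In particular, it is finitely generated.
   Context: A graph is a finite CW complex of dimension at most $1$; its 0-cells are vertices and its 1-cells are edges. A tree is a graph that is contractible (a finite nonempty connected acyclic graph). A contraction $\varphi:T\to T'$ of trees is determined by the induced map on vertex sets, which can be any map such that the preimage of every vertex of $T'$ is the vertex set of a (nonempty, connected) subtree of $T$; adjacent vertices of $T$ are then sent to equal or adjacent vertices of $T'$. $\mathcal{T}$ is the category of trees with contractions. A $\mathcal{T}^{\mathrm{op}}$-module over $k=\mathbb{Z}$ is a functor from $\mathcal{T}^{\mathrm{op}}$ to $\mathbb{Z}$-modules. The principal projective $P_S$ associated with a tree $S$ has $P_S(T)$ free on $\operatorname{Hom}_{\mathcal{T}}(T,S)$, with maps given by composition. A module is finitely generated if it is a quotient of a finite direct sum of principal projectives; generated in degrees $\le d$ if it is a quotient of a finite direct sum $\bigoplus_j P_{T_j}$ with every $T_j$ having at most $d$ edges; $d$-small if it is isomorphic to a subquotient of a module generated in degrees $\le d$. For a graph $G$, $\operatorname{UConf}_n(G)=\{(x_1,\dots,x_n)\in G^n\mid x_a\ne x_b \text{ for } a\neq b\}/S_n$ is the $n$-stranded unordered configuration space. Module structure. The homology is made functorial through the reduced Świątkowski complex $\widetilde S(G)$. Let $A_G$ be the integral polynomial ring generated by the edges of $G$. A half-edge is a pair $h=(v(h),e(h))$ of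 a vertex and an edge having that vertex as an endpoint. For a vertex $v$ let $S(v)$ be the free $A_G$-module on the symbol $\emptyset$ and all half-edges at $v$, bigraded with edges in degree $(0,1)$, $\emptyset$ in degree $(0,0)$, and half-edges in degree $(1,1)$. Let $\widetilde S(v)\subset S(v)$ be the submodule generated by $\emptyset$ and all differences $h-h'$ of half-edges at $v$, with $A_G$-linear differential of degree $(-1,0)$ given by $\partial(h-h')=(e(h)-e(h'))\emptyset$ and $\partial\emptyset=0$. Put $\widetilde S(G)=\bigotimes_{v}\widetilde S(v)$ (tensor product over $A_G$, over all vertices $v$ of $G$), a bigraded $A_G$-module with differential. By a theorem of An, Drummond-Cole and Knudsen, the bigraded abelian group $\bigoplus_{(i,n)}H_i(\operatorname{UConf}_n(G);\mathbb{Z})$ is isomorphic to the homology of $\widetilde S(G)$, with $H_i(\operatorname{UConf}_n(G);\mathbb{Z})$ corresponding to the degree $(i,n)$ part. For a simple contraction $\varphi:G\to G'$ (exactly one edge contracted), identify the contracted edge with $[0,1]$, with endpoints the vertices $0,1$ and half-edges $h_0,h_1$ at $0,1$ respectively, and let $w'$ be the image of this edge. Each edge of $G'$ is the image of a unique edge of $G$, and similarly for half-edges; this gives a ring map $A_{G'}\to A_G$ and an $A_{G'}$-module map $\bigotimes_{v'\ne w'}\widetilde S(v')\to\bigotimes_{v\ne 0,1}\widetilde S(v)$. Define an $A_{G'}$-linear map $\widetilde S(w')\to\widetilde S(0)\otimes\widetilde S(1)$ by the rule $\emptyset\mapsto\emptyset\otimes\emptyset$ and, for a half-edge $h'$ at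 $w'$ with corresponding half-edge $h$ of $G$, $h'\mapsto(h-h_0)\otimes\emptyset$ if $v(h)=0$ and $h'\mapsto\emptyset\otimes(h-h_1)$ if $v(h)=1$ (applied to differences of half-edges by linearity). Tensoring these maps gives a chain map $\widetilde\varphi^*:\widetilde S(G')\to\widetilde S(G)$. For arbitrary contractions, compose the maps for simple contractions (the result is independent of the factorization). The structure maps $H_i(\operatorname{UConf}_n(T');\mathbb{Z})\to H_i(\operatorname{UConf}_n(T);\mathbb{Z})$ of the module, for contractions $\varphi:T\to T'$, are those induced by $\widetilde\varphi^*$ on homology. *)

(* Defs.v *)
From HB Require Import structures.
From mathcomp Require Import all_boot all_order all_algebra all_fingroup.
From mathcomp Require Import generic_quotient ring_quotient.
From mathcomp Require Import finmap monalg.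
From mathcomp Require Import all_classical all_reals all_analysis.

Set Implicit Arguments.
Unset Strict Implicit.
Unset Printing Implicit Defensive.

Import GRing.Theory Num.Theory numFieldNormedType.Exports.

Local Open Scope ring_scope.
Local Open Scope quotient_scope.

Record tree := Tree {
  vert :> finType;
  adj : rel vert;
  adj_sym : symmetric adj;
  adj_irr : irreflexive adj;
  tree_nonempty : (0 < #|vert|)%N;
  tree_connected : forall x y, connect adj x y;
  tree_acyclic : forall p : seq vert, (2 < size p)%N -> ~ ucycle adj p
}.

(* A tree has no loops or multiple edges, so an edge is its set of endpoints. *)
Definition edge (T : tree) : predArgType :=
  {E : {set T} | [exists x, exists y, adj x y && (E == [set x; y])]}.

Definition adj_in (T : tree) (A : {set T}) : rel T :=
  [rel u v | [&& adj u v, u \in A & v \in A]].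

Definition subtree (T : tree) (A : {set T}) : bool :=
  (A != finset.set0) &&
  [forall x in A, forall y in A, connect (adj_in A) x y].

Definition is_contraction (T T' : tree) (f : {ffun T -> T'}) : bool :=
  [forall w, subtree (finset (fun v => f v == w))] &&
  [forall x, forall y, adj x y ==> (f x == f y) || adj (f x) (f y)].

Record contraction (T T' : tree) : predArgType := Contraction {
  contr_fun :> {ffun T -> T'};
  contrP : is_contraction contr_fun
}.

HB.instance Definition _ (T T' : tree) := [isSub for @contr_fun T T'].
HB.instance Definition _ (T T' : tree) := [Finite of contraction T T' by <:].

Lemma contr_id_subproof (T : tree) : is_contraction [ffun x : T => x].
Proof.
apply/andP; split; apply/forallP => w; last first.
  by apply/forallP => y; rewrite !ffunE; apply/implyP => ->; rewrite orbT.
apply/andP; split; first by apply/set0Pn; exists w; rewrite inE ffunE.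
apply/forall_inP => x; rewrite inE ffunE => /eqP ->.
apply/forall_inP => y; rewrite inE ffunE => /eqP ->.
exact: connect0.
Qed.

Definition contr_id (T : tree) : contraction T T :=
  Contraction (contr_id_subproof T).

Section ContractionTheory.
Variables (T T' : tree) (f : contraction T T').

Lemma contr_adj x y : adj x y -> f x = f y \/ adj (f x) (f y).
Proof.
case/andP: (contrP f) => _ /forallP /(_ x) /forallP /(_ y) /implyP h /h.
by case/orP => [/eqP|]; [left | right].
Qed.

Lemma contr_surj w : exists x, f x = w.
Proof.
case/andP: (contrP f) => /forallP /(_ w) /andP[/set0Pn[x]] .
by rewrite inE => /eqP fx _ _; exists x.
Qed.

Lemma contr_fiber x y : f x = f y ->
  connect (adj_in (finset (fun v => f v == f x))) x y.
Proof.
move=> fxy; case/andP: (contrP f) => /forallP /(_ (f x)) /andP[_].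
move=> /forall_inP /(_ x); rewrite inE => /(_ (eqxx _)).
by move=> /forall_inP /(_ y); rewrite inE fxy => /(_ (eqxx _)).
Qed.

Lemma contr_edge_lift u v : adj u v ->
  exists x y, [/\ adj x y, f x = u & f y = v].
Proof.
move=> uv.
pose e2 := [rel a b : T' | [exists x, exists y,
  [&& adj x y, f x == a, f y == b & a != b]]].
have e2P a b : e2 a b -> adj a b /\ exists x y, [/\ adj x y, f x = a & f y = b].
  move=> /existsP[x /existsP[y /and4P[xy /eqP fx /eqP fy ab]]].
  split; last by exists x, y.
  have [E|] := contr_adj xy; last by rewrite fx fy.
  by move: ab; rewrite -fx -fy E eqxx.
have [x fx] := contr_surj u; have [y fy] := contr_surj v.
have cxy : connect e2 u v.
  case/connectP: (tree_connected x y) => p pp yE.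
  rewrite -fx -fy yE; elim: p x {fx yE} pp => [|z p IH] x /=.
    by move=> _; exact: connect0.
  case/andP => xz /IH; apply: connect_trans.
  have [-> //|fxz] := contr_adj xz.
  apply: connect1; apply/existsP; exists x; apply/existsP; exists z.
  rewrite xz !eqxx /=; apply/eqP => E; by rewrite E adj_irr in fxz.
case/connectP: cxy => p0 pp0 vE0; move: vE0.
case/shortenP: pp0 => p pp up _ vE.
have padj : path (@adj T') u p by apply: sub_path pp => a b /e2P[].
case: p => [|a [|b p]] in pp up padj vE *.
- by rewrite vE /= adj_irr in uv.
- by rewrite /= in vE; subst a; case/andP: pp => /e2P[_ h] _.
- case: (@tree_acyclic T' [:: u, a, b & p]) => //.
  apply/andP; split => //.
  suff: path (@adj T') u (rcons [:: a, b & p] u) by [].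
  by rewrite rcons_path padj /=; move: vE => /= <-; rewrite adj_sym.
Qed.

End ContractionTheory.

Lemma contr_comp_subproof (T T' T'' : tree)
  (g : contraction T' T'') (f : contraction T T') :
  is_contraction [ffun x => g (f x)].
Proof.
apply/andP; split; apply/forallP => w; last first.
  apply/forallP => y; rewrite !ffunE; apply/implyP => wy.
  have [->|/(contr_adj g)[->|->]] := contr_adj f wy; rewrite ?eqxx ?orbT //.
apply/andP; split.
  have [v gv] := contr_surj g w; have [x fx] := contr_surj f v.
  by apply/set0Pn; exists x; rewrite inE ffunE fx gv.
set A := finset _.
have inA x : (x \in A) = (g (f x) == w) by rewrite inE ffunE.
have fib x y : x \in A -> f x = f y -> connect (adj_in A) x y.
  rewrite inA => /eqP gx /contr_fiber; apply: connect_sub => a b.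
  case/and3P => ab; rewrite !inE => /eqP fa /eqP fb; apply: connect1.
  by apply/and3P; split; rewrite // inA ?fa ?fb gx.
apply/forall_inP => x xA; apply/forall_inP => y yA.
have gE : g (f x) = g (f y) by move: xA yA; rewrite !inA => /eqP-> /eqP->.
have : connect (adj_in (finset (fun v => g v == w))) (f x) (f y).
  have <- : g (f x) = w by apply/eqP; rewrite -inA.
  exact: contr_fiber gE.
case/connectP => p; elim: p x xA {gE} => [|u p IH] z zA /=.
  by move=> _ E; exact: fib.
case/andP => /and3P[zu _ gu] pp E.
have [a [b [ab fa fb]]] := contr_edge_lift f zu.
have bA : b \in A by rewrite inA fb; move: gu; rewrite inE.
have aA : a \in A by rewrite inA fa -inA.
apply: connect_trans (fib z a zA (esym fa)) _.
apply: (@connect_trans _ _ b); first by apply: connect1; apply/and3P.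
by apply: IH => //; rewrite fb.
Qed.

Definition contr_comp (T T' T'' : tree)
  (g : contraction T' T'') (f : contraction T T') : contraction T T'' :=
  Contraction (contr_comp_subproof g f).

Record tree_action (F : tree -> zmodType) := TreeAction {
  tact : forall T T' : tree, contraction T T' -> {additive F T' -> F T};
  act_id : forall T x, tact (contr_id T) x = x;
  act_comp : forall T T' T'' (f : contraction T T') (g : contraction T' T'') x,
    tact (contr_comp g f) x = tact f (tact g x)
}.

Record tree_module := TreeModule {
  obj :> tree -> zmodType;
  mact : tree_action obj
}.

Record tree_mor (M N : tree_module) := TreeMor {
  mor :> forall T, {additive M T -> N T};
  mor_nat : forall T T' (f : contraction T T') (x : M T'),
    mor T (tact (mact M) f x) = tact (mact N) f (mor T' x)
}.

Definition quotient_of (N M : tree_module) : Prop :=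
  exists p : tree_mor N M, forall T (y : M T), exists x, p T x = y.

Definition submodule_of (K N : tree_module) : Prop :=
  exists j : tree_mor K N, forall T, injective (j T).

Definition subquotient_of (N M : tree_module) : Prop :=
  exists K, submodule_of K N /\ quotient_of K M.

Section Principal.
Variable S : tree.

Definition principal_obj (T : tree) : zmodType := {ffun contraction T S -> int}.

(* The basis element g is sent to the basis element g \o f. *)
Definition principal_map (T T' : tree) (f : contraction T T')
    (c : principal_obj T') : principal_obj T :=
  [ffun h => \sum_(g : contraction T' S | contr_comp g f == h) c g].

Lemma principal_map_additive T T' (f : contraction T T') :
  zmod_morphism (principal_map f).
Proof.
move=> c d; apply/ffunP => h; rewrite !ffunE -sumrB.
by apply: eq_bigr => g _; rewrite !ffunE.
Qed.

HB.instance Definition _ T T' (f : contraction T T') :=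
  GRing.isZmodMorphism.Build (principal_obj T') (principal_obj T)
    (principal_map f) (principal_map_additive f).

Lemma principal_map_id T x : principal_map (contr_id T) x = x.
Proof.
apply/ffunP => h; rewrite ffunE (big_pred1 h) // => g /=.
congr (_ == _); apply/val_inj/ffunP => v /=; by rewrite !ffunE.
Qed.

Lemma principal_map_comp T T' T'' (f : contraction T T')
    (g : contraction T' T'') x :
  principal_map (contr_comp g f) x = principal_map f (principal_map g x).
Proof.
apply/ffunP => h; rewrite !ffunE.
transitivity (\sum_(k | contr_comp k f == h)
    \sum_(l | contr_comp l g == k) x l); last first.
  by apply: eq_bigr => k _; rewrite ffunE.
have compA l : contr_comp l (contr_comp g f) = contr_comp (contr_comp l g) f.
  by apply/val_inj/ffunP => v /=; rewrite !ffunE.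
rewrite (partition_big (fun l => contr_comp l g)
  (fun k => contr_comp k f == h)) /=; last by move=> l; rewrite compA.
apply: eq_bigr => k /eqP kh; apply: eq_bigl => l; rewrite compA.
by case: (eqVneq (contr_comp l g) k) => [->|_]; rewrite ?kh ?eqxx ?andbF.
Qed.

Definition principal : tree_module :=
  TreeModule (@TreeAction principal_obj
    (fun T T' f => principal_map f : {additive _ -> _})
    principal_map_id principal_map_comp).

End Principal.

(* The index type is finite, so the direct sum is the product. *)
Definition dsum_obj (I : finType) (U : I -> zmodType) : Type := forall i, U i.

Section DsumObj.
Variables (I : finType) (U : I -> zmodType).
Local Notation D := (dsum_obj U).

HB.instance Definition _ := gen_eqMixin D.
HB.instance Definition _ := gen_choiceMixin D.

Let zero : D := fun=> 0.
Let opp (x : D) : D := fun i => - x i.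
Let add (x y : D) : D := fun i => x i + y i.

Lemma dsum_addA : associative add.
Proof. by move=> x y z; apply: functional_extensionality_dep => i; exact: addrA. Qed.
Lemma dsum_addC : commutative add.
Proof. by move=> x y; apply: functional_extensionality_dep => i; exact: addrC. Qed.
Lemma dsum_add0 : left_id zero add.
Proof. by move=> x; apply: functional_extensionality_dep => i; exact: add0r. Qed.
Lemma dsum_addN : left_inverse zero opp add.
Proof. by move=> x; apply: functional_extensionality_dep => i; exact: addNr. Qed.

HB.instance Definition _ :=
  GRing.isZmodule.Build D dsum_addA dsum_addC dsum_add0 dsum_addN.
End DsumObj.

Section Dsum.
Variables (I : finType) (M : I -> tree_module).

Definition dsum_map (T T' : tree) (f : contraction T T')
    (x : dsum_obj (fun i => M i T')) : dsum_obj (fun i => M i T) :=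
  fun i => tact (mact (M i)) f (x i).

Lemma dsum_map_additive T T' (f : contraction T T') :
  zmod_morphism (dsum_map f).
Proof.
by move=> x y; apply: functional_extensionality_dep => i; exact: raddfB.
Qed.

HB.instance Definition _ T T' (f : contraction T T') :=
  GRing.isZmodMorphism.Build (dsum_obj (fun i => M i T'))
    (dsum_obj (fun i => M i T)) (dsum_map f) (dsum_map_additive f).

Lemma dsum_map_id T x : dsum_map (contr_id T) x = x.
Proof. by apply: functional_extensionality_dep => i; exact: act_id. Qed.

Lemma dsum_map_comp T T' T'' (f : contraction T T')
    (g : contraction T' T'') x :
  dsum_map (contr_comp g f) x = dsum_map f (dsum_map g x).
Proof. by apply: functional_extensionality_dep => i; exact: act_comp. Qed.

Definition dsum : tree_module :=
  TreeModule (@TreeAction (fun T => dsum_obj (fun i => M i T) : zmodType)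
    (fun T T' f => dsum_map f : {additive _ -> _}) dsum_map_id dsum_map_comp).

End Dsum.

Definition finitely_generated (M : tree_module) : Prop :=
  exists (r : nat) (S : 'I_r -> tree),
    quotient_of (dsum (fun j => principal (S j))) M.

Definition generated_in_degrees_le (d : nat) (M : tree_module) : Prop :=
  exists (r : nat) (S : 'I_r -> tree),
    (forall j, (#|{: edge (S j)}| <= d)%N) /\
    quotient_of (dsum (fun j => principal (S j))) M.

Definition small (d : nat) (M : tree_module) : Prop :=
  exists N, generated_in_degrees_le d N /\ subquotient_of N M.

Section Subquotient.
Variables (U : zmodType) (Z B : zmodClosed U).

Definition subgrp : predArgType := {x : U | x \in Z}.

HB.instance Definition _ := [isSub of subgrp for (@sval U _)].
HB.instance Definition _ := [Choice of subgrp by <:].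
HB.instance Definition _ := [SubChoice_isSubZmodule of subgrp by <:].

Definition sub_pred : {pred subgrp} := fun x => val x \in B.

Lemma sub_pred_closed : zmod_closed sub_pred.
Proof.
split=> [|x y xB yB]; rewrite unfold_in /sub_pred ?raddf0 ?rpred0 //.
by rewrite raddfB rpredB.
Qed.

HB.instance Definition _ :=
  GRing.isZmodClosed.Build subgrp sub_pred sub_pred_closed.

(* The group Z / (Z :&: B). *)
Definition subquotient : zmodType := Quotient.quot sub_pred.

Definition subquotient_class (x : subgrp) : subquotient :=
  \pi_(Quotient.quot sub_pred) x.

End Subquotient.

Definition spanned (A : comNzRingType) (U : lmodType A) (G : U -> Prop) (x : U) :=
  exists (r : nat) (a : 'I_r -> A) (g : 'I_r -> U),
    (forall j, G (g j)) /\ x = \sum_j a j *: g j.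

Lemma spanned_zmod (A : comNzRingType) (U : lmodType A) (G : U -> Prop) :
  spanned G 0 /\ forall x y, spanned G x -> spanned G y -> spanned G (x - y).
Proof.
split; first by exists 0, (fun=> 0), (fun=> 0); split; [case | rewrite big_ord0].
move=> _ _ [r [a [g [Gg ->]]]] [r' [a' [g' [Gg' ->]]]].
exists (r + r')%N, (fun j => match fintype.split j with inl k => a k | inr k => - a' k end),
  (fun j => match fintype.split j with inl k => g k | inr k => g' k end); split.
  by move=> j; case: (fintype.split j).
rewrite big_split_ord /=; congr (_ + _); rewrite -?sumrN; apply: eq_bigr => k _.
  by have /= -> := unsplitK (inl k : 'I_r + 'I_r').
by have /= -> := unsplitK (inr k : 'I_r + 'I_r'); rewrite scaleNr.
Qed.

Section Swiatkowski.
Variable T : tree.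

Definition edge_ring : comNzRingType := {malg int[{cmonom edge T}]}.

Definition edge_var (e : edge T) : edge_ring := << ucm e >>.

(* S(v) sits inside the free module on option (edge T): None is the empty
   symbol and Some e, for e containing v, is the half-edge (v, e). The
   submodule S~(v) is sw_reduced_local v below. *)
Definition local_mod : lmodType edge_ring :=
  {ffun option (edge T) -> edge_ring^o}.

Definition symb (a : option (edge T)) : local_mod :=
  [ffun b => (a == b)%:R].

Definition local_gen (v : T) (y : local_mod) : Prop :=
  y = symb None \/
  exists e e' : edge T,
    [/\ v \in val e, v \in val e' & y = symb (Some e) - symb (Some e')].

Definition sw_reduced_local (v : T) : local_mod -> Prop := spanned (local_gen v).

(* The tensor product over all v of the modules S(v) is free on the families
   of symbols, one at each vertex. As S~(v) is a direct summand of S(v), the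
   tensor product of the S~(v) is the submodule spanned by the pure tensors
   of elements of the S~(v). The tensor factors are ordered by vrank. *)
Definition state : finType := {ffun T -> option (edge T)}.

Definition tensor_mod : lmodType edge_ring := {ffun state -> edge_ring^o}.

Definition basis_tensor (s : state) : tensor_mod := [ffun t => (s == t)%:R].

Definition pure_tensor (y : T -> local_mod) : tensor_mod :=
  [ffun s : state => \prod_v y v (s v)].

Definition sw_reduced : tensor_mod -> Prop :=
  spanned (fun x => exists y, (forall v, sw_reduced_local v (y v)) /\
                           x = pure_tensor y).

Definition occupied (s : state) : {set T} := finset (fun v => s v != None).

Definition vrank (v : T) : nat := enum_rank v.

Definition state_erase (s : state) (v : T) : state :=
  [ffun w => if w == v then None else s w].

Definition koszul_sign (s : state) (v : T) : edge_ring :=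
  (-1) ^+ #|[set u in occupied s | (vrank u < vrank v)%N]|.

(* The formula h |-> e(h) on half-edges restricts to
   h - h' |-> e(h) - e(h') on each S~(v); this is its extension to the tensor
   product by the Koszul sign rule. *)
Definition sw_diff (x : tensor_mod) : tensor_mod :=
  \sum_(s : state) \sum_(v : T)
    if s v is Some e
    then (koszul_sign s v * edge_var e * x s) *: basis_tensor (state_erase s v)
    else 0.

Definition bihomogeneous (i n : nat) (x : tensor_mod) : Prop :=
  forall (s : state) (m : {cmonom edge T}), mcoeff m (x s) != 0 ->
    #|occupied s| = i /\ (mdeg m + #|occupied s|)%N = n.

Definition sw_cycle_prop (n i : nat) (x : tensor_mod) : Prop :=
  [/\ sw_reduced x, bihomogeneous i n x & sw_diff x = 0].

Definition sw_boundary_prop (n i : nat) (x : tensor_mod) : Prop :=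
  exists y, [/\ sw_reduced y, bihomogeneous i.+1 n y & x = sw_diff y].

Lemma sw_diff_zmod : zmod_morphism sw_diff.
Proof.
move=> x y; rewrite /sw_diff -sumrB; apply: eq_bigr => s _.
rewrite -sumrB; apply: eq_bigr => v _; case: (s v) => [e|]; last by rewrite subr0.
by rewrite !ffunE mulrDr mulrN scalerBl.
Qed.

HB.instance Definition _ :=
  GRing.isZmodMorphism.Build tensor_mod tensor_mod sw_diff sw_diff_zmod.

Lemma bihomogeneous_zmod i n :
  bihomogeneous i n 0 /\ forall x y,
    bihomogeneous i n x -> bihomogeneous i n y -> bihomogeneous i n (x - y).
Proof.
split=> [s m|x y hx hy s m]; first by rewrite ffunE mcoeff0 eqxx.
rewrite !ffunE mcoeffB; have [-> | xm _] := eqVneq (mcoeff m (x s)) 0.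
  by rewrite sub0r oppr_eq0 => /hy.
exact: hx xm.
Qed.

Definition sw_cycles (n i : nat) : {pred tensor_mod} :=
  fun x => `[< sw_cycle_prop n i x >].

Definition sw_boundaries (n i : nat) : {pred tensor_mod} :=
  fun x => `[< sw_boundary_prop n i x >].

Lemma sw_cycles_closed n i : zmod_closed (sw_cycles n i).
Proof.
have [r0 rB] := spanned_zmod (fun x => exists y,
  (forall v, sw_reduced_local v (y v)) /\ x = pure_tensor y).
have [h0 hB] := bihomogeneous_zmod i n.
split=> [|x y /asboolP[rx hx dx] /asboolP[ry hy dy]]; apply/asboolP.
  by split => //; rewrite raddf0.
by split; [exact: rB | exact: hB | rewrite raddfB /= dx dy subr0].
Qed.

Lemma sw_boundaries_closed n i : zmod_closed (sw_boundaries n i).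
Proof.
have [r0 rB] := spanned_zmod (fun x => exists y,
  (forall v, sw_reduced_local v (y v)) /\ x = pure_tensor y).
have [h0 hB] := bihomogeneous_zmod i.+1 n.
split=> [|x y /asboolP[x' [rx hx ->]] /asboolP[y' [ry hy ->]]]; apply/asboolP.
  by exists 0; split; rewrite ?raddf0.
by exists (x' - y'); split; [exact: rB | exact: hB | rewrite raddfB].
Qed.

HB.instance Definition _ n i :=
  GRing.isZmodClosed.Build tensor_mod (sw_cycles n i) (sw_cycles_closed n i).
HB.instance Definition _ n i :=
  GRing.isZmodClosed.Build tensor_mod (sw_boundaries n i) (sw_boundaries_closed n i).

Definition sw_cycle (n i : nat) : Type := subgrp (sw_cycles n i).

(* Degree i is the homological degree, n the number of strands. *)
Definition sw_homology (n i : nat) : zmodType :=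
  subquotient (sw_cycles n i) (sw_boundaries n i).

Definition sw_class (n i : nat) (z : sw_cycle n i) : sw_homology n i :=
  subquotient_class (sw_boundaries n i) z.

End Swiatkowski.

Section Pullback.
Variables (T T' : tree) (f : contraction T T').

Definition contracted : {set edge T} :=
  finset (fun e : edge T => #|f @: val e| == 1%N).

(* For a contraction of trees, the edge of T with image e' exists and is
   unique. *)
Definition edge_lift (e' : edge T') : option (edge T) :=
  [pick e : edge T | f @: val e == val e'].

Definition edge_map (a : edge_ring T') : edge_ring T :=
  mmap (fun c : int => c%:~R)
    (fun m : {cmonom edge T'} => \prod_(e' : edge T')
       (if edge_lift e' is Some e then edge_var e else 0) ^+ m e') a.

(* Suppose f contracts at most one edge. For the half-edge h' = (v', e') of s'
   at v' = f v, the corresponding half-edge h of T is (v, e) for the endpoint v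
   of the lift e of e' with f v = v'; there h' contributes h, minus the
   half-edge of the contracted edge if v is an endpoint of it. The other
   vertices over v' get the empty symbol. *)
Definition lifted (s' : state T') (v : T) : option (edge T) :=
  if s' (f v) is Some e' then
    if edge_lift e' is Some e then
      if v \in val e then Some e else None
    else None
  else None.

Definition pull_factor (s' : state T') (v : T) : local_mod T :=
  if lifted s' v is Some e
  then symb (Some e) - \sum_(k in contracted | v \in val k) symb (Some k)
  else symb None.

(* Koszul sign of reordering the odd factors from the order of the vertices
   of T' to that of the vertices of T. *)
Definition pull_sign (s' : state T') : edge_ring T :=
  (-1) ^+ #|[set p : T * T | [&& lifted s' p.1 != None, lifted s' p.2 != None,
     (vrank p.1 < vrank p.2)%N & (vrank (f p.2) < vrank (f p.1))%N]]|.

Definition sw_pull (x : tensor_mod T') : tensor_mod T :=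
  \sum_(s' : state T')
    (pull_sign s' * edge_map (x s')) *: pure_tensor (pull_factor s').

Definition induced_by_pull (n i : nat)
    (F : sw_homology T' n i -> sw_homology T n i) : Prop :=
  forall z' : sw_cycle T' n i, exists z : sw_cycle T n i,
    val z = sw_pull (val z') /\ F (sw_class z') = sw_class z.

End Pullback.

(* Every contraction is a composite of simple contractions and isomorphisms,
   so at most one action satisfies this. *)
Definition sw_action (n i : nat)
    (M : tree_action (fun T => sw_homology T n i)) : Prop :=
  forall (T T' : tree) (f : contraction T T'),
    (#|contracted f| <= 1)%N -> induced_by_pull f (tact M f).

Local Open Scope classical_set_scope.

Section Topology.
Variable R : realType.

(* Barycentric coordinates; as a tree has no triangles, the support condition
   says that t lies in a closed edge or is a vertex. *)
Definition realization_set (T : tree) : set {ptws T -> R} :=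
  [set t | [/\ forall v, 0 <= t v, \sum_v t v = 1 &
     forall u v, t u != 0 -> t v != 0 -> u = v \/ adj u v]].

Definition realization (T : tree) : topologicalType :=
  set_type (@realization_set T).

Definition conf (n : nat) (X : topologicalType) : topologicalType :=
  set_type [set x : {ptws 'I_n -> X} | injective x].

Definition conf_rel (n : nat) (X : topologicalType) : rel (conf n X) :=
  fun x y => `[< exists p : 'S_n, forall a, set_val y a = set_val x (p a) >].

Lemma conf_rel_equiv n X : equiv_class_of (@conf_rel n X).
Proof.
split=> [x|x y|y x z].
- by apply/asboolP; exists 1%g => a; rewrite perm1.
- apply/asboolP/asboolP => -[p h]; exists p^-1%g => a; by rewrite h permKV.
- move=> /asboolP[p h] /asboolP[q k]; apply/asboolP; exists (q * p)%g => a.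
  by rewrite k h permM.
Qed.

Canonical conf_equiv n X := EquivRelPack (conf_rel_equiv n X).

Definition uconf (n : nat) (X : topologicalType) : topologicalType :=
  quotient_topology {eq_quot conf_equiv n X}.

Definition simplex_set (i : nat) : set {ptws 'I_i.+1 -> R} :=
  [set t | (forall j, 0 <= t j) /\ \sum_j t j = 1].

Definition simplex (i : nat) : topologicalType :=
  set_type (@simplex_set i).

Definition face_fun (i : nat) (j : 'I_i.+2) (t : {ptws 'I_i.+1 -> R}) :
    {ptws 'I_i.+2 -> R} :=
  fun k => if unlift j k is Some k' then t k' else 0.

Lemma face_subproof i (j : 'I_i.+2) (t : simplex i) :
  face_fun j (set_val t) \in @simplex_set i.+1.
Proof.
have [t0 t1] := set_mem (valP t).
apply/mem_set; split=> [k|].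
  by rewrite /face_fun; case: unlift => [k'|//]; exact: t0.
rewrite (bigD1_ord j) //= {1}/face_fun unlift_none add0r -t1.
by apply: eq_bigr => k _; rewrite /face_fun liftK.
Qed.

Definition face (i : nat) (j : 'I_i.+2) (t : simplex i) : simplex i.+1 :=
  exist _ (face_fun j (set_val t)) (face_subproof j t).

Lemma face_continuous i (j : 'I_i.+2) : continuous (face j).
Proof.
apply/continuousP => _ [B oB <-].
suff /continuousP : continuous (fun t : simplex i => face_fun j (set_val t)).
  by apply.
move=> x; apply/cvg_sup; first exact/fmap_filter/nbhs_filter.
move=> k.
move: x; apply/(@continuousP _ (initial_topology (@^~ k))) => _ [C oC <-].
suff /continuousP : continuous (fun t : simplex i => face_fun j (set_val t) k).
  by apply.
rewrite /face_fun; case: unlift => [k'|]; last exact: cst_continuous.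
move=> x; apply: (@continuous_comp _ _ _ (set_val : simplex i -> _) (proj k')).
  exact: initial_continuous.
exact: proj_continuous.
Qed.

Section Singular.
Variable X : topologicalType.

Definition sing_chain (i : nat) : zmodType := {malg int[continuousType (simplex i) X]}.

Definition sing_face (i : nat) (s : continuousType (simplex i.+1) X)
    (j : 'I_i.+2) : continuousType (simplex i) X :=
  s \o mkcts (@face_continuous i j).

Definition sing_diff (i : nat) (c : sing_chain i.+1) : sing_chain i :=
  \sum_(s <- msupp c)
    (\sum_(j < i.+2) << (-1) ^+ j *g sing_face s j >>) *~ mcoeff s c.

Lemma sing_diff_zmod i : zmod_morphism (@sing_diff i).
Proof.
have sdE (d : {fset continuousType (simplex i.+1) X}) (c : sing_chain i.+1) :
    (msupp c `<=` d)%fset -> sing_diff c =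
    \sum_(s <- d) (\sum_(j < i.+2) << (-1) ^+ j *g sing_face s j >>) *~ mcoeff s c.
  move=> cd; rewrite /sing_diff (big_fset_incl _ cd) // => s _ /mcoeff_outdom ->.
  by rewrite mulr0z.
move=> x y; pose d := (msupp x `|` msupp y)%fset.
rewrite (sdE d) ?msuppB_le // (sdE d x) ?fsubsetUl // (sdE d y) ?fsubsetUr //.
by rewrite -sumrB; apply: eq_bigr => s _; rewrite mcoeffB mulrzBr.
Qed.

HB.instance Definition _ i :=
  GRing.isZmodMorphism.Build (sing_chain i.+1) (sing_chain i) (@sing_diff i)
    (@sing_diff_zmod i).

Definition sing_cycles (i : nat) : {pred sing_chain i} :=
  match i with
  | 0 => fun=> true
  | i'.+1 => fun c => sing_diff c == 0
  end.

Definition sing_boundaries (i : nat) : {pred sing_chain i} :=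
  fun c => `[< exists b : sing_chain i.+1, c = sing_diff b >].

Lemma sing_cycles_closed i : zmod_closed (@sing_cycles i).
Proof.
case: i => [//|i]; split=> [|x y /eqP x0 /eqP y0]; apply/eqP.
  by rewrite raddf0.
by rewrite raddfB /= x0 y0 subr0.
Qed.

Lemma sing_boundaries_closed i : zmod_closed (@sing_boundaries i).
Proof.
split=> [|x y /asboolP[b ->] /asboolP[c ->]]; apply/asboolP.
  by exists 0; rewrite raddf0.
by exists (b - c); rewrite raddfB.
Qed.

HB.instance Definition _ i :=
  GRing.isZmodClosed.Build (sing_chain i) (@sing_cycles i) (@sing_cycles_closed i).
HB.instance Definition _ i :=
  GRing.isZmodClosed.Build (sing_chain i) (@sing_boundaries i)
    (@sing_boundaries_closed i).

Definition sing_homology (i : nat) : zmodType :=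
  subquotient (@sing_cycles i) (@sing_boundaries i).

End Singular.

Definition uconf_homology (n i : nat) (T : tree) : zmodType :=
  sing_homology (uconf n (realization T)) i.

(* M is an action on the homology of UConf_n transported from the reduced
   Swiatkowski complex along isomorphisms theta. The reduced complex computes
   the homology of UConf_n only for graphs without isolated vertices: for the
   one-vertex tree and (i, n) = (0, 1) the two homology groups differ. So
   nothing is required there, and the maps out of the value of M at the
   one-vertex tree may be arbitrary. *)
Definition uconf_action (n i : nat)
    (M : tree_action (uconf_homology n i)) : Prop :=
  exists theta : forall T, {additive uconf_homology n i T -> sw_homology T n i},
    (forall T, (0 < #|{: edge T}|)%N -> bijective (theta T)) /\
    forall (T T' : tree) (f : contraction T T'),
      (0 < #|{: edge T'}|)%N -> (#|contracted f| <= 1)%N ->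
      exists F : sw_homology T' n i -> sw_homology T n i,
        induced_by_pull f F /\
        forall x, theta T (tact M f x) = F (theta T' x).

End Topology.

(* Main.v *)
Require Import Defs.
From HB Require Import structures.
From mathcomp Require Import all_boot all_order all_algebra.
From mathcomp Require Import generic_quotient ring_quotient.
From mathcomp Require Import finmap monalg zify.
From mathcomp Require Import all_classical all_reals all_analysis.
(* Again, because the analysis library has its own [contraction]. *)
Require Import Defs.

Set Implicit Arguments.
Unset Strict Implicit.
Unset Printing Implicit Defensive.

Import Order.TTheory GRing.Theory Num.Theory.
Local Open Scope ring_scope.

(** Give each tree a root and let [up v] be the edge at [v] towards it. In the
    coordinates [e - up v], for the other edges [e] at [v], the reduced complex
    is a tensor product over the vertices of complexes that have a contracting
    homotopy onto the span of [1] and of the elements [star3 (up v, a, b)], which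
    are cycles supported at [v]. Hence, up to boundaries, every cycle is an
    integral combination of products of a monomial with such star cycles at
    distinct vertices. In bidegree [(i, n)] there are [i] stars, with three edges
    each, and the monomial has degree [n - 2 i], so at most [n + i] edges occur. An
    edge that does not occur is [up v] for one of its ends [v], so this end
    carries no star, and the product is the image of a similar product under the
    contraction of that edge. Therefore the module is generated by its values on
    trees with at most [n + i] edges, and no Noetherianity is needed.

    The structure maps exist because the maps of the simple contractions agree
    on the reduced complex with [chain_pull], which is strictly functorial. *)

(** * Separation in trees *)

(** The local complex at [v] is the bottom of a Koszul complex: its variables are the edges of
    [down v], and its cycles in degree one are the syzygies of these variables, generated by the
    relations between two of them, which are the stars. An edge is non-rootward at one end at most,
    so different vertices use different variables, and the homotopies do not disturb each other. The
    edge chosen at the root lies in no [down v] and stays a free variable.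

    The map of a simple contraction subtracts the contracted half-edge at the same vertex and is
    given for one contracted edge only. Adding instead the contracted half-edge at the other end
    changes the image of a half-edge by a term independent of it, invisible on differences, and this
    version has a formula for all contractions.

    For configuration spaces, the maps out of the one-vertex tree are arbitrary, so the descent must
    not contract the last edge. This matters only for [n + i = 0]: there the module need not be
    generated in degree 0 and is a genuine subquotient. *)

Lemma neq_adj (T : tree) (x y : T) : adj x y -> x != y.
Proof. by apply: contraTneq => ->; rewrite adj_irr. Qed.

Section TreeSeparation.
Variable T : tree.
Implicit Types (x y z u v : T) (k j e : edge T).

Lemma mk_edge_subproof u v : adj u v ->
  [exists x : T, exists y : T, adj x y && ([set u; v]%SET == [set x; y]%SET)].
Proof.
by move=> uv; apply/existsP; exists u; apply/existsP; exists v; rewrite uv eqxx.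
Qed.

Definition mk_edge u v (uv : adj u v) : edge T := Sub [set u; v]%SET (mk_edge_subproof uv).

Lemma edgeP k : exists u v, adj u v /\ val k = [set u; v]%SET.
Proof.
by case: k => E /= /existsP[u /existsP[v /andP[uv /eqP->]]]; exists u, v.
Qed.

Lemma edge_at k x : x \in val k -> exists y, adj x y /\ val k = [set x; y]%SET.
Proof.
have [u [v [uv ->]]] := edgeP k.
case/set2P => ->; first by exists v.
by exists u; rewrite adj_sym finset.setUC.
Qed.

Lemma card_edge k : #|val k| = 2.
Proof. by have [u [v [uv ->]]] := edgeP k; rewrite cards2 neq_adj. Qed.

Lemma adj_edge u v k : val k = [set u; v]%SET -> adj u v.
Proof.
have [x [y [xy ->]]] := edgeP k => E.
have xE : x \in [set u; v]%SET by rewrite -E set21.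
have yE : y \in [set u; v]%SET by rewrite -E set22.
have uE : u \in [set x; y]%SET by rewrite E set21.
have vE : v \in [set x; y]%SET by rewrite E set22.
have n := neq_adj xy.
case/set2P: xE => xE; case/set2P: yE => yE; subst x y => //.
- by rewrite eqxx in n.
- by rewrite adj_sym.
- by rewrite eqxx in n.
Qed.

Definition adjx k : rel T := [rel u v | adj u v && ([set u; v]%SET != val k)].

Definition sep k x y := ~~ connect (adjx k) x y.

Lemma adjxE k u v : adjx k u v = adj u v && ([set u; v]%SET != val k).
Proof. by []. Qed.

Lemma adjx_sym k : symmetric (adjx k).
Proof. by move=> u v; rewrite !adjxE [adj u v]adj_sym finset.setUC. Qed.

Lemma adjx_edge e j u v : val e = [set u; v]%SET -> j != e -> adjx j u v.
Proof.
move=> eE n; rewrite adjxE (adj_edge eE) -eE.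
by apply: contraNneq n => /val_inj->.
Qed.

Lemma cutC k x y : connect (adjx k) x y = connect (adjx k) y x.
Proof. exact: sym_connect_sym (adjx_sym k) _ _. Qed.

Lemma sepC k x y : sep k x y = sep k y x.
Proof. by rewrite /sep cutC. Qed.

Lemma cut_trans k x y z :
  connect (adjx k) x y -> connect (adjx k) y z -> connect (adjx k) x z.
Proof. exact: connect_trans. Qed.

Lemma sep_trans k x y z : sep k x y -> connect (adjx k) y z -> sep k x z.
Proof. by move=> xy yz; apply: contra xy => /cut_trans; apply; rewrite cutC. Qed.

(** A simple path from [u] to [v] that avoids [k] has at least two steps, so [k] closes it up to a
    cycle. *)
Lemma sep_bridge k u v : val k = [set u; v]%SET -> sep k u v.
Proof.
move=> kE; have uv := adj_edge kE.
apply/negP => /connectP[p0 pp0 vE0]; move: vE0.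
case/shortenP: pp0 => p pp up _ vE.
case: p => [|a [|b p]] in pp up vE *.
- by rewrite /= in vE; rewrite vE adj_irr in uv.
- by rewrite /= in vE pp; subst a; rewrite adjxE uv kE eqxx in pp.
- case: (@tree_acyclic T [:: u, a, b & p]) => //.
  apply/andP; split => //.
  suff: path (@adj T) u (rcons [:: a, b & p] u) by [].
  rewrite rcons_path; apply/andP; split; last by rewrite -vE adj_sym.
  by apply: sub_path pp => x y /andP[].
Qed.

(** Along a path from [u], the component changes only when [k] is crossed, and then the path stands
    at an end of [k]. *)
Lemma cut_cover k u v x : val k = [set u; v]%SET ->
  connect (adjx k) u x || connect (adjx k) v x.
Proof.
move=> kE; have /connectP[p pp ->] := tree_connected u x.
elim/last_ind: p pp => [|p y IH]; first by rewrite /= connect0.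
rewrite rcons_path last_rcons => /andP[/IH h py].
have [E|n] := eqVneq [set last u p; y]%SET (val k); last first.
  have l : connect (adjx k) (last u p) y by apply: connect1; rewrite adjxE py.
  by case/orP: h => /connect_trans -> //; rewrite orbT.
have : y \in [set u; v]%SET by rewrite -kE -E set22.
by case/set2P => ->; rewrite connect0 ?orbT.
Qed.

Lemma sep_other k u v x : val k = [set u; v]%SET ->
  sep k u x -> connect (adjx k) v x.
Proof. by move=> kE; have := cut_cover x kE; rewrite /sep; case/orP => ->. Qed.

(** The component of [u] without [k] does not contain [x], so a path inside it uses no edge at [x],
    in particular not [j]. *)
Lemma cut_avoid k j u w x :
  connect (adjx k) u w -> sep k u x -> x \in val j -> connect (adjx j) u w.
Proof.
move=> /connectP[p pp ->] + xj.
elim: p u pp => [|a p IH] u /=; first by rewrite connect0.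
case/andP => /andP[ua n] pp ux.
have ax : sep k a x.
  rewrite sepC; apply: (@sep_trans _ _ u); first by rewrite sepC.
  by apply: connect1; rewrite adjxE ua.
apply: connect_trans (IH _ pp ax); apply: connect1; rewrite adjxE ua andTb.
apply: contraTneq xj => <-; apply/negP => /set2P[] E; move: ux ax;
  by rewrite -E /sep connect0.
Qed.

(** The first edge of a simple path works, since the rest of the path never returns to [x] and so
    does not use this edge again. *)
Lemma dir_exists x y : x != y -> exists2 k : edge T, x \in val k & sep k x y.
Proof.
move=> xy; have /connectP[p0 pp0 yE0] := tree_connected x y; move: yE0.
case/shortenP: pp0 => p pp up _ yE.
case: p => [|a p] in pp up yE *; first by rewrite yE eqxx in xy.
case/andP: pp => xa pp; exists (mk_edge xa); first by rewrite set21.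
apply: sep_trans (sep_bridge (erefl : val (mk_edge xa) = [set x; a]%SET)) _.
case/andP: up => xap _; apply/connectP; exists p => //; clear yE xy y.
have: x \in val (mk_edge xa) by rewrite set21.
move: (mk_edge xa) => k xk; elim: p a xap pp {xa} => [//|b p IH] c.
rewrite !inE !negb_or => /and3P[xc xb xp] /=/andP[cb pp].
rewrite adjxE cb andTb (IH b) ?inE ?negb_or ?xb // andbT.
by apply: contraTneq xk => <-; rewrite !inE negb_or xc xb.
Qed.

(** Beyond [k], the way from [x] to [y] uses no edge at [x], so removing another edge at [x] does
    not separate them. *)
Lemma dir_uniq x y k j : x \in val k -> sep k x y -> x \in val j -> sep j x y ->
  k = j.
Proof.
move=> xk kxy xj jxy; apply/eqP/negPn/negP => kj.
have [a [xa kE]] := edge_at xk.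
have ay := sep_other kE kxy.
have xa' : sep k a x by rewrite sepC; exact: sep_bridge.
have ayj := cut_avoid ay xa' xj.
move: jxy; rewrite /sep => /negP; apply; apply: connect_trans ayj.
by apply: connect1; rewrite adjxE xa andTb -kE; apply: contraNneq kj => /val_inj->.
Qed.

(* The first edge on the path from [v] to [y], and the first edge on the path
   from [v] through the edge [e]. *)
Definition dir v y : option (edge T) :=
  [pick k : edge T | (v \in val k) && sep k v y].

Lemma dirP v y k : reflect (v \in val k /\ sep k v y) (dir v y == Some k).
Proof.
rewrite /dir; case: pickP => [j /andP[vj jvy]|h]; apply: (iffP eqP) => //.
- by case=> <-.
- by case=> vk kvy; congr Some; apply: dir_uniq jvy _ _.
- by case=> vk kvy; move: (h k); rewrite vk kvy.
Qed.

Lemma dirNone v y : (dir v y == None) = (v == y).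
Proof.
have [->|n] := eqVneq v y.
  by apply/eqP; rewrite /dir; case: pickP => // k /andP[_]; rewrite /sep connect0.
have [k vk kvy] := dir_exists n.
by have /dirP/eqP-> : v \in val k /\ sep k v y.
Qed.

Lemma far_end v e : exists2 y, y \in val e & y != v.
Proof.
have [a [b [ab ->]]] := edgeP e; have [E|n] := eqVneq a v.
  by exists b; rewrite ?set22 // -E eq_sym neq_adj.
by exists a; rewrite ?set21.
Qed.

(* The first edge on a path that starts at [v] and runs through [e]. *)
Definition edge_dir v e : edge T :=
  odflt e [pick k : edge T | (v \in val k) &&
                             [forall y in val e, (y != v) ==> sep k v y]].

Lemma edge_dir_spec v e : v \in val (edge_dir v e) /\
  forall y, y \in val e -> y != v -> sep (edge_dir v e) v y.
Proof.
rewrite /edge_dir; case: pickP => [k /andP[vk /forall_inP h]|h] /=.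
  by split=> // y ye; apply/implyP; exact: h.
have [y ye yv] := far_end v e.
have [k vk kvy] : exists2 k : edge T, v \in val k & sep k v y.
  by apply: dir_exists; rewrite eq_sym.
suff : (v \in val k) && [forall y in val e, (y != v) ==> sep k v y] by rewrite h.
rewrite vk; apply/forall_inP => z ze; apply/implyP => zv.
(* Both ends of [e] lie on the same side of [k]: if they are distinct and differ from [v], then [e]
   does not contain [v] and is not [k]. *)
have [->//|zy] := eqVneq z y.
have [a [ya eE]] := edge_at ye.
have az : a = z by move: ze; rewrite eE => /set2P[] E //; rewrite E eqxx in zy.
subst a; apply: sep_trans kvy _; apply: connect1; rewrite adjxE ya -eE andTb.
apply: contraTneq vk => <-.
by rewrite eE !inE negb_or ![v == _]eq_sym yv.
Qed.

Lemma edge_dir_in v e : v \in val (edge_dir v e).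
Proof. by case: (edge_dir_spec v e). Qed.

Lemma edge_dir_sep v e y : y \in val e -> y != v -> sep (edge_dir v e) v y.
Proof. by case: (edge_dir_spec v e) => _; apply. Qed.

Lemma edge_dirE v e y k : y \in val e -> y != v -> v \in val k -> sep k v y ->
  edge_dir v e = k.
Proof.
move=> ye yv vk kvy; apply: dir_uniq (edge_dir_in v e) _ vk kvy.
exact: edge_dir_sep.
Qed.

Lemma edge_dir_id v e : v \in val e -> edge_dir v e = e.
Proof.
move=> ve; have [y [vy eE]] := edge_at ve.
apply: (@edge_dirE _ _ y) => //; first by rewrite eE set22.
  by rewrite eq_sym neq_adj.
exact: sep_bridge.
Qed.
End TreeSeparation.

(** * Edges under a contraction *)

Section ContractionEdges.
Variables (T T' : tree) (f : contraction T T').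
Implicit Types (x y u v : T) (k e : edge T).

Lemma contractedP k u v : val k = [set u; v]%SET ->
  (k \in contracted f) = (f u == f v).
Proof. by move=> kE; rewrite inE kE imsetU1 imset_set1 cards2 eqSS eqb0 negbK. Qed.

(** Every edge inside a fiber is contracted, so the paths that connect a fiber avoid [k]. *)
Lemma cut_fiber k x y : k \notin contracted f -> f x = f y -> connect (adjx k) x y.
Proof.
move=> kc /contr_fiber; apply: connect_sub => a b /and3P[ab].
rewrite !inE => /eqP fa /eqP fb; apply: connect1; rewrite adjxE ab.
apply: contraNneq kc => /esym kE; by rewrite (contractedP kE) fa fb.
Qed.

Lemma lift_exists (e' : edge T') : exists e, f @: val e == val e'.
Proof.
have [u [v [uv ->]]] := edgeP e'.
have [x [y [xy fx fy]]] := contr_edge_lift f uv.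
by exists (mk_edge xy); rewrite imsetU1 imset_set1 fx fy.
Qed.

Definition lift_edge (e' : edge T') : edge T := xchoose (lift_exists e').

Lemma lift_edgeP (e' : edge T') : f @: val (lift_edge e') = val e'.
Proof. exact/eqP/(xchooseP (lift_exists e')). Qed.

Lemma image_not_contracted e (e' : edge T') : f @: val e = val e' -> e \notin contracted f.
Proof. by move=> E; rewrite inE E card_edge. Qed.

Lemma lift_not_contracted (e' : edge T') : lift_edge e' \notin contracted f.
Proof. exact/image_not_contracted/lift_edgeP. Qed.

(** Two such edges would be joined at both ends through fibers, so the second would bypass the
    first, which is a bridge. *)
Lemma image_edge_inj e1 e2 : e1 \notin contracted f -> 
  f @: val e1 = f @: val e2 -> e1 = e2.
Proof.
have [p1 [q1 [pq1 E1]]] := edgeP e1; have [p2 [q2 [pq2 E2]]] := edgeP e2 => ec E.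
apply/eqP/negPn/negP => e12.
have n1 : f p1 != f q1 by rewrite -(contractedP E1).
(* The ends of the second edge are named so that they lie in the fibers of those of the first. *)
wlog [Ep Eq] : p2 q2 pq2 E2 / f p1 = f p2 /\ f q1 = f q2.
  move=> hw; have : f p1 \in f @: val e2 by rewrite -E E1 imset_f // set21.
  have : f q1 \in f @: val e2 by rewrite -E E1 imset_f // set22.
  rewrite E2 imsetU1 imset_set1 => /set2P[] h2 /set2P[] h1.
  - by rewrite h1 h2 eqxx in n1.
  - by apply: (hw q2 p2) => //; [rewrite adj_sym | rewrite finset.setUC].
  - exact: (hw p2 q2).
  - by rewrite h1 h2 eqxx in n1.
have := sep_bridge E1; rewrite /sep => /negP; apply.
apply: connect_trans (cut_fiber ec Ep) _.
apply: connect_trans (cut_fiber ec (esym Eq)).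
by apply: connect1; rewrite adjxE pq2 -E2 eq_sym; apply: contraNneq e12 => /val_inj->.
Qed.

Lemma lift_edgeE e (e' : edge T') : f @: val e = val e' -> lift_edge e' = e.
Proof.
move=> E; apply: image_edge_inj; first exact: lift_not_contracted.
by rewrite E lift_edgeP.
Qed.

Lemma lift_edge_inj : injective lift_edge.
Proof. by move=> e1 e2 E; apply: val_inj; rewrite -!lift_edgeP E. Qed.

Lemma edge_liftE (e' : edge T') : edge_lift f e' = Some (lift_edge e').
Proof.
rewrite /edge_lift; case: pickP => [e /eqP/lift_edgeE->//|/(_ (lift_edge e'))].
by rewrite lift_edgeP eqxx.
Qed.

Lemma push_edge e : e \notin contracted f -> exists e' : edge T', f @: val e = val e'.
Proof.
have [u [v [uv eE]]] := edgeP e; rewrite (contractedP eE) => n.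
have [E|fuv] := contr_adj f uv; first by rewrite E eqxx in n.
by exists (mk_edge fuv); rewrite eE imsetU1 imset_set1.
Qed.

Lemma lift_edge_surj e : e \notin contracted f -> exists e' : edge T', lift_edge e' = e.
Proof. by move=> /push_edge[e' /lift_edgeE]; exists e'. Qed.

Lemma lift_edge_at (e' : edge T') (v' : T') : v' \in val e' ->
  exists2 v, v \in val (lift_edge e') & f v = v'.
Proof. by rewrite -lift_edgeP => /imsetP[v]; exists v. Qed.

Lemma lift_edge_f (e' : edge T') v : v \in val (lift_edge e') -> f v \in val e'.
Proof. by move=> h; rewrite -lift_edgeP imset_f. Qed.

Lemma lift_edge_end_uniq (e' : edge T') u v : u \in val (lift_edge e') ->
  v \in val (lift_edge e') -> f u = f v -> u = v.
Proof.
move=> ul vl E; apply/eqP/negPn/negP => uv.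
have [w [uw lE]] := edge_at ul.
have vw : v = w by move: vl; rewrite lE => /set2P[] // h; rewrite h eqxx in uv.
by have := lift_not_contracted e'; rewrite (contractedP lE) E vw eqxx.
Qed.

(** A path avoiding the lift projects to one avoiding [k']: each step is collapsed or runs over an
    edge other than [k']. *)
Lemma sep_lift (k' : edge T') x y : sep k' (f x) (f y) -> sep (lift_edge k') x y.
Proof.
apply: contra => /connectP[p pp ->].
elim: p x pp => [|a p IH] x /=; first by rewrite connect0.
rewrite -/(adjx _ _ _) adjxE => /andP[/andP[xa n] /IH]; apply: connect_trans.
have [->//|fxa] := contr_adj f xa.
apply: connect1; rewrite adjxE fxa; apply: contra n => /eqP E.
by apply/eqP; rewrite (@lift_edgeE (mk_edge xa)) // imsetU1 imset_set1.
Qed.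

(** Looking for the first edge in two stages gives the same edge; this makes [dir_over] strictly
    functorial. Beyond the lift of [k'], the way from [v] to the lift of [e'] meets no edge at [v]
    any more, so it leaves [v] through the same edge [j]. *)
Lemma edge_dir_lift v (e' : edge T') :
  edge_dir v (lift_edge (edge_dir (f v) e')) = edge_dir v (lift_edge e').
Proof.
set k' := edge_dir (f v) e'; set j := edge_dir v (lift_edge k').
have [a' ae' av'] := far_end (f v) e'.
have [a al fa] := lift_edge_at ae'.
have fva : sep k' (f v) (f a) by rewrite fa edge_dir_sep.
have kva := sep_lift fva.
have [p pk fp] := lift_edge_at (edge_dir_in (f v) e').
have [q [pq kE]] := edge_at pk.
have fpq : f q != f v.
  by have := lift_not_contracted k'; rewrite (contractedP kE) fp eq_sym.
have qv : q != v by apply: contraNneq fpq => ->.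
have qk : q \in val (lift_edge k') by rewrite kE set22.
have jvq : sep j v q by exact: edge_dir_sep.
have vp : connect (adjx (lift_edge k')) v p.
  by apply: cut_fiber (lift_not_contracted _) _; rewrite fp.
have pa : sep (lift_edge k') p a.
  by rewrite sepC; apply: sep_trans vp; rewrite sepC.
have qa := sep_other kE pa.
have qvs : sep (lift_edge k') q v.
  apply: (@sep_trans _ _ _ p); last by rewrite cutC.
  by rewrite sepC; exact: sep_bridge.
have qaj := cut_avoid qa qvs (edge_dir_in v (lift_edge k')).
apply/esym/(@edge_dirE _ _ _ a) => //; last 2 first.
- exact: edge_dir_in.
- exact: sep_trans jvq qaj.
by apply: contraTneq kva => ->; rewrite /sep connect0.
Qed.

(** The fiber is a tree, and sending each of its vertices other than the end [r] of the lift to its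
    first edge towards [r] is a bijection onto the edges of the fiber. The second sum does not
    depend on [e'], so it cancels against coefficients of sum zero. *)
Lemma fiber_dir_sum (V : nmodType) (F : edge T -> V) (e' : edge T') (w : T') :
  w \in val e' ->
  \sum_(v | f v == w) F (edge_dir v (lift_edge e')) =
  F (lift_edge e') + \sum_(k : edge T | f @: val k == [set w]%SET) F k.
Proof.
move=> /lift_edge_at[r rl fr]; rewrite (bigD1 r) ?fr ?eqxx //=.
rewrite (edge_dir_id rl); congr (_ + _).
(* The inverse of this bijection: the end of a fiber edge that is farther from [r]. *)
pose c (k : edge T) := odflt r [pick v | (v \in val k) && sep k v r].
have cP k : f @: val k == [set w]%SET -> c k \in val k /\ sep k (c k) r.
  move=> /eqP kw; have [u [v [uv kE]]] := edgeP k; rewrite /c.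
  case: pickP => [x /andP[]//|h] /=; have := h u; have := h v.
  rewrite kE set21 set22 /= /sep => /negbFE vr /negbFE ur.
  have := sep_bridge kE; rewrite /sep => /negP[]; apply: connect_trans ur _.
  by rewrite cutC.
have cE k v : v \in val k -> sep k v r -> c k = v.
  move=> vk kv; rewrite /c; case: pickP => [x /andP[xk kx]|/(_ v)]; last by rewrite vk kv.
  apply/eqP/negPn/negP => /= xv.
  have [y [xy kE]] := edge_at xk.
  have yv : v = y by move: vk; rewrite kE => /set2P[] // h; rewrite h eqxx in xv.
  by have := cut_cover r kE; rewrite -yv; move: kx kv; rewrite /sep => /negPf-> /negPf->.
rewrite [RHS](reindex_onto (fun v => edge_dir v (lift_edge e')) c); last first.
  move=> k /cP[ck skr]; apply: (edge_dirE rl) => //.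
  by apply: contraTneq skr => <-; rewrite /sep connect0.
apply: eq_bigl => v; set d := edge_dir v _.
apply/andP/andP => [[/eqP fv vr]|[/eqP dw /eqP cd]].
  have dr : sep d v r by apply: edge_dir_sep; rewrite // eq_sym.
  have vd : v \in val d by exact: edge_dir_in.
  rewrite (cE _ _ vd dr) eqxx; split => //.
  have : d \in contracted f by apply/negPn/negP => /cut_fiber h; move: dr; rewrite /sep h // fr.
  rewrite inE => /cards1P[x E]; rewrite E eq_sym -fv.
  suff : f v \in [set x]%SET by rewrite inE => /eqP->.
  by rewrite -E imset_f.
have vd : v \in val d by exact: edge_dir_in.
split; first by apply/eqP/finset.set1P; rewrite -dw; exact: imset_f.
apply: contraNneq (lift_not_contracted e') => vr.
by rewrite inE -(edge_dir_id rl) -vr -/d dw cards1.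
Qed.

End ContractionEdges.

Lemma contr_id_edge (T : tree) (e : edge T) : lift_edge (contr_id T) e = e.
Proof.
apply: lift_edgeE; apply/finset.setP => x; apply/imsetP/idP => [[y ye ->]|xe].
  by rewrite ffunE.
by exists x; rewrite ?ffunE.
Qed.

Lemma contr_comp_edge (T T' T'' : tree) (g : contraction T' T'')
  (f : contraction T T') (e : edge T'') :
  lift_edge (contr_comp g f) e = lift_edge f (lift_edge g e).
Proof.
apply: lift_edgeE; rewrite -(lift_edgeP g) -(lift_edgeP f) -imset_comp.
by apply: eq_imset => x /=; rewrite ffunE.
Qed.

(** * Rooted trees *)

Section Rooted.
Variables (T : tree) (r : T).
Implicit Types (u v x y : T) (e j k : edge T).

(* The rootward edge at [v]; at the root, an arbitrary edge if there is one. *)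
Definition up v : option (edge T) :=
  if v == r then [pick e : edge T | r \in val e] else dir v r.

(** Indexes the basis of differences [e - up v] of half-edges at [v]. *)
Definition down v : {set edge T} :=
  finset (fun e : edge T => (v \in val e) && (Some e != up v)).

Lemma up_exists v e : v \in val e -> exists2 k : edge T, up v = Some k & v \in val k.
Proof.
move=> ve; rewrite /up; have [rv|vr] := eqVneq v r; last first.
  have := dirNone v r; rewrite (negPf vr); case E: (dir v r) => [k|] // _.
  by exists k => //; have /eqP/dirP[] := E.
subst v; case: pickP => [k kr|h]; first by exists k.
by move: (h e); rewrite ve.
Qed.

Lemma up_sep v e : v \in val e -> sep e v r -> up v = Some e.
Proof.
move=> ve s; rewrite /up; have [E|_] := eqVneq v r; last exact/eqP/dirP.
by move: s; rewrite E /sep connect0.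
Qed.

Lemma up_in v e : up v = Some e -> v \in val e.
Proof.
rewrite /up; have [->|_] := eqVneq v r; last by move/eqP/dirP => [].
by case: pickP => // k h [<-].
Qed.

Lemma rooted_ends e :
  exists a b, [/\ val e = [set a; b]%SET, connect (adjx e) a r & sep e b r].
Proof.
have [a [b [ab eE]]] := edgeP e; have := cut_cover r eE; have s := sep_bridge eE.
case: (boolP (connect (adjx e) a r)) => [ar _|ar /= br].
  exists a, b; split=> //; rewrite sepC.
  by apply: contra s => rb; apply: cut_trans ar rb.
by exists b, a; rewrite finset.setUC.
Qed.

Lemma edge_up_end e u v : val e = [set u; v]%SET -> up u = Some e \/ up v = Some e.
Proof.
have [a [b [eE _ br]]] := rooted_ends e => eE2.
have ub : up b = Some e by apply: up_sep => //; rewrite eE set22.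
have : b \in [set u; v]%SET by rewrite -eE2 eE set22.
by case/set2P => <-; [left | right].
Qed.

(** Makes the variables of the local complexes at different vertices disjoint. *)
Lemma down_uniq e u v : e \in down u -> e \in down v -> u = v.
Proof.
rewrite !inE => /andP[ue nu] /andP[ve nv]; apply/eqP/negPn/negP => uv.
have [w [uw eE]] := edge_at ue.
have vw : v = w by move: ve; rewrite eE => /set2P[] // h; rewrite h eqxx in uv.
by subst w; case: (edge_up_end eE) => E; move: nu nv; rewrite E eqxx // => _.
Qed.

Lemma down_exists e : up r != Some e -> exists v, e \in down v.
Proof.
move=> n; have [a [b [eE ar br]]] := rooted_ends e; exists a.
rewrite inE eE set21 /=; have [->|nar] := eqVneq a r; first by rewrite eq_sym.
apply/eqP => /esym; rewrite /up (negPf nar) => /eqP/dirP[_].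
by rewrite /sep ar.
Qed.

(* The edges on the path from [e] to the root, together with the edge chosen at
   the root. *)
Definition anc e : {set edge T} :=
  finset (fun j : edge T => (up r == Some j) ||
                   [exists b in val e, sep e b r && sep j b r]).

Lemma ancP e a b : val e = [set a; b]%SET -> connect (adjx e) a r -> sep e b r ->
  forall j, (j \in anc e) = (up r == Some j) || sep j b r.
Proof.
move=> eE ar br j; rewrite inE; congr (_ || _).
apply/exists_inP/idP => [[x]|jb]; last by exists b; rewrite ?br // eE set22.
by rewrite eE => /set2P[] -> /andP[] //; rewrite /sep ar.
Qed.

Lemma anc_root e : up r = Some e -> anc e = [set e]%SET.
Proof.
move=> re; have [a [b [eE ar br]]] := rooted_ends e.
apply/finset.setP => j; rewrite (ancP eE ar br) finset.in_set1 re.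
have arE : a = r.
  have : r \in val e by exact: up_in.
  by rewrite eE => /set2P[->//|E]; move: br; rewrite -E /sep connect0.
have [[->]|n] := eqVneq (Some e) (Some j); first by rewrite eqxx.
have ej : j == e = false by apply: contraNF n => /eqP->.
rewrite ej orFb -arE sepC; apply/negbTE; rewrite negbK connect1 //.
by apply: adjx_edge eE _; rewrite ej.
Qed.

(** This recursion makes the change of coordinates unitriangular: the way from [e] to the root is
    [e] followed by the way from the rootward edge at its upper end [v]. *)
Lemma anc_down v e k : e \in down v -> up v = Some k ->
  anc e = (e |: anc k)%SET /\ e \notin anc k.
Proof.
rewrite inE => /andP[ve nv] vk; rewrite vk in nv.
have [a [b [eE ar br]]] := rooted_ends e.
have ub : up b = Some e by apply: up_sep => //; rewrite eE set22.
have {ve} va : v = a.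
  by move: ve; rewrite eE => /set2P[] // E; move: nv; rewrite -vk E ub eqxx.
(* At the root, only the chosen edge [k] comes after [e]. *)
subst v; have [E|nar] := eqVneq a r.
  have anck : anc k = [set k]%SET by apply: anc_root; rewrite -E.
  rewrite anck finset.in_set1; split; last by apply: contraNneq nv => ->.
  apply/finset.setP => j; rewrite (ancP eE ar br) !inE -E vk orbC.
  congr (_ || _); last by apply/eqP/eqP => [[->]|->].
  apply/idP/eqP => [s|->]; last by rewrite E.
  apply/eqP/negPn/negP => n; move: s; rewrite sepC /sep connect1 //.
  exact: adjx_edge eE n.
have sk : sep k a r by move: vk; rewrite /up (negPf nar) => /eqP/dirP[].
have ak := up_in vk.
have [c [ac kE]] := edge_at ak.
have cr : connect (adjx k) c r by exact: sep_other kE sk.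
have kE' : val k = [set c; a]%SET by rewrite kE finset.setUC.
split.
  apply/finset.setP => j; rewrite (ancP eE ar br) finset.in_setU1 (ancP kE' cr sk).
  have [->|je] := eqVneq j e; first by rewrite br orbT.
  congr (_ || _); have ab : connect (adjx j) a b.
    exact/connect1/(adjx_edge eE).
  rewrite /sep; congr (~~ _); apply/idP/idP; first exact: cut_trans.
  by apply: cut_trans; rewrite cutC.
rewrite (ancP kE' cr sk) /sep ar orbF; apply/eqP => rE.
have := up_in rE; rewrite eE => /set2P[] E; first by rewrite E eqxx in nar.
by move: br; rewrite E /sep connect0.
Qed.

End Rooted.

Lemma up_inj (T : tree) (r u v : T) : u != r -> v != r ->
  up r u = up r v -> u = v.
Proof.
rewrite /up => ur vr; rewrite (negPf ur) (negPf vr).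
case E: (dir u r) => [k|]; last by move/eqP: E; rewrite dirNone (negPf ur).
move/esym/eqP/dirP => [vk kv]; move/eqP/dirP: E => [uk ku].
apply/eqP/negPn/negP => uv; have [w [uw kE]] := edge_at uk.
have vw : v = w by move: vk; rewrite kE => /set2P[] // h; rewrite h eqxx in uv.
by have := cut_cover r kE; rewrite -vw; move: kv ku; rewrite /sep => /negPf-> /negPf->.
Qed.

(** Away from the root, [up] is injective with values in the edges. *)
Lemma card_vert_le (T : tree) : (#|T| <= #|{: edge T}|.+1)%N.
Proof.
have /card_gt0P[r _] := tree_nonempty T.
rewrite (cardD1 r) inE add1n ltnS.
have <- : #|up r @: [predD1 T & r]| = #|[predD1 T & r]|.
  apply: card_in_imset => u v; rewrite !inE !andbT => ur vr.
  exact: up_inj.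
have sinj : injective (@Some (edge T)) by move=> ? ? [].
rewrite -(card_imset _ sinj).
apply/subset_leq_card/fintype.subsetP => o /imsetP[v]; rewrite inE => /andP[vr _] ->.
case E: (up r v) => [k|]; first exact: imset_f.
by move/eqP: E; rewrite /up (negPf vr) dirNone (negPf vr).
Qed.

(** * Coordinates on the reduced complex *)

Section Update.
Variables (I : finType) (B : finType).
Implicit Types (s t : {ffun I -> B}) (v u : I) (a b : B).

Definition upd s v a : {ffun I -> B} := [ffun u => if u == v then a else s u].

Lemma updE s v a u : upd s v a u = if u == v then a else s u.
Proof. by rewrite ffunE. Qed.

Lemma upd_same s v a : upd s v a v = a.
Proof. by rewrite updE eqxx. Qed.

Lemma upd_other s v a u : u != v -> upd s v a u = s u.
Proof. by rewrite updE => /negPf->. Qed.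

Lemma upd_upd s v a b : upd (upd s v a) v b = upd s v b.
Proof. by apply/ffunP => u; rewrite !updE; case: eqP. Qed.

Lemma upd_id s v : upd s v (s v) = s.
Proof. by apply/ffunP => u; rewrite !updE; case: eqP => [->|]. Qed.

Lemma sum_upd (V : nmodType) (F : {ffun I -> B} -> V) t v b :
  \sum_(s | upd s v b == upd t v b) F s = \sum_a F (upd t v a).
Proof.
rewrite (reindex_onto (fun a => upd t v a) (fun s => s v)).
  by apply: eq_bigl => a; rewrite upd_upd upd_same !eqxx.
move=> s /eqP E; apply/ffunP => u; rewrite updE.
case: eqP => [->//|/eqP uv].
by have := congr1 (fun f : {ffun I -> B} => f u) E; rewrite !upd_other.
Qed.

Lemma prod_upd (R : comNzRingType) (F : I -> B -> R) s v a :
  \prod_u F u (upd s v a u) = F v a * \prod_(u | u != v) F u (s u).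
Proof.
rewrite (bigD1 v) //= upd_same; congr (_ * _).
by apply: eq_bigr => u uv; rewrite upd_other.
Qed.

(** The hypothesis expands [x] in one tensor factor at a time; applied at every coordinate in turn,
    it yields the expansion in product vectors. *)
Lemma multilinear_expand (R : comNzRingType) (x : {ffun I -> B} -> R)
    (K : I -> B -> B -> R) :
  (forall v s, x s = \sum_a x (upd s v a) * K v a (s v)) ->
  forall s, x s = \sum_t x t * \prod_v K v (t v) (s v).
Proof.
move=> xK s.
(* Stage [l] has expanded the coordinates in [l], so [t] may differ from [s] only there. *)
have H (l : seq I) : uniq l -> x s =
    \sum_(t : {ffun I -> B} | [forall w, (w \notin l) ==> (t w == s w)])
      x t * \prod_(v <- l) K v (t v) (s v).
  elim: l => [_|v l IH /andP[vl ul]].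
    rewrite (big_pred1 s) ?big_nil ?mulr1 // => t /=.
    apply/forallP/eqP => [h|-> w]; last by rewrite eqxx.
    by apply/ffunP => w; have /eqP := h w.
  rewrite (IH ul) [RHS](partition_big (fun t => upd t v (s v))
    (fun t : {ffun I -> B} => [forall w, (w \notin l) ==> (t w == s w)])) /=.
    apply: eq_bigr => t /forallP ht.
    have tv : t v = s v by apply/eqP; have := ht v; rewrite vl.
    rewrite [in LHS](xK v t) mulr_suml.
    rewrite [RHS](eq_bigl (fun t' => upd t' v (s v) == upd t v (s v))); last first.
      have tE : upd t v (s v) = t by rewrite -tv upd_id.
      move=> t' /=; rewrite tE andbC; case: eqP => //= E.
      apply/forallP => w; rewrite inE negb_or; apply/implyP => /andP[wv wl].
      by have := ht w; rewrite wl -E upd_other.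
    rewrite [RHS]sum_upd; apply: eq_bigr => a _.
    rewrite big_cons upd_same tv -mulrA; congr (_ * (_ * _)).
    rewrite [LHS]big_seq [RHS]big_seq; apply: eq_bigr => u ul'.
    by rewrite upd_other //; apply: contraNneq vl => <-.
  move=> t /forallP ht; apply/forallP => w; apply/implyP => wl.
  rewrite updE; have [->//|wv] := eqVneq w v; have := ht w.
  by rewrite inE negb_or wv wl.
rewrite (H (index_enum I) (index_enum_uniq I)); apply: eq_bigl => t.
by apply/forallP => w; rewrite mem_index_enum.
Qed.
End Update.

Lemma sum_option (V : nmodType) (I : finType) (F : option I -> V) :
  \sum_a F a = F None + \sum_i F (Some i).
Proof.
rewrite (bigD1 None) //=; congr (_ + _).
rewrite (reindex_omap Some id) //=; last by case.
by apply: eq_bigl => i; rewrite eqxx.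
Qed.

Lemma some_eqE (I : eqType) (a b : I) : (Some a == Some b) = (a == b).
Proof. by []. Qed.

Lemma sum_some_delta (R : nzSemiRingType) (I : finType) (a : I) :
  \sum_i (Some a == Some i)%:R = 1 :> R.
Proof.
rewrite (bigD1 a) //= eqxx big1 ?addr0 // => i ia.
by rewrite some_eqE eq_sym (negPf ia).
Qed.

Section Evaluation.
Variables (I : finType) (S : comNzRingType) (F : I -> S).

Definition evm (m : {cmonom I}) : S := \prod_i F i ^+ m i.

Lemma evm1 : evm mone = 1.
Proof. by rewrite /evm big1 // => i _; rewrite cm1 expr0. Qed.

Lemma evmM : {morph evm : m1 m2 / mmul m1 m2 >-> m1 * m2}.
Proof.
by move=> m1 m2; rewrite /evm -big_split; apply: eq_bigr => i _; rewrite cmM exprD.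
Qed.

HB.instance Definition _ := isMultiplicative.Build {cmonom I} S evm (evmM, evm1).

Definition ev (a : {malg int[{cmonom I}]}) : S := mmap intr evm a.

HB.instance Definition _ := GRing.RMorphism.copy ev (mmap intr evm).

Lemma evU m : ev << m >> = evm m.
Proof. by rewrite /ev mmapU mul1r. Qed.

Lemma ev_var i : ev << ucm i >> = F i.
Proof.
rewrite evU /evm (bigD1 i) //= cmUU big1 ?mulr1 // => j ji.
by rewrite cmU eq_sym (negPf ji).
Qed.
End Evaluation.

Lemma cmonom_ind (I : choiceType) (P : {cmonom I} -> Prop) :
  P mone -> (forall i m, P m -> P (mmul (ucm i) m)) -> forall m, P m.
Proof.
move=> P1 PM m; elim: {m}(mdeg m) {-2}m (leqnn (mdeg m)) => [|d IH] m.
  by rewrite leqn0 mdeg_eq0 => /eqP->.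
have [->//|m1] := eqVneq m mone; move=> md.
have [i im] : exists i, i \in finsupp (cmonom_val m).
  have [E|] := eqVneq (finsupp (cmonom_val m)) fset0; last by case/fset0Pn => i; exists i.
  case/eqP: m1; apply/eqP/cmP => j; rewrite cm1; apply/eqP.
  by rewrite cmE_eq0 E.
have mi : (0 < m i)%N by rewrite lt0n cmE_neq0.
have mE : m = mmul (ucm i) (divcm m (ucm i)).
  apply/eqP/cmP => j; rewrite cmM divcmE cmU.
  by case: eqP => [<-|_]; rewrite ?subn0 // subnKC.
by rewrite mE; apply/PM/IH; move: md; rewrite {1}mE mdegM mdegU.
Qed.

Lemma scale_regular (A : comNzRingType) (a : A) (b : A^o) : a *: b = a * b.
Proof. by []. Qed.

Section EdgeRing.
Variable T : tree.

Lemma monomial_mul (I : choiceType) (m1 m2 : {cmonom I}) :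
  << mmul m1 m2 >> = << m1 >> * << m2 >> :> {malg int[{cmonom I}]}.
Proof. by rewrite malgM_def fgmulUU mul1r. Qed.

Lemma monomial_ev (I : finType) (m : {cmonom I}) :
  << m >> = evm (fun i => << ucm i >>) m :> {malg int[{cmonom I}]}.
Proof.
elim/cmonom_ind: m => [|i m IH]; first by rewrite evm1.
by rewrite monomial_mul IH evmM -(evU _ (ucm i)) ev_var.
Qed.

Lemma monomial_scale (K : choiceType) (c : int) (m : K) :
  << c *g m >> = << m >> *~ c :> {malg int[K]}.
Proof. by rewrite -{1}[c]intz raddfMz. Qed.

Lemma rmorph_ev (S : comNzRingType) (phi : {rmorphism edge_ring T -> S}) a :
  phi a = ev (fun e => phi (edge_var e)) a.
Proof.
rewrite {1}(monalgE a) rmorph_sum /ev mmapE; apply: eq_bigr => m _.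
rewrite monomial_scale raddfMz mulrzl; congr (_ *~ _).
have -> : << m >> = \prod_(e : edge T) edge_var e ^+ m e :> edge_ring T.
  exact: monomial_ev.
apply: etrans (rmorph_prod phi _ _ _) _.
by apply: eq_bigr => e _; rewrite rmorphXn.
Qed.

Lemma koszul_sign_upd (s : state T) v a : koszul_sign (upd s v a) v = koszul_sign s v.
Proof.
rewrite /koszul_sign; congr (_ ^+ #|pred_of_set _|); apply/finset.setP => u.
rewrite !inE; case: (ltnP (vrank u) (vrank v)) => uv; rewrite ?andbF // !andbT.
by rewrite upd_other //; apply: contraTneq uv => ->; rewrite ltnn.
Qed.

Lemma scale_delta (a : edge_ring T) (b : bool) :
  a *: (b%:R : (edge_ring T)^o) = if b then a else 0.
Proof. by case: b; rewrite scale_regular ?mulr1 ?mulr0. Qed.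

(** The differential empties vertices; its coefficient at [t] therefore collects the states obtained
    by filling an empty vertex of [t]. *)
Lemma sw_diffE (x : tensor_mod T) (t : state T) :
  sw_diff x t = \sum_(v | t v == None) koszul_sign t v *
                 \sum_e edge_var e * x (upd t v (Some e)).
Proof.
rewrite /sw_diff exchange_big sum_ffunE [RHS]big_mkcond /=; apply: eq_bigr => v _.
rewrite sum_ffunE.
pose F (s : state T) := if s v is Some e then koszul_sign s v * edge_var e * x s else 0.
transitivity (\sum_(s : state T | upd s v None == t) F s).
  rewrite [RHS]big_mkcond /=; apply: eq_bigr => s _; rewrite /F.
  case: (s v) => [e|]; rewrite ?ffunE ?if_same //.
  exact: scale_delta.
have [tv|tv] := eqVneq (t v) None; last first.
  by rewrite big_pred0 // => s; apply: contraNF tv => /eqP<-; rewrite upd_same.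
have tE : upd t v None = t by rewrite -tv upd_id.
rewrite (eq_bigl (fun s => upd s v None == upd t v None)); last first.
  by move=> s; rewrite tE.
apply: etrans (sum_upd F t v None) _; rewrite sum_option /F upd_same add0r mulr_sumr; apply: eq_bigr => e _.
by rewrite upd_same koszul_sign_upd mulrA.
Qed.

(** Equations for the submodule that [sw_reduced] gives by generators, see [sw_reducedP]. Unlike
    membership in a span, they are easy to check for the image of a map. *)
Definition reduced_coord (x : tensor_mod T) : Prop :=
  (forall (s : state T) (v : T) (e : edge T), s v = Some e -> v \notin val e -> x s = 0) /\
  (forall (s : state T) (v : T), \sum_e x (upd s v (Some e)) = 0).

Lemma spanned_ind (A : comNzRingType) (U : lmodType A) (G P : U -> Prop) :
  P 0 -> (forall a x y, P x -> P y -> P (a *: x + y)) -> (forall x, G x -> P x) ->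
  forall x, spanned G x -> P x.
Proof.
move=> P0 PD PG x [n [a [g [Gg ->]]]]; elim/big_rec: _ => // j y _ Py.
exact/PD/Py/PG.
Qed.

Lemma spanned_gen (A : comNzRingType) (U : lmodType A) (G : U -> Prop) x :
  G x -> spanned G x.
Proof.
move=> Gx; exists 1%N, (fun=> 1), (fun=> x); split => //.
by rewrite big_ord1 scale1r.
Qed.

Lemma spannedZ (A : comNzRingType) (U : lmodType A) (G : U -> Prop) a x :
  spanned G x -> spanned G (a *: x).
Proof.
case=> n [b [g [Gg ->]]]; exists n, (fun j => a * b j), g; split=> //.
by rewrite scaler_sumr; apply: eq_bigr => j _; rewrite scalerA.
Qed.

Lemma spannedB (A : comNzRingType) (U : lmodType A) (G : U -> Prop) x y :
  spanned G x -> spanned G y -> spanned G (x - y).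
Proof. by case: (spanned_zmod G) => _; apply. Qed.

Lemma spanned0 (A : comNzRingType) (U : lmodType A) (G : U -> Prop) : spanned G 0.
Proof. by case: (spanned_zmod G). Qed.

Lemma spannedD (A : comNzRingType) (U : lmodType A) (G : U -> Prop) x y :
  spanned G x -> spanned G y -> spanned G (x + y).
Proof.
move=> xG yG; rewrite -[y]opprK; apply: spannedB => //.
by rewrite -sub0r; apply: spannedB => //; exact: spanned0.
Qed.

Lemma spanned_sum (A : comNzRingType) (U : lmodType A) (G : U -> Prop)
  (I : Type) (r : seq I) (F : I -> U) :
  (forall i, spanned G (F i)) -> spanned G (\sum_(i <- r) F i).
Proof.
move=> h; elim/big_rec: _ => [|i x _ xG]; first exact: spanned0.
exact: spannedD.
Qed.

Lemma reduced_local_coord v (y : local_mod T) : sw_reduced_local v y ->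
  (forall e : edge T, v \notin val e -> y (Some e) = 0) /\ \sum_e y (Some e) = 0.
Proof.
move: y; apply: spanned_ind.
- by split=> [e _|]; [rewrite ffunE | rewrite big1 // => e _; rewrite ffunE].
- move=> a x y [x1 x2] [y1 y2]; split=> [e ve|].
    by rewrite !ffunE x1 // y1 // addr0 scaler0.
  under eq_bigr do rewrite !ffunE.
  by rewrite big_split /= -scaler_sumr x2 y2 addr0 scaler0.
- move=> _ [->|[e [e' [ve ve' ->]]]]; split.
  + by move=> e _; rewrite ffunE.
  + by rewrite big1 // => e _; rewrite ffunE.
  + move=> k vk; rewrite !ffunE.
    have -> : (Some e == Some k) = false by apply: contraNF vk => /eqP[<-].
    have -> : (Some e' == Some k) = false by apply: contraNF vk => /eqP[<-].
    by rewrite subr0.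
  + under eq_bigr do rewrite !ffunE.
    by rewrite sumrB !sum_some_delta subrr.
Qed.

Lemma sw_reduced_coord x : sw_reduced x -> reduced_coord x.
Proof.
move: x; apply: spanned_ind.
- by split=> *; rewrite ?ffunE // big1 // => e _; rewrite ffunE.
- move=> a x y [x1 x2] [y1 y2]; split=> [s v e sv ve|s v].
    by rewrite !ffunE (x1 s v e) // (y1 s v e) // addr0 scaler0.
  under eq_bigr do rewrite !ffunE.
  by rewrite big_split /= -scaler_sumr x2 y2 addr0 scaler0.
- move=> _ [y [yr ->]]; split=> [s v e sv ve|s v].
    rewrite ffunE (bigD1 v) //= sv; have [h _] := reduced_local_coord (yr v).
    by rewrite h // mul0r.
  under eq_bigr do rewrite ffunE (prod_upd (fun u b => y u b)).
  have [_ h] := reduced_local_coord (yr v).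
  by rewrite -mulr_suml h mul0r.
Qed.

Section Basis.
Variable r : T.

(** The value zero outside [down r v] allows sums to run over all states. *)
Definition basis_local (v : T) (a : option (edge T)) : local_mod T :=
  if a is Some e then
    if e \in down r v then symb (Some e) - symb (up r v) else 0
  else symb None.

Lemma basis_local_reduced v a : sw_reduced_local v (basis_local v a).
Proof.
case: a => [e|] /=; last by apply: spanned_gen; left.
case: ifP => [|_]; last exact: spanned0.
rewrite inE => /andP[ve _]; have [k -> vk] := up_exists r ve.
by apply: spanned_gen; right; exists e, k.
Qed.

Lemma basis_local_expand x v s : reduced_coord x ->
  x s = \sum_a x (upd s v a) * basis_local v a (s v).
Proof.
move=> [x1 x2]; rewrite sum_option /= ffunE.
case sv: (s v) => [k|]; last first.
  rewrite eqxx mulr1 -sv upd_id big1 ?addr0 // => e _.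
  case: ifP => [|_]; last by rewrite ffunE mulr0.
  rewrite !ffunE inE sv => /andP[ve _].
  by have [j -> _] := up_exists r ve; rewrite subr0 mulr0.
rewrite mulr0 add0r.
have [vk|vk] := boolP (v \in val k); last first.
  rewrite (x1 s v k sv vk) big1 // => e _.
  case: ifP => [|_]; last by rewrite ffunE mulr0.
  rewrite !ffunE inE => /andP[ve _].
  have -> : (Some e == Some k) = false by apply: contraNF vk => /eqP[<-].
  have [j -> vj] := up_exists r ve.
  have -> : (Some j == Some k) = false by apply: contraNF vk => /eqP[<-].
  by rewrite subr0 mulr0.
(* The coefficient of the rootward half-edge is minus the sum of the others, which is what the terms
   [- symb (up r v)] contribute. *)
have [ku|ku] := eqVneq (up r v) (Some k).
  have := x2 s v; rewrite (bigD1 k) //= -{1}sv upd_id => /eqP.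
  rewrite addr_eq0 => /eqP->; rewrite -sumrN big_mkcond; apply: eq_bigr => e _.
  rewrite inE ku /=; have [->|ek] := eqVneq e k.
    by rewrite eqxx andbF ffunE mulr0.
  have eks : (Some e == Some k) = false by rewrite some_eqE (negPf ek).
  rewrite eks andbT; case: ifP => ve; last by rewrite ffunE mulr0 (x1 _ v e) ?upd_same ?ve ?oppr0.
  by rewrite !ffunE eks eqxx sub0r mulrN1.
rewrite (bigD1 k) //= big1 ?addr0.
  by rewrite inE vk eq_sym ku /= !ffunE eqxx (negPf ku) subr0 mulr1 -sv upd_id.
move=> e ek; case: ifP => _; last by rewrite ffunE mulr0.
rewrite !ffunE (negPf ku).
have -> : (Some e == Some k) = false by rewrite some_eqE (negPf ek).
by rewrite subr0 mulr0.
Qed.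

Definition basis_state (t : state T) : tensor_mod T :=
  pure_tensor (fun v => basis_local v (t v)).

Lemma basis_state_reduced t : sw_reduced (basis_state t).
Proof.
by apply: spanned_gen; exists (fun v => basis_local v (t v)); split=> // v;
  exact: basis_local_reduced.
Qed.

Lemma reduced_expand x : reduced_coord x -> x = \sum_t x t *: basis_state t.
Proof.
move=> xr; apply/ffunP => s; rewrite sum_ffunE.
rewrite (multilinear_expand (K := basis_local) (fun v s => basis_local_expand v s xr)).
by apply: eq_bigr => t _; rewrite !ffunE.
Qed.

End Basis.

(** The equations suffice because they allow the expansion in [basis_state], for an arbitrary
    root. *)
Lemma sw_reducedP x : sw_reduced x <-> reduced_coord x.
Proof.
split; first exact: sw_reduced_coord.
have /card_gt0P[r _] := tree_nonempty T => /(reduced_expand r) ->.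
by apply: spanned_sum => t; apply/spannedZ/basis_state_reduced.
Qed.

End EdgeRing.

(** * Functoriality *)

Lemma vrank_inj (T : tree) : injective (@vrank T).
Proof. by move=> u v /ord_inj/enum_rank_inj. Qed.

Lemma vrank_ltn (T : tree) (u v : T) : u != v -> (vrank u < vrank v)%N = ~~ (vrank v < vrank u)%N.
Proof.
by move=> uv; case: ltngtP => // /vrank_inj E; rewrite E eqxx in uv.
Qed.

(** * Koszul signs as numbers of inversions *)

Section Inversions.
Implicit Types T : tree.

Definition inverted T T' (f : T -> T') (u v : T) : bool :=
  (vrank u < vrank v)%N && (vrank (f v) < vrank (f u))%N.

Definition ninv T T' (f : T -> T') (A : {set T}) : nat :=
  \sum_(u in A) \sum_(v in A) inverted f u v.

Definition nbelow T (A : {set T}) (v : T) : nat :=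
  \sum_(u in A) (vrank u < vrank v)%N.

Lemma ninvE T T' (f : T -> T') (A : {set T}) (P : pred T) : P =1 mem A ->
  #|finset (fun p : T * T => [&& P p.1, P p.2,
     (vrank p.1 < vrank p.2)%N & (vrank (f p.2) < vrank (f p.1))%N])| = ninv f A.
Proof.
move=> PA; rewrite -sum1_card big_mkcond /ninv.
rewrite [RHS](eq_bigr (fun u => \sum_v (if v \in A then (inverted f u v : nat) else 0%N))); last first.
  by move=> u _; rewrite big_mkcond.
rewrite [RHS]big_mkcond /=.
rewrite [RHS](eq_bigr (fun u => \sum_v
    (if (u \in A) && (v \in A) then (inverted f u v : nat) else 0%N))); last first.
  by move=> u _; case: (u \in A) => //=; rewrite big1.
rewrite pair_bigA /=; apply: eq_bigr => -[u v] _ /=.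
rewrite inE /= !PA !inE /inverted.
by case: (u \in A); case: (v \in A) => //=; case: ifP.
Qed.

Lemma koszul_signE T (s : state T) v : 
  koszul_sign s v = (-1) ^+ nbelow (occupied s) v.
Proof.
rewrite /koszul_sign /nbelow -sum1_card; congr (_ ^+ _).
rewrite (eq_bigl (fun u => (u \in occupied s) && (vrank u < vrank v)%N)); last first.
  by move=> u; rewrite inE.
by rewrite big_mkcondr; apply: eq_bigr => u _; case: ifP.
Qed.

Lemma ninv_insert T T' (f : T -> T') (A : {set T}) v : v \notin A ->
  ninv f (v |: A)%SET =
  (ninv f A + \sum_(u in A) (inverted f u v + inverted f v u))%N.
Proof.
move=> vA; rewrite /ninv !big_setU1 //=.
have -> : inverted f v v = false by rewrite /inverted ltnn.
rewrite add0n [X in (_ + X)%N = _](eq_bigr (fun u =>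
  (inverted f u v + \sum_(w in A) inverted f u w)%N)); last first.
  by move=> u _; rewrite big_setU1.
by rewrite !big_split /= addnA addnC; congr (_ + _)%N; rewrite addnC.
Qed.

Lemma nbelow_image T T' (f : T -> T') (A : {set T}) (v' : T') : {in A &, injective f} ->
  nbelow (f @: A) v' = (\sum_(u in A) (vrank (f u) < vrank v'))%N.
Proof. by move=> fA; rewrite /nbelow big_imset. Qed.

Lemma odd_sum (I : finType) (A : {set I}) (F G : I -> nat) :
  (forall i, i \in A -> odd (F i) = odd (G i)) ->
  odd (\sum_(i in A) F i) = odd (\sum_(i in A) G i).
Proof.
move=> h; elim/big_ind2: _ => // x1 x2 y1 y2 hx hy.
by rewrite !oddD hx hy.
Qed.

(** For each [u] in [A], the indicator of [u] before [v] and the inversions of the pair add up,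
    modulo 2, to the indicator of [f u] before [f v]. This matches the signs of the two
    differentials in [chain_pull_diff]. *)
Lemma ninv_nbelow T T' (f : T -> T') (A : {set T}) v : v \notin A ->
  {in (v |: A)%SET &, injective f} ->
  odd (nbelow A v + ninv f (v |: A)%SET) =
  odd (ninv f A + nbelow (f @: A) (f v)).
Proof.
move=> vA finj; have fA : {in A &, injective f}.
  by move=> x y xA yA; apply: finj; rewrite setU1r.
rewrite ninv_insert // nbelow_image // addnCA !oddD; congr (_ (+) _).
rewrite /nbelow -oddD -big_split /=; apply: odd_sum => u uA.
have uv : u != v by apply: contraNneq vA => <-.
have fuv : f u != f v.
  by apply: contraNneq uv => /finj->; rewrite ?setU11 ?setU1r.
rewrite /inverted (vrank_ltn uv) (vrank_ltn fuv).
by case: (vrank v < vrank u)%N; case: (vrank (f v) < vrank (f u))%N.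
Qed.

Lemma ninv_insert_odd T T' (f : T -> T') (A : {set T}) v : v \notin A ->
  {in (v |: A)%SET &, injective f} ->
  odd (ninv f (v |: A)%SET) =
  odd (nbelow A v) (+) odd (ninv f A) (+) odd (nbelow (f @: A) (f v)).
Proof.
by move=> vA /(ninv_nbelow vA); rewrite !oddD; case: (odd _); case: (odd _); case: (odd _); case: (odd _).
Qed.

(** Signs of reorderings multiply under composition. Inserting a vertex into [A] changes each parity
    by its positions before and after the map, and the position at the middle stage cancels. *)
Lemma ninv_comp T T' T'' (f : T -> T') (g : T' -> T'') (h : T -> T'') (A : {set T}) :
  (forall u, h u = g (f u)) -> {in A &, injective h} ->
  odd (ninv h A) = odd (ninv f A) (+) odd (ninv g (f @: A)).
Proof.
move=> hE; have hI (B : {set T}) : {in B &, injective h} ->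
    {in B &, injective f} /\ {in (f @: B) &, injective g}.
  move=> hB; split=> [x y xB yB E|_ _ /imsetP[x xB ->] /imsetP[y yB ->]].
    by apply: hB; rewrite // !hE E.
  by rewrite -!hE => /hB->.
elim: {A}#|A| {-2}A (erefl #|A|) => [A /eqP + _|n IH A cA hA].
  by rewrite cards_eq0 => /eqP->; rewrite imset0 /ninv !big_set0.
have /card_gt0P[v vA] : (0 < #|A|)%N by rewrite cA.
pose B := (A :\ v)%SET; have AE : A = (v |: B)%SET by rewrite finset.setD1K.
have vB : v \notin B by rewrite finset.setD11.
have cB : #|B| = n by move: cA; rewrite AE cardsU1 vB => -[].
rewrite AE in hA *; have [hf hg] := hI _ hA.
have hB : {in B &, injective h}.
  by move=> x y xB yB; apply: hA; rewrite finset.setU1r.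
have fvB : f v \notin f @: B.
  apply/imsetP => -[u uB E]; move: vB.
  by rewrite (hf v u) ?uB ?finset.setU11 ?finset.setU1r.
have hBE : h @: B = g @: (f @: B) by rewrite -imset_comp; apply: eq_imset.
rewrite imsetU1 !ninv_insert_odd //; last by rewrite -imsetU1.
rewrite (IH B cB hB) hBE hE.
by case: (odd _); case: (odd _); case: (odd _); case: (odd _); case: (odd _).
Qed.
End Inversions.

(** * Homogeneous polynomials *)

Section Degree.
Variable I : choiceType.
Implicit Types (a b : {malg int[{cmonom I}]}) (d : nat).

Definition hdeg d a : Prop := forall m, mcoeff m a != 0 -> mdeg m = d.

Lemma hdeg0 d : hdeg d 0.
Proof. by move=> m; rewrite mcoeff0 eqxx. Qed.

Lemma hdegD d a b : hdeg d a -> hdeg d b -> hdeg d (a + b).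
Proof.
move=> ha hb m; rewrite mcoeffD; have [->|/ha//] := eqVneq (mcoeff m a) 0.
by rewrite add0r => /hb.
Qed.

Lemma hdegN d a : hdeg d a -> hdeg d (- a).
Proof. by move=> ha m; rewrite mcoeffN oppr_eq0 => /ha. Qed.

Lemma hdeg_sum d (J : Type) (r : seq J) (P : pred J) (F : J -> {malg int[{cmonom I}]}) :
  (forall j, P j -> hdeg d (F j)) -> hdeg d (\sum_(j <- r | P j) F j).
Proof. by move=> h; elim/big_ind: _ => //; [exact: hdeg0 | exact: hdegD]. Qed.

Lemma hdegMz d a (z : int) : hdeg d a -> hdeg d (a *~ z).
Proof.
move=> ha; have hn n : hdeg d (a *+ n).
  elim: n => [|n IH]; first exact: hdeg0.
  by rewrite mulrS; exact: hdegD.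
case: z => n; first exact: hn.
by rewrite NegzE mulrNz; apply: hdegN; exact: hn.
Qed.

Lemma hdegU m : hdeg (mdeg m) << m >>.
Proof. by move=> m'; rewrite mcoeffU1; have [->|_] := eqVneq m m'; rewrite ?eqxx. Qed.

Lemma hdegM d1 d2 a b : hdeg d1 a -> hdeg d2 b -> hdeg (d1 + d2) (a * b).
Proof.
move=> ha hb; rewrite malgME.
rewrite big_seq; apply: hdeg_sum => m1 h1; rewrite big_seq; apply: hdeg_sum => m2 h2.
rewrite monomial_scale; apply: hdegMz.
by rewrite -(ha m1) ?mcoeff_neq0 // -(hb m2) ?mcoeff_neq0 // -mdegM; exact: hdegU.
Qed.

Lemma hdeg1 : hdeg 0 1.
Proof. by have := @hdegU mone; rewrite mdeg1. Qed.

Lemma hdegX d a k : hdeg d a -> hdeg (k * d) (a ^+ k).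
Proof.
move=> ha; elim: k => [|k IH]; first exact: hdeg1.
by rewrite exprS mulSn; exact: hdegM.
Qed.

Lemma hdeg_prod (J : Type) (r : seq J) (P : pred J) (D : J -> nat)
    (F : J -> {malg int[{cmonom I}]}) :
  (forall j, P j -> hdeg (D j) (F j)) ->
  hdeg (\sum_(j <- r | P j) D j) (\prod_(j <- r | P j) F j).
Proof.
move=> h; elim/big_rec2: _ => [|j x y Pj hxy]; first exact: hdeg1.
by apply: hdegM => //; exact: h.
Qed.

Lemma hdeg_sign d a n : hdeg d a -> hdeg d ((-1) ^+ n * a).
Proof.
move=> ha; rewrite -signr_odd; case: odd; rewrite ?expr1 ?expr0 ?mul1r //.
by rewrite mulN1r; exact: hdegN.
Qed.

End Degree.

Lemma mdeg_sum (I : finType) (m : {cmonom I}) : mdeg m = (\sum_i m i)%N.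
Proof.
elim/cmonom_ind: m => [|i m IH]; first by rewrite mdeg1 big1 // => i _; rewrite cm1.
rewrite mdegM mdegU IH; under [RHS]eq_bigr do rewrite cmM cmU.
rewrite big_split /=; congr (_ + _)%N.
rewrite (bigD1 i) //= eqxx big1 // => j ji.
by rewrite eq_sym (negPf ji).
Qed.

Lemma hdeg_ev (I : finType) (J : choiceType) (F : I -> {malg int[{cmonom J}]}) d
    (a : {malg int[{cmonom I}]}) :
  (forall i, hdeg 1 (F i)) -> hdeg d a -> hdeg d (ev F a).
Proof.
move=> hF ha; rewrite /ev mmapE big_seq; apply: hdeg_sum => m ma.
rewrite mulrzl; apply: hdegMz; rewrite -(ha m) ?mcoeff_neq0 //.
have -> : mdeg m = (\sum_i m i * 1)%N.
  by rewrite mdeg_sum; apply: eq_bigr => i _; rewrite muln1.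
by apply: hdeg_prod => i _; apply: hdegX.
Qed.

Lemma eq_ev (I : finType) (S : comNzRingType) (F G : I -> S) a :
  (forall i, F i = G i) -> ev F a = ev G a.
Proof. by move=> E; rewrite (functional_extensionality_dep E). Qed.

Lemma sum_mul_zero (R : nzRingType) (I : finType) (P : pred I) (F : I -> R) (a b c : R) :
  c = 0 -> \sum_(i | P i) F i * c = a * c + b * c.
Proof. by move=> ->; rewrite -mulr_suml !mulr0 addr0. Qed.

Lemma sum_mul_cancel (R : nzRingType) (I : finType) (F X : I -> R) (b : R) :
  \sum_i X i = 0 -> \sum_i (F i * X i + b * X i) = \sum_i F i * X i.
Proof. by move=> X0; rewrite big_split /= -mulr_sumr X0 mulr0 addr0. Qed.

Section EdgeMap.
Variables (T T' : tree) (f : contraction T T').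

Lemma edge_mapE a : edge_map f a = ev (fun e' => edge_var (lift_edge f e')) a.
Proof.
apply: eq_bigr => m _; apply: (congr1 ( *%R _)).
by apply: eq_bigr => e' _; rewrite edge_liftE.
Qed.

Lemma edge_map_ext : edge_map f = ev (fun e' => edge_var (lift_edge f e')).
Proof. by apply: functional_extensionality_dep => a; rewrite edge_mapE. Qed.

Lemma edge_map_additive : zmod_morphism (edge_map f).
Proof. by rewrite edge_map_ext; exact: raddfB. Qed.

Lemma edge_map_multiplicative : monoid_morphism (edge_map f).
Proof. by rewrite edge_map_ext; split; [exact: rmorph1 | exact: rmorphM]. Qed.

HB.instance Definition _ := GRing.isZmodMorphism.Build (edge_ring T') (edge_ring T)
  (edge_map f) edge_map_additive.
HB.instance Definition _ := GRing.isMonoidMorphism.Build (edge_ring T') (edge_ring T)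
  (edge_map f) edge_map_multiplicative.

Lemma edge_map_var e' : edge_map f (edge_var e') = edge_var (lift_edge f e').
Proof. by rewrite edge_mapE; exact: ev_var. Qed.

Lemma edge_map_hdeg d a : hdeg d a -> hdeg d (edge_map f a).
Proof.
move=> ha; rewrite edge_mapE; apply: hdeg_ev ha => e'.
by have := @hdegU _ (ucm (lift_edge f e')); rewrite mdegU.
Qed.
End EdgeMap.

Lemma edge_map_id (T : tree) a : edge_map (contr_id T) a = a.
Proof.
rewrite edge_mapE [RHS](rmorph_ev (idfun : {rmorphism edge_ring T -> edge_ring T})).
apply: eq_ev => e.
by rewrite contr_id_edge.
Qed.

Lemma edge_map_comp (T T' T'' : tree) (g : contraction T' T'') (f : contraction T T') a :
  edge_map (contr_comp g f) a = edge_map f (edge_map g a).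
Proof.
rewrite edge_mapE [RHS](rmorph_ev (edge_map f \o edge_map g)).
apply: eq_ev => e.
by rewrite contr_comp_edge /= !edge_map_var.
Qed.

(** * The functorial chain map *)

Section ChainPull.
Variables (T T' : tree) (f : contraction T T').

Definition dir_over (v : T) (o : option (edge T')) : option (edge T) :=
  omap (fun e' => edge_dir v (lift_edge f e')) o.

(** The pairs in which [s] is a term of the image of the basis state [s']: expanding the tensor
    product picks one vertex over each occupied vertex of [T']. *)
Definition compat (s : state T) (s' : state T') : bool :=
  [&& dinjectiveb f (mem (occupied s)), f @: occupied s == occupied s' &
      [forall v in occupied s, s v == dir_over v (s' (f v))]].

Lemma compatP (s : state T) (s' : state T') : reflect [/\ {in occupied s &, injective f},
    f @: occupied s = occupied s' &
    forall v, v \in occupied s -> s v = dir_over v (s' (f v))] (compat s s').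
Proof.
apply: (iffP and3P) => [[/dinjectiveP h /eqP h' /forall_inP h'']|[h h' h'']].
  by split=> // v /h''/eqP.
split; [exact/dinjectiveP|exact/eqP|apply/forall_inP => v /h''->//].
Qed.

(* A half-edge at [w] of [T'] is sent to the sum, over the vertices [v] above
   [w], of the half-edges at [v] pointing towards its lift. On differences this
   agrees with the map of a simple contraction, and it is strictly functorial. *)
Definition chain_pull (x : tensor_mod T') : tensor_mod T :=
  [ffun s : state T => (-1) ^+ ninv f (occupied s) *
     \sum_(s' : state T' | compat s s') edge_map f (x s')].

Lemma chain_pull_additive : zmod_morphism chain_pull.
Proof.
move=> x y; apply/ffunP => s; rewrite !ffunE -mulrBr -sumrB.
by congr (_ * _); apply: eq_bigr => s' _; rewrite !ffunE raddfB.
Qed.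

HB.instance Definition _ := GRing.isZmodMorphism.Build (tensor_mod T') (tensor_mod T)
  chain_pull chain_pull_additive.

Lemma occupied_in (S : tree) (s : state S) v : (v \in occupied s) = (s v != None).
Proof. by rewrite inE. Qed.

Lemma occupied_upd (S : tree) (s : state S) v e : occupied (upd s v (Some e)) = (v |: occupied s)%SET.
Proof. by apply/finset.setP => u; rewrite !inE updE; case: (u == v). Qed.

Lemma compat_upd (t : state T) (t' : state T') v k (e' : edge T') : t v = None -> t' (f v) = None ->
  compat (upd t v (Some k)) (upd t' (f v) (Some e')) =
  compat t t' && (k == edge_dir v (lift_edge f e')).
Proof.
move=> tv tfv.
have vt : v \notin occupied t by rewrite occupied_in tv.
have fvt : f v \notin occupied t' by rewrite occupied_in tfv.
have nu u : u \in occupied t -> u != v by apply: contraTneq => ->.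
apply/compatP/andP; rewrite !occupied_upd.
  move=> [inj im dir].
  have nf : f v \notin f @: occupied t.
    apply/imsetP => -[u ut /esym/inj E]; have := nu u ut.
    by rewrite E ?eqxx // ?finset.setU11 // finset.setU1r.
  have imE : f @: occupied t = occupied t'.
    by rewrite -(setU1K fvt) -im imsetU1 setU1K.
  split; last first.
    by have := dir v (finset.setU11 _ _); rewrite !upd_same => -[->].
  apply/compatP; split=> //.
    by move=> x y xt yt; apply: inj; rewrite finset.setU1r.
  move=> u ut; have := dir u (finset.setU1r _ ut); rewrite upd_other ?nu //.
  rewrite upd_other //; apply: contraNneq nf => <-; exact: imset_f.
case=> /compatP[inj im dir] /eqP kE.
have fu u : u \in occupied t -> f u != f v.
  by move=> ut; apply: contraNneq fvt => <-; rewrite -im imset_f.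
split; last 2 first.
- by rewrite imsetU1 im.
- move=> u /setU1P[->|ut]; first by rewrite !upd_same kE.
  by rewrite !upd_other ?fu ?nu // dir.
move=> x y /setU1P[->|xt] /setU1P[->|yt] //.
- by move=> /esym/eqP; rewrite (negPf (fu _ yt)).
- by move=> /eqP; rewrite (negPf (fu _ xt)).
- exact: inj.
Qed.

Lemma sum_erase (S : tree) (V : nmodType) (F : state S -> V) w :
  \sum_s F s = \sum_(t : state S | t w == None) \sum_a F (upd t w a).
Proof.
rewrite (partition_big (fun s => upd s w None) (fun t => t w == None)) /=; last first.
  by move=> s _; rewrite upd_same.
apply: eq_bigr => t /eqP tw; rewrite -(sum_upd F t w None); apply: eq_bigl => s.
by rewrite -{1}(upd_id t w) tw.
Qed.

(** The half-edge at [v] is determined by the one at [f v], so summing over its edge [k] leaves a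
    sum over the edge [e'] of the latter. *)
Lemma compat_insert (V : nmodType) (G : edge T -> state T' -> V) (t : state T) v : t v = None ->
  \sum_k \sum_(s' | compat (upd t v (Some k)) s') G k s' =
  \sum_(t' | compat t t' && (t' (f v) == None))
    \sum_e' G (edge_dir v (lift_edge f e')) (upd t' (f v) (Some e')).
Proof.
move=> tv; under eq_bigr => k _.
  rewrite big_mkcond (sum_erase _ (f v)).
  rewrite (eq_bigr (fun t' : state T' => \sum_e' if compat t t' && (k == edge_dir v (lift_edge f e')) then
     G k (upd t' (f v) (Some e')) else 0)); last first.
    move=> t' /eqP tfv; rewrite sum_option.
    have -> : compat (upd t v (Some k)) (upd t' (f v) None) = false.
      apply/negP => /compatP[_ im _].
      have : f v \in occupied (upd t' (f v) None).
        by rewrite -im imset_f // occupied_in upd_same.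
      by rewrite occupied_in upd_same.
    by rewrite add0r; apply: eq_bigr => e' _; rewrite compat_upd.
  over.
rewrite exchange_big /= [RHS]big_mkcondl /=; apply: eq_bigr => t' _.
rewrite exchange_big /=; case: (compat t t') => /=; last first.
  by rewrite big1 // => e' _; rewrite big1.
by apply: eq_bigr => e' _; rewrite -big_mkcond big_pred1_eq.
Qed.

Lemma chain_pull_reduced x : reduced_coord x -> reduced_coord (chain_pull x).
Proof.
move=> [x1 x2]; split=> [s v e sv ve|s v].
  rewrite ffunE big1 ?mulr0 // => s' /compatP[_ _ dir].
  have vs : v \in occupied s by rewrite occupied_in sv.
  have := dir v vs; rewrite sv /dir_over; case: (s' (f v)) => // e' [] E.
  by rewrite E edge_dir_in in ve.
pose t := upd s v None.
have tv : t v = None by rewrite upd_same.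
have tE a : upd s v a = upd t v a by rewrite upd_upd.
rewrite (eq_bigr (fun e => (-1) ^+ ninv f (v |: occupied t)%SET *
    \sum_(s' : state T' | compat (upd t v (Some e)) s') edge_map f (x s'))); last first.
  by move=> e _; rewrite tE ffunE occupied_upd.
rewrite -mulr_sumr (compat_insert (fun _ s' => edge_map f (x s')) tv).
by rewrite big1 ?mulr0 // => t' _; rewrite -raddf_sum x2 raddf0.
Qed.

(** Fix an empty vertex [w] below. For a half-edge [e'] at [w], the vertices over [w] contribute
    their edges towards the lift of [e'], which by [fiber_dir_sum] add up to the lift plus the sum
    [K] of the edges collapsed to [w]. As the coefficients [X] have sum zero, [K] drops out. *)
Lemma chain_pull_diff x : reduced_coord x ->
  sw_diff (chain_pull x) = chain_pull (sw_diff x).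
Proof.
move=> [x1 x2]; apply/ffunP => t; rewrite sw_diffE [RHS]ffunE.
pose D (t' : state T') v := \sum_e' edge_var (edge_dir v (lift_edge f e')) *
  edge_map f (x (upd t' (f v) (Some e'))).
have -> : \sum_(v | t v == None) koszul_sign t v *
    (\sum_e edge_var e * chain_pull x (upd t v (Some e))) =
  \sum_(v | t v == None) \sum_(t' | compat t t' && (t' (f v) == None))
    (-1) ^+ (nbelow (occupied t) v + ninv f (v |: occupied t)%SET) * D t' v.
  apply: eq_bigr => v /eqP tv.
  have CI := compat_insert (fun e s' => edge_var e * edge_map f (x s')) tv.
  transitivity (koszul_sign t v * ((-1) ^+ ninv f (v |: occupied t)%SET *
    \sum_(t' | compat t t' && (t' (f v) == None)) D t' v)).
    apply: (congr1 ( *%R _)); rewrite -CI mulr_sumr; apply: eq_bigr => e _.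
    by rewrite ffunE occupied_upd mulrCA; apply: (congr1 ( *%R _)); rewrite mulr_sumr.
  by rewrite koszul_signE mulrA -exprD mulr_sumr.
rewrite (exchange_big_dep (compat t)) /=; last by move=> v t' _ /andP[].
rewrite mulr_sumr; apply: eq_bigr => t' ct; have /compatP[inj im _] := ct.
rewrite sw_diffE raddf_sum mulr_sumr /=.
rewrite (partition_big f (fun w => t' w == None)) /=; last first.
  by move=> v /and3P[].
apply: eq_bigr => w /eqP tw.
have vt v : f v = w -> v \notin occupied t.
  move=> fv; apply/negP => /(imset_f f); rewrite im fv occupied_in tw.
  by rewrite eqxx.
rewrite (eq_bigl (fun v => f v == w)); last first.
  move=> v; rewrite ct /=; have [fv|] := eqVneq (f v) w; rewrite ?andbF //.
  by have := vt v fv; rewrite occupied_in negbK fv tw => ->.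
have [X XE] : exists X, forall e', X e' = edge_map f (x (upd t' w (Some e'))).
  by exists (fun e' => edge_map f (x (upd t' w (Some e')))).
have [K KE] : exists K : edge_ring T,
  K = \sum_(k : edge T | f @: val k == [set w]%SET) edge_var k by eexists.
transitivity ((-1) ^+ (ninv f (occupied t) + nbelow (occupied t') w) *
    \sum_(v | f v == w) \sum_e' edge_var (edge_dir v (lift_edge f e')) * X e').
  rewrite mulr_sumr; apply: eq_bigr => v /eqP fv.
  have vt' := vt v fv; rewrite /D fv.
  under [in LHS]eq_bigr do rewrite -XE.
  apply: (congr1 ( *%R^~ _)).
  rewrite -signr_odd ninv_nbelow ?signr_odd ?im ?fv //.
  move=> a b /setU1P[->|ao] /setU1P[->|bo] // E; last exact: inj.
  - by have := vt b; rewrite -E fv bo => /(_ erefl).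
  - by have := vt a; rewrite E fv ao => /(_ erefl).
rewrite exchange_big /= rmorphM exprD -mulrA; apply: (congr1 ( *%R _)).
rewrite koszul_signE rmorph_sign; apply: (congr1 ( *%R _)).
transitivity (\sum_e' (edge_var (lift_edge f e') * X e' + K * X e')).
  apply: eq_bigr => e' _; have [we|we] := boolP (w \in val e').
    have FS := @fiber_dir_sum T T' f _ (@edge_var T) e' w we.
    by rewrite -mulrDl KE -FS mulr_suml.
  have X0 : X e' = 0 by rewrite XE (x1 _ w e') ?upd_same ?raddf0.
  exact: sum_mul_zero.
have XS : \sum_e' X e' = 0.
  by rewrite (eq_bigr _ (fun e' _ => XE e')) -raddf_sum x2 raddf0.
rewrite (sum_mul_cancel _ _ XS) raddf_sum.
apply: eq_bigr => e' _; rewrite XE -edge_map_var.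
exact/esym/(rmorphM (edge_map f)).
Qed.

Lemma chain_pull_bihomogeneous i n x :
  bihomogeneous i n x -> bihomogeneous i n (chain_pull x).
Proof.
move=> hx s m; rewrite ffunE => sm.
have [s' [cs nz]] : exists s', compat s s' /\ edge_map f (x s') != 0.
  apply/not_existsP => h; move: sm; rewrite big1 ?mulr0 ?mcoeff0 ?eqxx // => s' cs.
  by apply/eqP/negPn/negP => nz; apply: (h s').
have [inj im _] := compatP _ _ cs.
have co (u' : state T') : compat s u' -> #|occupied u'| = #|occupied s|.
  by case/compatP => i' im' _; rewrite -im' card_in_imset.
have hX (u' : state T') : compat s u' -> hdeg (n - #|occupied s|) (edge_map f (x u')).
  move=> cu; apply: edge_map_hdeg => m' /hx [_ <-].
  by rewrite (co _ cu) addnK.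
have sd : mdeg m = (n - #|occupied s|)%N.
  by move: sm; apply: hdeg_sign; apply: hdeg_sum.
have [m0 m0s] : exists m0, mcoeff m0 (x s') != 0.
  apply/not_existsP => h; move: nz; have -> : x s' = 0; last by rewrite raddf0 eqxx.
  by apply/malgP => k; rewrite mcoeff0; apply/eqP/negPn/negP => /h.
have [c1 c2] := hx _ _ m0s; rewrite (co _ cs) in c1 c2.
by split=> //; rewrite sd subnK // -c2 leq_addl.
Qed.
End ChainPull.

(** Reducedness enters because [edge_dir] fixes only the edges incident to the vertex. *)
Lemma chain_pull_id (T : tree) (x : tensor_mod T) : reduced_coord x -> chain_pull (contr_id T) x = x.
Proof.
move=> [x1 x2]; apply/ffunP => s; rewrite ffunE.
have idE v : contr_id T v = v by rewrite ffunE.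
have -> : ninv (contr_id T) (occupied s) = 0%N.
  rewrite /ninv big1 // => u _; rewrite big1 // => v _.
  by rewrite /inverted !idE; case: ltngtP.
rewrite expr0 mul1r.
have cs (s' : state T) : x s' != 0 -> compat (contr_id T) s s' = (s' == s).
  move=> nz; apply/compatP/eqP => [[_ im dir]|E].
    apply/ffunP => v; have [vs|vs] := boolP (v \in occupied s); last first.
      have : v \notin occupied s'.
        by rewrite -im; apply: contra vs => /imsetP[u us ->]; rewrite idE.
      by move: vs; rewrite !occupied_in !negbK => /eqP-> /eqP->.
    have := dir v vs; rewrite idE /dir_over; case E: (s' v) => [e|] //= ->.
    rewrite contr_id_edge edge_dir_id //; apply: contraNT nz => ve.
    by rewrite (x1 _ _ _ E ve).
  subst s'; split=> [a b _ _||v vs]; first by rewrite !idE.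
    by rewrite (eq_imset _ idE) imset_id.
  rewrite idE /dir_over; case E: (s v) => [e|] //=.
  rewrite contr_id_edge edge_dir_id //; apply: contraNT nz => ve.
  by rewrite (x1 _ _ _ E ve).
transitivity (\sum_(s' | s' == s) x s'); last by rewrite big_pred1_eq.
rewrite big_mkcond [RHS]big_mkcond; apply: eq_bigr => s' _.
have [x0|/cs->] := eqVneq (x s') 0; last by case: ifP => // _; rewrite edge_map_id.
by rewrite x0 raddf0 !if_same.
Qed.

Section Composition.
Variables (T T' T'' : tree) (g : contraction T' T'') (f : contraction T T').

Lemma dir_over_comp v (o : option (edge T'')) :
  dir_over f v (dir_over g (f v) o) = dir_over (contr_comp g f) v o.
Proof. by case: o => //= e; rewrite edge_dir_lift contr_comp_edge. Qed.

(** The only state of [T'] through which a pair compatible for the composite can factor, see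
    [compat_comp]. *)
Definition mid (s : state T) (s'' : state T'') : state T' :=
  [ffun v' => if v' \in f @: occupied s then dir_over g v' (s'' (g v')) else None].

Lemma contr_compE v : contr_comp g f v = g (f v).
Proof. by rewrite ffunE. Qed.

Lemma compat_comp (s : state T) (s' : state T') (s'' : state T'') :
  compat f s s' && compat g s' s'' =
  compat (contr_comp g f) s s'' && (s' == mid s s'').
Proof.
apply/andP/andP => [[/compatP[fi fim fd] /compatP[gi gim gd]]|].
  split.
    apply/compatP; split=> [u v us vs|| v vs].
    - rewrite !contr_compE => E; apply: fi => //.
      by apply: gi => //; rewrite -fim imset_f.
    - rewrite -gim -fim -imset_comp; apply: eq_imset => u.
      by rewrite contr_compE.
    - rewrite contr_compE -dir_over_comp -gd ?fd // -fim imset_f //.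
  apply/eqP/ffunP => v'; rewrite ffunE fim; case: ifPn => [/gd//|].
  by rewrite occupied_in negbK => /eqP.
case=> /compatP[ci cim cd] /eqP->.
have ci' : {in occupied s &, injective (g \o f)}.
  by move=> u v us vs /= E; apply: ci => //; rewrite !contr_compE.
have cim' : g @: (f @: occupied s) = occupied s''.
  by rewrite -imset_comp -cim; apply: eq_imset => u; rewrite contr_compE.
have om : occupied (mid s s'') = f @: occupied s.
  apply/finset.setP => v'; rewrite occupied_in ffunE; case: ifPn => // vi.
  have : g v' \in occupied s'' by rewrite -cim' imset_f.
  by rewrite occupied_in; case: (s'' (g v')).
split; apply/compatP; rewrite om; split=> //.
- by move=> u v us vs E; apply: ci' => //=; rewrite E.
- move=> v vs; rewrite ffunE imset_f // dir_over_comp cd //.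
  by rewrite contr_compE.
- by move=> _ _ /imsetP[u us ->] /imsetP[v vs ->] /ci'->.
- by move=> v' v's; rewrite ffunE v's.
Qed.

Lemma occupied_mid (s : state T) (s'' : state T'') : compat (contr_comp g f) s s'' ->
  occupied (mid s s'') = f @: occupied s.
Proof.
move=> c; have : compat f s (mid s s'') && compat g (mid s s'') s''.
  by rewrite compat_comp c eqxx.
by case/andP => /compatP[_ ->].
Qed.

Lemma chain_pull_comp x : chain_pull (contr_comp g f) x = chain_pull f (chain_pull g x).
Proof.
apply/ffunP => s; rewrite [LHS]ffunE [RHS]ffunE.
transitivity (\sum_(s' | compat f s s') \sum_(s'' | compat g s' s'')
   (-1) ^+ (ninv f (occupied s) + ninv g (occupied s')) * edge_map f (edge_map g (x s''))); last first.
  rewrite mulr_sumr; apply: eq_bigr => s' _.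
  rewrite [chain_pull _ _ _]ffunE (rmorphM (edge_map f)) rmorph_sign raddf_sum mulrA -exprD.
  by rewrite mulr_sumr.
rewrite (exchange_big_dep (compat (contr_comp g f) s)) /=; last first.
  by move=> s' s'' c1 c2; have := compat_comp s s' s''; rewrite c1 c2 => /esym/andP[].
rewrite mulr_sumr; apply: eq_bigr => s'' c.
rewrite (big_pred1 (mid s s'')); last by move=> s' /=; rewrite compat_comp c.
rewrite edge_map_comp; apply: (congr1 ( *%R^~ _)).
rewrite -signr_odd (ninv_comp (f := f) (g := g)); last 2 first.
- by move=> u; rewrite contr_compE.
- by case/compatP: c.
by rewrite occupied_mid // -oddD signr_odd.
Qed.
End Composition.

Lemma prod_delta (R : comNzRingType) (I : finType) (B : eqType) (s t : {ffun I -> B}) :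
  \prod_v (s v == t v)%:R = (s == t)%:R :> R.
Proof.
have [->|st] := eqVneq s t; first by rewrite big1 // => v _; rewrite eqxx.
have [v sv] : exists v, s v != t v.
  apply/not_existsP => h; case/eqP: st; apply/ffunP => v; apply/eqP/negPn/negP; exact: h.
by rewrite (bigD1 v) //= (negPf sv) mul0r.
Qed.

Lemma prod_eq0 (R : comNzRingType) (I : finType) (F : I -> R) v :
  F v = 0 -> \prod_v F v = 0.
Proof. by move=> F0; rewrite (bigD1 v) //= F0 mul0r. Qed.

Lemma scale_pureE (T : tree) (a : edge_ring T) y (s : state T) :
  (a *: pure_tensor y) s = a * \prod_v y v (s v).
Proof. by rewrite ffunE [pure_tensor _ _]ffunE. Qed.

Lemma sum_option_mul (R : nzRingType) (I : finType) (X c : option I -> R) (h : R) :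
  c None = 0 -> (forall i, c (Some i) = h) -> \sum_i X (Some i) = 0 ->
  \sum_a X a * c a = 0.
Proof.
move=> c0 ch X0; rewrite sum_option c0 mulr0 add0r.
by under eq_bigr do rewrite ch; rewrite -mulr_suml X0 mul0r.
Qed.

(** * Comparison with the maps of simple contractions *)

Section SimpleContraction.
Variables (T T' : tree) (f : contraction T T').

(** The leading term of the image of [s']: each half-edge goes to its own lift, without the
    correction at the contracted edge. *)
Definition lift_state (s' : state T') : state T := [ffun v => lifted f s' v].

Definition incident (s' : state T') : bool :=
  [forall v', if s' v' is Some e' then v' \in val e' else true].

Lemma lift_stateE s' v : lift_state s' v =
  if s' (f v) is Some e' then
    if v \in val (lift_edge f e') then Some (lift_edge f e') else None
  else None.
Proof. by rewrite ffunE /lifted; case: (s' (f v)) => // e'; rewrite edge_liftE. Qed.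

Lemma lift_state_some s' v : lift_state s' v != None -> exists e',
  [/\ s' (f v) = Some e', v \in val (lift_edge f e') & lift_state s' v = Some (lift_edge f e')].
Proof.
rewrite lift_stateE; case E: (s' (f v)) => [e'|//]; case: ifP => // ve _.
by exists e'; split.
Qed.

Lemma lift_state_inj s' : {in occupied (lift_state s') &, injective f}.
Proof.
move=> u v; rewrite !occupied_in.
move=> /lift_state_some[e1 [E1 ue _]] /lift_state_some[e2 [E2 ve _]] E.
move: E1; rewrite E E2 => -[E12]; subst e2; exact: lift_edge_end_uniq ue ve E.
Qed.

Lemma compat_lift_state s' : incident s' -> compat f (lift_state s') s'.
Proof.
move=> /forallP inc; apply/compatP; split; first exact: lift_state_inj.
  apply/finset.setP => v'; apply/imsetP/idP => [[v]|].
    by rewrite occupied_in => /lift_state_some[e' [E _ _]] ->; rewrite occupied_in E.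
  rewrite occupied_in; have := inc v'; case E: (s' v') => [e'|//] ve' _.
  have [v ve fv] := lift_edge_at f ve'; exists v => //.
  by rewrite occupied_in lift_stateE fv E ve.
move=> v; rewrite occupied_in => /lift_state_some[e' [E ve ->]].
by rewrite E /= edge_dir_id.
Qed.

Lemma pull_signE s' : pull_sign f s' = (-1) ^+ ninv f (occupied (lift_state s')).
Proof.
rewrite /pull_sign -(ninvE f (A := occupied (lift_state s')) (P := fun v => lifted f s' v != None)) //.
by move=> v; rewrite -[RHS]/(v \in occupied _) occupied_in ffunE.
Qed.

Lemma pull_factorE s' v b : pull_factor f s' v b =
  if lift_state s' v is Some e then
    (Some e == b)%:R - \sum_(k in contracted f | v \in val k) (Some k == b)%:R
  else (None == b)%:R.
Proof.
rewrite /pull_factor [lift_state s' v]ffunE; case: (lifted f s' v) => [e|]; rewrite !ffunE //.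
by rewrite sum_ffunE; congr (_ - _); apply: eq_bigr => k _; rewrite ffunE.
Qed.

Hypothesis simple : (#|contracted f| <= 1)%N.

Lemma contracted_uniq k1 k2 : k1 \in contracted f -> k2 \in contracted f -> k1 = k2.
Proof. by move/card_le1P: simple => h k1c; have := h k1 k1c; move=> /(_ k2) ->  /eqP ->. Qed.

Lemma fiber_edge u v : u != v -> f u = f v ->
  exists2 k, k \in contracted f & val k = [set u; v]%SET.
Proof.
move=> uv fuv; have [k uk kuv] := dir_exists uv.
have vu : v != u by rewrite eq_sym.
have [j vj jvu] := dir_exists vu.
have kc : k \in contracted f.
  by apply/negPn/negP => /cut_fiber h; move: kuv; rewrite /sep h.
have jc : j \in contracted f.
  by apply/negPn/negP => /cut_fiber h; move: jvu; rewrite /sep h.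
have kj := contracted_uniq kc jc; subst j; exists k => //.
have [w [uw kE]] := edge_at uk.
by move: vj; rewrite kE => /set2P[E|->//]; rewrite E eqxx in vu.
Qed.

(** No half-edge is lifted to an end of a contracted edge, so the occupied vertices below have
    one-point fibers and [s] is forced. *)
Lemma compat_off (s : state T) (s' : state T') : incident s' ->
  (forall v k, k \in contracted f -> v \in val k -> lift_state s' v = None) ->
  compat f s s' -> s = lift_state s'.
Proof.
move=> inc noD c; have [inj im dir] := compatP _ _ _ c.
have [linj lim ldir] := compatP _ _ _ (compat_lift_state inc).
have H v : v \in occupied s -> lift_state s' v = s v.
  move=> vs; have : f v \in f @: occupied (lift_state s') by rewrite lim -im imset_f.
  case/imsetP => u ul E; have [vu|uv] := eqVneq v u.
    by subst u; rewrite ldir // (dir v vs).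
  have [k kc kE] := fiber_edge uv E.
  by move: ul; rewrite occupied_in (noD u k kc) ?eqxx // kE set22.
apply/ffunP => v; have [/H->//|vs] := boolP (v \in occupied s).
have : s v = None by apply/eqP; rewrite -[_ == _]negbK -occupied_in.
move=> ->; apply/esym/eqP/negPn/negP => lv.
have vl : v \in occupied (lift_state s') by rewrite occupied_in.
have : f v \in f @: occupied s by rewrite im -lim imset_f.
case/imsetP => u us E; have ul : u \in occupied (lift_state s').
  by rewrite occupied_in H // -occupied_in.
by move: vs; rewrite (linj v u) // us.
Qed.

Lemma prod_pull_off (s : state T) (s' : state T') :
  (forall v k, k \in contracted f -> v \in val k -> lift_state s' v = None) ->
  \prod_v pull_factor f s' v (s v) = (lift_state s' == s)%:R.
Proof.
move=> noD; rewrite -prod_delta; apply: eq_bigr => v _; rewrite pull_factorE.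
case E: (lift_state s' v) => [e|] //; rewrite big1 ?subr0 // => k /andP[kc vk].
by move: (noD v k kc vk); rewrite E.
Qed.

Section OneEdge.
Variables (k : edge T) (kc : k \in contracted f) (p q : T).
Hypotheses (kE : val k = [set p; q]%SET).
Variables (s' : state T') (e' : edge T').
Hypotheses (inc : incident s') (se : s' (f p) = Some e') (pe : p \in val (lift_edge f e')).

Let pq : p != q. Proof. exact/neq_adj/(adj_edge kE). Qed.
Let fpq : f p = f q. Proof. by apply/eqP; rewrite -(contractedP f kE). Qed.
Let t' := upd s' (f p) None.

Lemma incident_erase : incident t'.
Proof.
apply/forallP => v'; rewrite updE; case: (v' == f p) => //.
by move/forallP: inc => /(_ v').
Qed.

Lemma lift_state_erase v : v \in val k -> lift_state t' v = None.
Proof.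
rewrite kE => /set2P[] ->; rewrite lift_stateE; first by rewrite upd_same.
by rewrite -fpq upd_same.
Qed.

Lemma lift_state_q : lift_state s' q = None.
Proof.
rewrite lift_stateE -fpq se; case: ifP => // qe.
by case/eqP: pq; apply: lift_edge_end_uniq pe qe fpq.
Qed.

Lemma lift_state_p : lift_state s' p = Some (lift_edge f e').
Proof. by rewrite lift_stateE se pe. Qed.

Lemma lift_state_split a : upd (lift_state t') p a = upd (lift_state s') p a.
Proof.
apply/ffunP => v; rewrite !updE; have [//|vp] := eqVneq v p.
have [->|vq] := eqVneq v q.
  by rewrite lift_state_q lift_state_erase // kE set22.
rewrite !lift_stateE updE; have [E|//] := eqVneq (f v) (f p).
have [j jc] := fiber_edge vp E; rewrite (contracted_uniq jc kc) => jE.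
have : v \in [set p; q]%SET by rewrite -kE jE set21.
by case/set2P => h; [rewrite h eqxx in vp | rewrite h eqxx in vq].
Qed.

Lemma off_erase v j : j \in contracted f -> v \in val j -> lift_state t' v = None.
Proof. by move=> jc; rewrite (contracted_uniq jc kc); exact: lift_state_erase. Qed.

Lemma edge_dir_q : edge_dir q (lift_edge f e') = k.
Proof.
apply: (edge_dirE pe pq); first by rewrite kE set22.
by rewrite sepC; exact: sep_bridge.
Qed.

Lemma s'_split : s' = upd t' (f p) (Some e').
Proof. by rewrite upd_upd -se upd_id. Qed.

(** The vertex chosen over [f p] is either [p], with the lift of [e'], or [q], with the edge [k]
    that leads from [q] to this lift. *)
Lemma compat_on (s : state T) : (compat f s s' : nat) =
  ((lift_state s' == s) + (upd (lift_state t') q (Some k) == s))%N.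
Proof.
have tp := lift_state_erase (v := p); have tq := lift_state_erase (v := q).
rewrite kE set21 set22 in tp tq; have {}tp := tp isT; have {}tq := tq isT.
have ct := compat_lift_state incident_erase.
have ne : upd (lift_state t') q (Some k) != lift_state s'.
  apply/eqP => /ffunP/(_ q); by rewrite upd_same lift_state_q.
have c1 : compat f (lift_state s') s' by exact: compat_lift_state.
have c2 : compat f (upd (lift_state t') q (Some k)) s'.
  rewrite s'_split fpq compat_upd ?ct ?edge_dir_q ?eqxx //.
  by rewrite -fpq upd_same.
have [<-|ns] := eqVneq (lift_state s') s; first by rewrite c1 (negPf ne).
have [<-|ns2] := eqVneq (upd (lift_state t') q (Some k)) s; first by rewrite c2.
case: (boolP (compat f s s')) => // c; have [inj im dir] := compatP _ _ _ c.
have : f p \in f @: occupied s by rewrite im occupied_in se.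
case/imsetP => v vs fv.
have [kv svE] : exists kv, s v = Some kv.
  by move: vs; rewrite occupied_in; case: (s v) => // kv _; exists kv.
have sE : s = upd (upd s v None) v (Some kv) by rewrite upd_upd -svE upd_id.
have tfv : t' (f v) = None by rewrite -fv upd_same.
move: (c); rewrite {1}sE s'_split fv compat_upd ?upd_same // => /andP[cv /eqP kvE].
have tE := compat_off incident_erase off_erase cv.
rewrite tE in sE.
have : v \in [set p; q]%SET.
  have [->|pv] := eqVneq p v; first by rewrite set21.
  have [j jc jE] := fiber_edge pv fv.
  by rewrite -kE (contracted_uniq kc jc) jE set22.
case/set2P => E; subst v.
  by case/eqP: ns; rewrite sE lift_state_split kvE edge_dir_id // -lift_state_p upd_id.
by case/eqP: ns2; rewrite [RHS]sE kvE edge_dir_q.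
Qed.

(** The second state has [k] at [p] and a minus sign, whereas in [compat_on] it has [k] at [q] and a
    plus sign. *)
Lemma prod_pull_on (s : state T) : \prod_v pull_factor f s' v (s v) =
  (lift_state s' == s)%:R - (upd (lift_state t') p (Some k) == s)%:R.
Proof.
rewrite lift_state_split -!prod_delta.
rewrite (bigD1 p) //= [X in _ = X - _](bigD1 p) //= [X in _ = _ - X](bigD1 p) //=.
pose R := \prod_(v | v != p) (lift_state s' v == s v)%:R : edge_ring T.
have R1 : \prod_(v | v != p) pull_factor f s' v (s v) = R.
  apply: eq_bigr => v vp; rewrite pull_factorE.
  case E: (lift_state s' v) => [e|] //; rewrite big1 ?subr0 // => j /andP[jc vj].
  move: vj; rewrite (contracted_uniq jc kc) kE => /set2P[] h; subst v; first by rewrite eqxx in vp.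
  by rewrite lift_state_q in E.
have R2 : \prod_(v | v != p) (upd (lift_state s') p (Some k) v == s v)%:R = R.
  by apply: eq_bigr => v vp; rewrite upd_other.
rewrite R1 R2 -mulrBl upd_same; apply: (congr1 ( *%R^~ _)).
rewrite pull_factorE lift_state_p (big_pred1 k) // => j /=.
apply/andP/eqP => [[jc _]|->]; first exact: contracted_uniq.
by rewrite kc kE set21.
Qed.
End OneEdge.

Lemma pull_factor_supp (s : state T) s' :
  \prod_v pull_factor f s' v (s v) != 0 -> occupied (lift_state s') = occupied s.
Proof.
move=> nz; apply/finset.setP => v; rewrite !occupied_in.
have h : pull_factor f s' v (s v) != 0.
  by apply: contraNneq nz => E; apply/eqP; exact: (@prod_eq0 _ _ (fun v => pull_factor f s' v (s v)) v E).
move: h; rewrite pull_factorE; case: (lift_state s' v) => [e|]; case: (s v) => [b|] //.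
  by rewrite big1 ?subr0 ?eqxx.
by case/eqP.
Qed.

(** The two rules differ by the half-edges of [k] at both of its ends. This correction does not
    involve the half-edge at [f p], so it is a function [H] of the state with that half-edge
    erased. *)
Lemma compat_pull_diff (s : state T) k p q : k \in contracted f -> val k = [set p; q]%SET ->
  exists H : state T' -> edge_ring T, forall s', incident s' ->
  (compat f s s')%:R - \prod_v pull_factor f s' v (s v) =
  if s' (f p) is Some _ then H (upd s' (f p) None) else 0.
Proof.
move=> kc kE; have fpq : f p = f q by apply/eqP; rewrite -(contractedP f kE).
exists (fun t' => (upd (lift_state t') q (Some k) == s)%:R + (upd (lift_state t') p (Some k) == s)%:R).
move=> s' inc; case E: (s' (f p)) => [e'|]; last first.
  have off v j : j \in contracted f -> v \in val j -> lift_state s' v = None.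
    move=> jc; rewrite (contracted_uniq jc kc) kE lift_stateE.
    by case/set2P => ->; rewrite -?fpq E.
  rewrite prod_pull_off //.
  suff -> : compat f s s' = (lift_state s' == s) by rewrite subrr.
  apply/idP/eqP => [/(compat_off inc off)->//|<-]; exact: compat_lift_state.
have : f p \in val e' by move/forallP: inc => /(_ (f p)); rewrite E.
move=> /(lift_edge_at f)[v ve fv].
have : v \in [set p; q]%SET.
  have [->|pv] := eqVneq p v; first by rewrite set21.
  have [j jc jE] := fiber_edge pv (esym fv).
  by rewrite -kE (contracted_uniq kc jc) jE set22.
case/set2P => h; subst v.
  rewrite (prod_pull_on kc kE E ve) (compat_on kc kE inc E ve) natrD.
  by rewrite opprB addrC addrA subrK addrC.
have kE' : val k = [set q; p]%SET by rewrite kE finset.setUC.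
have E' : s' (f q) = Some e' by rewrite -fpq.
rewrite (prod_pull_on kc kE' E' ve) (compat_on kc kE' inc E' ve) natrD -fpq.
by rewrite opprB addrC addrA subrK.
Qed.

(** By [compat_pull_diff], the difference is a sum over the half-edges at [f p] with a constant
    factor, and the coefficients of a reduced chain have sum zero there. *)
Lemma sw_pull_simple x : reduced_coord x -> sw_pull f x = chain_pull f x.
Proof.
move=> [x1 x2]; apply/ffunP => s; rewrite [RHS]ffunE sum_ffunE.
have xinc s' : ~~ incident s' -> x s' = 0.
  case/forallPn => v'; case E: (s' v') => [e'|//]; exact: x1.
have [G GE] : exists G : state T' -> edge_ring T,
  forall s', G s' = \prod_v pull_factor f s' v (s v) by eexists.
transitivity ((-1) ^+ ninv f (occupied s) * \sum_s' edge_map f (x s') * G s').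
  rewrite mulr_sumr; apply: eq_bigr => s' _.
  transitivity (pull_sign f s' * edge_map f (x s') * G s').
    by rewrite GE; exact: scale_pureE.
  have [G0|nz] := eqVneq (G s') 0; first by rewrite G0 !mulr0.
  have oE : occupied (lift_state s') = occupied s by apply: pull_factor_supp; rewrite -GE.
  by rewrite pull_signE oE; apply/esym; exact: mulrA.
apply: (congr1 ( *%R _)); rewrite [RHS]big_mkcond /=.
have [C0|] := eqVneq (contracted f) finset.set0.
  apply: eq_bigr => s' _; have [inc|/xinc->] := boolP (incident s'); last first.
    by rewrite raddf0 mul0r if_same.
  have off v j : j \in contracted f -> v \in val j -> lift_state s' v = None.
    by rewrite C0 inE.
  rewrite GE prod_pull_off //.
  suff -> : compat f s s' = (lift_state s' == s).
    by case: ifP => _; rewrite ?mulr1 ?mulr0.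
  apply/idP/eqP => [/(compat_off inc off)->//|<-]; exact: compat_lift_state.
case/set0Pn => k kc; have [p [q [pq kE]]] := edgeP k.
have [H HE] := compat_pull_diff s kc kE.
apply/esym/eqP; rewrite -subr_eq0 -sumrB.
rewrite (eq_bigr (fun s' => edge_map f (x s') *
  (if s' (f p) is Some _ then H (upd s' (f p) None) else 0))); last first.
  move=> s' _; have [inc|/xinc->] := boolP (incident s'); last first.
    by rewrite raddf0 !mul0r if_same subr0.
  rewrite -HE // -GE mulrBr; congr (_ - _).
  by case: (compat f s s'); rewrite ?mulr1 ?mulr0.
rewrite (sum_erase _ (f p)) big1 // => t' /eqP tp.
apply: (@sum_option_mul _ _ (fun a => edge_map f (x (upd t' (f p) a)))
  (fun a => if upd t' (f p) a (f p) is Some _ then H (upd (upd t' (f p) a) (f p) None) else 0) (H t')).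
- by rewrite upd_same.
- by move=> e'; rewrite upd_same upd_upd -{1}tp upd_id.
by rewrite -raddf_sum x2 raddf0.
Qed.
End SimpleContraction.

(** * The action on homology *)

Section SubquotientMaps.
Variables (U : zmodType) (Z B : zmodClosed U).

Lemma classE (x y : subgrp Z) :
  (subquotient_class B x == subquotient_class B y) = (val x - val y \in B).
Proof.
rewrite /subquotient_class -Quotient.idealrBE.
by rewrite unfold_in /sub_pred raddfB.
Qed.

Definition class_repr (c : subquotient Z B) : subgrp Z := repr c.

Lemma class_reprK (c : subquotient Z B) : subquotient_class B (class_repr c) = c.
Proof. by rewrite /subquotient_class reprK. Qed.

Lemma class_surj (c : subquotient Z B) : exists x : subgrp Z, c = subquotient_class B x.
Proof. by exists (class_repr c); rewrite class_reprK. Qed.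

Lemma classB (x y : subgrp Z) :
  subquotient_class B (x - y) = subquotient_class B x - subquotient_class B y.
Proof. by rewrite /subquotient_class raddfB. Qed.
End SubquotientMaps.

Section SubquotientMap.
Variables (U U' : zmodType) (Z B : zmodClosed U) (Z' B' : zmodClosed U').
Variable phi : {additive U -> U'}.
Hypotheses (phiZ : forall x, x \in Z -> phi x \in Z').
Hypotheses (phiB : forall x, x \in Z -> x \in B -> phi x \in B').

Definition cycle_map (x : subgrp Z) : subgrp Z' := Sub (phi (val x)) (phiZ (valP x)).

Definition subquotient_map (c : subquotient Z B) : subquotient Z' B' :=
  subquotient_class B' (cycle_map (class_repr c)).

Lemma subquotient_mapE x :
  subquotient_map (subquotient_class B x) = subquotient_class B' (cycle_map x).
Proof.
rewrite /subquotient_map; set y := class_repr _.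
have /eqP : subquotient_class B x = subquotient_class B y by rewrite class_reprK.
rewrite classE => xy; apply/eqP; rewrite classE /= -raddfB.
apply: phiB; first by apply: rpredB; exact: valP.
have : val y - val x \in B by rewrite -opprB rpredN.
exact.
Qed.

Lemma subquotient_map_additive : zmod_morphism subquotient_map.
Proof.
move=> c d; have [x ->] := class_surj c; have [y ->] := class_surj d.
rewrite -classB !subquotient_mapE -classB; congr (subquotient_class _ _).
by apply: val_inj; rewrite /= raddfB.
Qed.
End SubquotientMap.

Section HomologyPull.
Variables (n i : nat) (T T' : tree) (f : contraction T T').

Lemma chain_pull_cycles (x : tensor_mod T') : x \in sw_cycles n i -> chain_pull f x \in sw_cycles n i.
Proof.
move=> /asboolP[/sw_reducedP xr xh xd]; apply/asboolP; split.
- exact/sw_reducedP/chain_pull_reduced.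
- exact: chain_pull_bihomogeneous.
- by rewrite chain_pull_diff // xd raddf0.
Qed.

Lemma chain_pull_boundaries (x : tensor_mod T') : x \in sw_cycles n i -> x \in sw_boundaries n i ->
  chain_pull f x \in sw_boundaries n i.
Proof.
move=> _ /asboolP[y [/sw_reducedP yr yh ->]]; apply/asboolP; exists (chain_pull f y); split.
- exact/sw_reducedP/chain_pull_reduced.
- exact: chain_pull_bihomogeneous.
- by rewrite chain_pull_diff.
Qed.

Definition homology_pull : sw_homology T' n i -> sw_homology T n i :=
  @subquotient_map _ _ _ (sw_boundaries (T := T') n i) _ (sw_boundaries (T := T) n i) _ chain_pull_cycles.

Lemma homology_pull_additive : zmod_morphism homology_pull.
Proof. exact: (subquotient_map_additive chain_pull_cycles chain_pull_boundaries). Qed.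

HB.instance Definition _ := GRing.isZmodMorphism.Build (sw_homology T' n i)
  (sw_homology T n i) homology_pull homology_pull_additive.

Lemma homology_pullE (z : sw_cycle T' n i) :
  homology_pull (sw_class z) = sw_class (cycle_map chain_pull_cycles z).
Proof. exact: (subquotient_mapE chain_pull_cycles chain_pull_boundaries). Qed.
End HomologyPull.

Lemma cycle_coord (T : tree) n i (z : sw_cycle T n i) : reduced_coord (val z).
Proof. by have /asboolP[/sw_reducedP] := valP z. Qed.

Section Action.
Variables n i : nat.

Lemma homology_pull_id (T : tree) (c : sw_homology T n i) : homology_pull (contr_id T) c = c.
Proof.
have [z ->] := class_surj c; rewrite homology_pullE; congr (sw_class _).
by apply: val_inj; rewrite /= chain_pull_id //; exact: cycle_coord.
Qed.

Lemma homology_pull_comp (T T' T'' : tree) (f : contraction T T') (g : contraction T' T'')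
    (c : sw_homology T'' n i) :
  homology_pull (contr_comp g f) c = homology_pull f (homology_pull g c).
Proof.
have [z ->] := class_surj c; have E1 := homology_pullE (contr_comp g f) z.
have E2 := homology_pullE g z.
have E3 := homology_pullE f (cycle_map (chain_pull_cycles g) z).
apply: etrans E1 _; apply: etrans (esym (etrans (congr1 _ E2) E3)).
congr (sw_class _); apply: val_inj; exact: chain_pull_comp.
Qed.

Definition homology_action : tree_action (fun T => sw_homology T n i) :=
  TreeAction homology_pull_id homology_pull_comp.

Lemma homology_actionP : sw_action homology_action.
Proof.
move=> T T' f simple z; exists (cycle_map (chain_pull_cycles f) z); split.
  by rewrite /= sw_pull_simple //; exact: cycle_coord.
exact: homology_pullE.
Qed.
End Action.

(** * Generation by star classes *)

Section LinearExtension.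
Variables (K : choiceType) (V : zmodType) (phi : K -> V).

Definition lin (X : {malg int[K]}) : V := \sum_(b <- msupp X) phi b *~ mcoeff b X.

Lemma linE (d : {fset K}) X : (msupp X `<=` d)%fset ->
  lin X = \sum_(b <- d) phi b *~ mcoeff b X.
Proof.
by move=> Xd; rewrite /lin (big_fset_incl _ Xd) // => b _ /mcoeff_outdom->; rewrite mulr0z.
Qed.

Lemma lin_additive : zmod_morphism lin.
Proof.
move=> X Y; pose d := (msupp X `|` msupp Y)%fset.
rewrite (linE (d := d)) ?msuppB_le // (@linE d X) ?fsubsetUl // (@linE d Y) ?fsubsetUr //.
by rewrite -sumrB; apply: eq_bigr => b _; rewrite mcoeffB mulrzBr.
Qed.

HB.instance Definition _ := GRing.isZmodMorphism.Build {malg int[K]} V lin lin_additive.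

Lemma linU b : lin << b >> = phi b.
Proof. by rewrite (linE msuppU_le) big_seq_fset1 mcoeffUU mulr1z. Qed.
End LinearExtension.

Lemma linUz (K : choiceType) (V : zmodType) (phi : K -> V) b (z : int) :
  lin phi (<< b >> *~ z) = phi b *~ z.
Proof. by rewrite raddfMz; congr (_ *~ _); exact: linU. Qed.

Lemma linUB (K : choiceType) (V : zmodType) (phi : K -> V) b1 b2 :
  lin phi (<< b1 >> - << b2 >>) = phi b1 - phi b2.
Proof. by rewrite raddfB; congr (_ - _); exact: linU. Qed.

(* Keeps unification from unfolding linear extensions. *)
Opaque lin.

Lemma malg_expand (K : choiceType) (X : {malg int[K]}) :
  X = \sum_(b <- msupp X) << b >> *~ mcoeff b X.
Proof.
rewrite {1}[X]monalgE; apply: eq_bigr => b _; exact: monomial_scale.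
Qed.

(** The span over the integers, whereas [spanned] is over the edge ring; the inductive form gives
    induction on the elements of the span. *)
Inductive zspan (V : zmodType) (G : V -> Prop) : V -> Prop :=
| zspan0 : zspan G 0
| zspanB x y : zspan G x -> zspan G y -> zspan G (x - y)
| zspan_gen x : G x -> zspan G x.

Section Zspan.
Variables (V : zmodType) (G : V -> Prop).

Lemma zspanN x : zspan G x -> zspan G (- x).
Proof. by move=> h; rewrite -sub0r; apply: zspanB => //; exact: zspan0. Qed.

Lemma zspanD x y : zspan G x -> zspan G y -> zspan G (x + y).
Proof. by move=> hx hy; rewrite -[y]opprK; apply: zspanB => //; exact: zspanN. Qed.

Lemma zspanMn x k : zspan G x -> zspan G (x *+ k).
Proof.
by move=> h; elim: k => [|k IH]; [exact: zspan0 | rewrite mulrS; exact: zspanD].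
Qed.

Lemma zspanMz x (z : int) : zspan G x -> zspan G (x *~ z).
Proof.
by case: z => k h; [exact: zspanMn | rewrite NegzE mulrNz; apply/zspanN/zspanMn].
Qed.

Lemma zspan_sum (I : Type) (s : seq I) (P : pred I) (F : I -> V) :
  (forall i, P i -> zspan G (F i)) -> zspan G (\sum_(i <- s | P i) F i).
Proof.
by move=> h; elim/big_ind: _ => //; [exact: zspan0 | exact: zspanD].
Qed.

Lemma zspan_image (W : zmodType) (H : W -> Prop) (phi : {additive V -> W}) :
  (forall x, G x -> zspan H (phi x)) -> forall x, zspan G x -> zspan H (phi x).
Proof.
move=> h x; elim=> [|{}x y _ hx _ hy|{}x /h//]; first by rewrite raddf0; exact: zspan0.
by rewrite raddfB; exact: zspanB.
Qed.

Lemma zspan_eq (W : zmodType) (f g : {additive V -> W}) :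
  (forall x, G x -> f x = g x) -> forall x, zspan G x -> f x = g x.
Proof.
move=> h x; elim=> [|{}x y _ hx _ hy|{}x /h//]; first by rewrite !raddf0.
by rewrite !raddfB hx hy.
Qed.

Lemma zspan_sub (H : V -> Prop) : (forall x, G x -> zspan H x) ->
  forall x, zspan G x -> zspan H x.
Proof. exact: (@zspan_image V H (idfun : {additive V -> V})). Qed.
End Zspan.

(** The terms at [(u, v)] and [(v, u)] cancel. The diagonal is a separate hypothesis because [V] may
    have 2-torsion. *)
Lemma antisym_sum (V : zmodType) (I : finType) (F : I -> I -> V) :
  (forall u, F u u = 0) -> (forall u v, F u v = - F v u) ->
  \sum_u \sum_v F u v = 0.
Proof.
move=> F0 FA.
pose lt (u v : I) := (enum_rank u < enum_rank v)%N.
have E u v : F u v = (if lt u v then F u v else 0) + (if lt v u then F u v else 0).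
  rewrite /lt; case: ltngtP => [||/ord_inj/enum_rank_inj->]; rewrite ?addr0 ?add0r //.
under eq_bigr do under eq_bigr do rewrite E.
under eq_bigr do rewrite big_split /=.
rewrite big_split /= [X in _ + X]exchange_big /= -big_split big1 // => u _.
rewrite -big_split big1 // => v _ /=.
by case: ifP => _; rewrite ?addr0 // FA addNr.
Qed.

(** * A tensor product of truncated Koszul complexes *)

Section KoszulBasis.
Variables (V E : finType) (down : V -> {set E}) (rk : V -> nat).
Hypothesis down_disjoint : forall e u v, e \in down u -> e \in down v -> u = v.
Hypothesis rk_inj : injective rk.
Let state := {ffun V -> option E}.
Let mono := {ffun E -> nat}.
Let basis := (state * mono)%type.
Let L := {malg int[basis]}.
Implicit Types (t : state) (m : mono) (u v : V) (a b e : E).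

Definition occ t : {set V} := finset (fun v => t v != None).

Lemma occ_in t v : (v \in occ t) = (t v != None).
Proof. by rewrite inE. Qed.

Lemma occ_some t v e : occ (upd t v (Some e)) = (v |: occ t)%SET.
Proof. by apply/finset.setP => u; rewrite !inE updE; case: (u == v). Qed.

Definition below (A : {set V}) v : nat := \sum_(u in A) (rk u < rk v)%N.

Lemma rk_ltn u v : u != v -> (rk u < rk v)%N = ~~ (rk v < rk u)%N.
Proof. by move=> uv; case: ltngtP => // /rk_inj E0; rewrite E0 eqxx in uv. Qed.

Definition madd m e : mono := [ffun x => m x + (x == e)]%N.
Definition msub m e : mono := [ffun x => m x - (x == e)]%N.

Lemma maddE m e x : madd m e x = (m x + (x == e))%N.
Proof. by rewrite ffunE. Qed.

Lemma msubE m e x : msub m e x = (m x - (x == e))%N.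
Proof. by rewrite ffunE. Qed.

Lemma maddC m a b : madd (madd m a) b = madd (madd m b) a.
Proof. by apply/ffunP => x; rewrite !maddE; exact: addnAC. Qed.

Lemma msubK m a : (0 < m a)%N -> madd (msub m a) a = m.
Proof.
move=> ma; apply/ffunP => x; rewrite maddE msubE.
by case: eqP => [->|_]; rewrite ?subn0 ?addn0 // subnK.
Qed.

Lemma maddK m a : msub (madd m a) a = m.
Proof. by apply/ffunP => x; rewrite msubE maddE addnK. Qed.

Lemma madd_msub m a b : a != b -> madd (msub m a) b = msub (madd m b) a.
Proof.
move=> ab; apply/ffunP => x; rewrite maddE !msubE maddE.
by have [->|_] := eqVneq x a; rewrite ?(negPf ab) ?subn0 ?addn0.
Qed.

Definition sgn t v : int := (-1) ^+ below (occ t) v.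

Lemma sgnM t v : sgn t v * sgn t v = 1.
Proof. by rewrite /sgn -expr2 sqrr_sign. Qed.

Lemma occ_none t v : occ (upd t v None) = (occ t :\ v)%SET.
Proof. by apply/finset.setP => u; rewrite !inE updE; case: (u == v). Qed.

Lemma sgn_upd t v (a : option E) : sgn (upd t v a) v = sgn t v.
Proof.
rewrite /sgn /below; congr (_ ^+ _); rewrite big_mkcond [RHS]big_mkcond.
apply: eq_bigr => u _; rewrite !occ_in.
have [->|uv] := eqVneq u v; first by rewrite ltnn !if_same.
by rewrite upd_other.
Qed.

(** Filling [v] and emptying [u] anticommute, since exactly one of the two vertices precedes the
    other. *)
Lemma sgn_anti t u v a : u != v -> t v = None -> t u != None ->
  sgn t v * sgn (upd t v (Some a)) u = - (sgn t u * sgn (upd t u None) v).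
Proof.
move=> uv tv tu.
have ut : u \in occ t by rewrite occ_in.
have vt : v \notin occ t by rewrite occ_in tv.
rewrite /sgn occ_some occ_none -!exprD.
have E1 : below (v |: occ t)%SET u = ((rk v < rk u) + below (occ t) u)%N.
  by rewrite /below big_setU1.
have E2 : below (occ t) v = ((rk u < rk v) + below (occ t :\ u)%SET v)%N.
  by rewrite /below (big_setD1 u).
rewrite E1 -signr_odd -[X in _ = - X]signr_odd !oddD E2 oddD.
have := rk_ltn uv; case: (rk u < rk v)%N; case: (rk v < rk u)%N => //= _;
  by case: (odd _); case: (odd _).
Qed.

Lemma sgn_anti2 t u v : u != v -> t v != None -> t u != None ->
  sgn t v * sgn (upd t v None) u = - (sgn t u * sgn (upd t u None) v).
Proof.
move=> uv tv tu.
rewrite /sgn !occ_none -!exprD.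
have E1 : below (occ t) u = ((rk v < rk u) + below (occ t :\ v)%SET u)%N.
  by rewrite /below (big_setD1 v) // occ_in.
have E2 : below (occ t) v = ((rk u < rk v) + below (occ t :\ u)%SET v)%N.
  by rewrite /below (big_setD1 u) // occ_in.
rewrite E1 E2 -signr_odd -[X in _ = - X]signr_odd !oddD.
have := rk_ltn uv; case: (rk u < rk v)%N; case: (rk v < rk u)%N => //= _;
  by case: (odd _); case: (odd _).
Qed.

(* The complex in the coordinates [e - up v], for [e] in [down v]: the basis
   element [(t, m)] stands for the monomial [m] in these coordinates times the
   differences of half-edges recorded by [t]. *)
Definition diff_at v (x : basis) : L :=
  if x.1 v is Some e then << (upd x.1 v None, madd x.2 e) >> *~ sgn x.1 v else 0.

Definition diff0 (x : basis) : L := \sum_v diff_at v x.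

Lemma diff_at_some v t m e : t v = Some e ->
  diff_at v (t, m) = << (upd t v None, madd m e) >> *~ sgn t v.
Proof. by rewrite /diff_at /= => ->. Qed.

Lemma diff_at_upd v t m a :
  diff_at v (upd t v (Some a), m) = << (upd t v None, madd m a) >> *~ sgn t v.
Proof. by rewrite (diff_at_some _ (upd_same t v (Some a))) upd_upd sgn_upd. Qed.

Lemma diff_at_none v t m : t v = None -> diff_at v (t, m) = 0.
Proof. by rewrite /diff_at /= => ->. Qed.

Lemma upd_comm t u v (a b : option E) : u != v -> upd (upd t u a) v b = upd (upd t v b) u a.
Proof.
move=> uv; apply/ffunP => w; rewrite !updE.
by have [->|//] := eqVneq w v; rewrite eq_sym (negPf uv).
Qed.

Lemma diff0_diff0 x : lin diff0 (diff0 x) = 0.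
Proof.
case: x => t m; rewrite {2}/diff0 raddf_sum /=.
rewrite (eq_bigr (fun v => \sum_u lin (diff_at u) (diff_at v (t, m)))); last first.
  move=> v _; case tv: (t v) => [e|]; last first.
    by rewrite diff_at_none // raddf0 big1 // => u _; rewrite raddf0.
  rewrite (diff_at_some _ tv) linUz /diff0 mulrz_suml; apply: eq_bigr => u _.
  by rewrite linUz.
apply: antisym_sum => [u|v u].
  case tu: (t u) => [e|]; last by rewrite diff_at_none // raddf0.
  by rewrite (diff_at_some _ tu) linUz diff_at_none ?upd_same ?mul0rz.
have [->|uv] := eqVneq u v.
  case tv: (t v) => [e|]; last by rewrite diff_at_none // raddf0 oppr0.
  by rewrite (diff_at_some _ tv) linUz diff_at_none ?upd_same ?mul0rz ?oppr0.
have vu : v != u by rewrite eq_sym.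
case tv: (t v) => [e|]; case tu: (t u) => [k|].
- have X1 : upd t v None u = Some k by rewrite upd_other.
  have X2 : upd t u None v = Some e by rewrite upd_other.
  rewrite (diff_at_some _ tv) (diff_at_some _ tu) [LHS]linUz [X in - X]linUz.
  rewrite (diff_at_some _ X1) (diff_at_some _ X2) (upd_comm _ _ _ uv) maddC.
  rewrite -mulrzA -mulrzA -mulrNz; apply: (congr1 (intmul _)).
  by rewrite mulrC [in RHS]mulrC sgn_anti2 ?tu ?tv.
- have X1 : upd t v None u = None by rewrite upd_other.
  rewrite (diff_at_some _ tv) [LHS]linUz (diff_at_none _ X1) mul0rz.
  by rewrite (diff_at_none _ tu) raddf0 oppr0.
- have X2 : upd t u None v = None by rewrite upd_other.
  rewrite (diff_at_some _ tu) [X in - X]linUz (diff_at_none _ X2) mul0rz oppr0.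
  by rewrite (diff_at_none _ tv) raddf0.
by rewrite (diff_at_none _ tv) (diff_at_none _ tu) [LHS]raddf0 [X in - X]raddf0 oppr0.
Qed.

Definition pivot v m : option E := [pick e in down v | (0 < m e)%N].

Lemma eq_pivot v m1 m2 : (forall e, e \in down v -> (0 < m1 e)%N = (0 < m2 e)%N) ->
  pivot v m1 = pivot v m2.
Proof.
move=> h; apply: eq_pick => e /=; case ed: (e \in down v) => //=; exact: h.
Qed.

Lemma pivot_madd u v m a : a \in down u -> u != v -> pivot v (madd m a) = pivot v m.
Proof.
move=> ad uv; apply: eq_pivot => e ed; rewrite maddE.
have [ea|_] := eqVneq e a; last by rewrite addn0.
by case/eqP: uv; rewrite ea in ed; exact: down_disjoint ad ed.
Qed.

Lemma pivotP v m a : pivot v m = Some a -> a \in down v /\ (0 < m a)%N.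
Proof. by rewrite /pivot; case: pickP => // e /andP[ed me] [<-]. Qed.

(* Any variable at [v] dividing the monomial can be chosen: the choice depends on
   the variables at [v] only, so it commutes with the differential at the other
   vertices. *)
Definition homot v (x : basis) : L :=
  if x.1 v is None then
    if pivot v x.2 is Some a then << (upd x.1 v (Some a), msub x.2 a) >> *~ sgn x.1 v
    else 0
  else 0.

(** What [homotopy] leaves over. At an occupied vertex with [a] different from [e], it is a monomial
    times the relation between the variables [a] and [e], hence a star; at an empty vertex, it keeps
    the monomials without variables at [v]. *)
Definition proj_at v (x : basis) : L :=
  if x.1 v is Some e then
    if pivot v (madd x.2 e) is Some a
    then << x >> - << (upd x.1 v (Some a), msub (madd x.2 e) a) >> else 0
  else if pivot v x.2 is Some _ then 0 else << x >>.

Definition admissible t : bool :=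
  [forall v, if t v is Some e then e \in down v else true].

Lemma admissibleP t v e : admissible t -> t v = Some e -> e \in down v.
Proof. by move=> /forallP/(_ v); case: (t v) => // a ad [<-]. Qed.

Lemma admissible_upd t v e : admissible t -> e \in down v -> admissible (upd t v (Some e)).
Proof.
move=> /forallP at0 ed; apply/forallP => u; rewrite updE.
by have [->|_] := eqVneq u v; last exact: at0.
Qed.

Lemma admissible_none t v : admissible t -> admissible (upd t v None).
Proof. by move=> /forallP at0; apply/forallP => u; rewrite updE; case: (u == v). Qed.

Lemma homot_some v t m e : t v = Some e -> homot v (t, m) = 0.
Proof. by rewrite /homot /= => ->. Qed.

Lemma homot_pivot v t m a : t v = None -> pivot v m = Some a ->
  homot v (t, m) = << (upd t v (Some a), msub m a) >> *~ sgn t v.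
Proof. by rewrite /homot /= => -> ->. Qed.

Lemma homot_nopivot v t m : t v = None -> pivot v m = None -> homot v (t, m) = 0.
Proof. by rewrite /homot /= => -> ->. Qed.

Lemma pivot_madd_exists v m e : e \in down v -> exists a, pivot v (madd m e) = Some a.
Proof.
move=> ed; rewrite /pivot; case: pickP => [a _|/(_ e)]; first by exists a.
by rewrite ed maddE eqxx addn1.
Qed.

Lemma homot_diff_other u v t m a : u != v -> admissible t -> t v = None ->
  pivot v m = Some a ->
  lin (homot v) (diff_at u (t, m)) =
  - (diff_at u (upd t v (Some a), msub m a) *~ sgn t v).
Proof.
move=> uv adm tv pa; have vu : v != u by rewrite eq_sym.
case tu: (t u) => [e|]; last first.
  have X1 : upd t v (Some a) u = None by rewrite upd_other.
  by rewrite (diff_at_none _ tu) (diff_at_none _ X1) raddf0 mul0rz oppr0.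
have ed := admissibleP adm tu; have [ad ma] := pivotP pa.
have ae : a != e.
  by apply: contraNneq uv => h; rewrite h in ad; apply/eqP; exact: down_disjoint ed ad.
have X1 : upd t u None v = None by rewrite upd_other.
have X2 : upd t v (Some a) u = Some e by rewrite upd_other.
have X3 : pivot v (madd m e) = Some a by rewrite (pivot_madd _ ed uv).
rewrite (diff_at_some _ tu) [LHS]linUz (homot_pivot X1 X3) (diff_at_some _ X2).
rewrite (upd_comm _ _ _ uv) (madd_msub _ ae).
rewrite -mulrzA -mulrzA -mulrNz; apply: (congr1 (intmul _)).
by rewrite mulrC [X in - X]mulrC sgn_anti ?tu // opprK.
Qed.

Lemma homot_diff_zero u v t m : u != v -> admissible t ->
  (t v <> None \/ pivot v m = None) ->
  lin (homot v) (diff_at u (t, m)) = 0.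
Proof.
move=> uv adm h; have vu : v != u by rewrite eq_sym.
case tu: (t u) => [e|]; last by rewrite (diff_at_none _ tu) raddf0.
have ed := admissibleP adm tu.
have X1 : upd t u None v = t v by rewrite upd_other.
rewrite (diff_at_some _ tu) linUz.
case tv: (t v) h X1 => [k|] h X1; first by rewrite (homot_some _ X1) mul0rz.
case: h => // h; rewrite -(pivot_madd m ed uv) in h.
by rewrite (homot_nopivot X1 h) mul0rz.
Qed.

(** The differential at the other vertices anticommutes with [homot v], so only the terms at [v]
    survive. Admissibility keeps the variables of other vertices from affecting the pivot at [v]. *)
Lemma homotopy v t m : admissible t ->
  lin diff0 (homot v (t, m)) + lin (homot v) (diff0 (t, m)) = << (t, m) >> - proj_at v (t, m).
Proof.
move=> adm; rewrite {2}/diff0 raddf_sum /= (bigD1 v) //=.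
case tv: (t v) => [e|].
  have ed := admissibleP adm tv.
  rewrite big1 ?addr0; last by move=> u uv; apply: homot_diff_zero; rewrite // tv; left.
  rewrite (homot_some _ tv) raddf0 add0r (diff_at_some _ tv) linUz.
  have [a pa] := pivot_madd_exists m ed.
  rewrite (@homot_pivot _ _ _ a) ?upd_same // upd_upd sgn_upd -mulrzA sgnM.
  by rewrite /proj_at /= tv pa opprB addrC subrK.
rewrite diff_at_none // raddf0 add0r.
case pa: (pivot v m) => [a|]; last first.
  rewrite homot_nopivot // raddf0 add0r big1; last first.
    by move=> u uv; apply: homot_diff_zero => //; right.
  by rewrite /proj_at /= tv pa subrr.
have [ad ma] := pivotP pa.
rewrite (homot_pivot tv pa) linUz /proj_at /= tv pa subr0 {1}/diff0 (bigD1 v) //=.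
rewrite diff_at_upd mulrzDl -mulrzA sgnM msubK // -tv upd_id -addrA.
rewrite (eq_bigr _ (fun u uv => homot_diff_other uv adm tv pa)) sumrN -mulrz_suml.
by rewrite subrr addr0.
Qed.

(* In these coordinates, multiplication by the star cycle at [v] with half-edges
   [a], [b] and the rootward one. *)
Definition star1 v a b (x : basis) : L :=
  << (upd x.1 v (Some b), madd x.2 a) >> - << (upd x.1 v (Some a), madd x.2 b) >>.

Lemma sub_swap (W : zmodType) (x y z w : W) : x - y - (z - w) = x - z - (y - w).
Proof. by rewrite !opprD !opprK addrACA. Qed.

(** A star at [u] multiplies by variables of [u] only, so it changes neither the pivot at [v] nor
    the symbol there. *)
Lemma proj_star u v a b x : u != v -> a \in down u -> b \in down u ->
  lin (proj_at v) (star1 u a b x) = lin (star1 u a b) (proj_at v x).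
Proof.
move=> uv ad bd; have vu : v != u by rewrite eq_sym.
case: x => t m; rewrite [LHS]linUB /proj_at /= !upd_other //.
case tv: (t v) => [e|].
  have p1 : pivot v (madd (madd m a) e) = pivot v (madd m e).
    by rewrite maddC (pivot_madd _ ad uv).
  have p2 : pivot v (madd (madd m b) e) = pivot v (madd m e).
    by rewrite maddC (pivot_madd _ bd uv).
  rewrite p1 p2; case pc: (pivot v (madd m e)) => [c|]; last by rewrite [RHS]raddf0 subrr.
  have [cd mc] := pivotP pc.
  have ca : c != a by apply: contraNneq uv => h; rewrite h in cd; apply/eqP; exact: down_disjoint ad cd.
  have cb : c != b by apply: contraNneq uv => h; rewrite h in cd; apply/eqP; exact: down_disjoint bd cd.
  have E1 : (upd (upd t u (Some b)) v (Some c), msub (madd (madd m a) e) c) =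
      (upd (upd t v (Some c)) u (Some b), madd (msub (madd m e) c) a).
    by rewrite (upd_comm _ _ _ uv) maddC madd_msub.
  have E2 : (upd (upd t u (Some a)) v (Some c), msub (madd (madd m b) e) c) =
      (upd (upd t v (Some c)) u (Some a), madd (msub (madd m e) c) b).
    by rewrite (upd_comm _ _ _ uv) maddC madd_msub.
  rewrite E1 E2 [RHS]linUB; exact: sub_swap.
rewrite !(pivot_madd _ _ uv) //; case: (pivot v m) => [c|]; last by rewrite linU.
by rewrite [RHS]raddf0 subrr.
Qed.
End KoszulBasis.

Lemma malg_ext (K : choiceType) (W : zmodType) (f g : {additive {malg int[K]} -> W}) :
  (forall b, f << b >> = g << b >>) -> forall X, f X = g X.
Proof.
move=> fg X; rewrite (malg_expand X) [LHS]raddf_sum [RHS]raddf_sum.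
by apply: eq_bigr => b _; rewrite [LHS]raddfMz [RHS]raddfMz fg.
Qed.

(** * Reduction of cycles to stars *)

Section StarBasis.
Variables (V E : finType) (down : V -> {set E}) (rk : V -> nat).
Hypothesis down_disjoint : forall e u v, e \in down u -> e \in down v -> u = v.
Hypothesis rk_inj : injective rk.
Let state := {ffun V -> option E}.
Let mono := {ffun E -> nat}.
Let basis := (state * mono)%type.
Let L := {malg int[basis]}.
Implicit Types (t : state) (m : mono) (u v : V) (a b e : E) (q : seq (V * E * E)) (A : {set V}).

Notation diff0 := (diff0 rk).
Notation homot := (homot down rk).
Notation proj := (proj_at down).
Notation adm := (admissible down).

Definition mdegree m : nat := \sum_e m e.

Lemma mdegree_add m a : mdegree (madd m a) = (mdegree m).+1.
Proof.
rewrite /mdegree; under eq_bigr do rewrite maddE.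
rewrite big_split /= -addn1; congr (_ + _)%N; rewrite (bigD1 a) //= eqxx big1 // => e ea.
by rewrite (negPf ea).
Qed.

Lemma mdegree_sub m a : (0 < m a)%N -> (mdegree (msub m a)).+1 = mdegree m.
Proof. by move=> ma; rewrite -(mdegree_add _ a) msubK. Qed.

Definition star_op (c : V * E * E) (X : L) : L := lin (star1 c.1.1 c.1.2 c.2) X.

Definition stars q (X : L) : L := foldl (fun X c => star_op c X) X q.

Lemma stars_additive q : zmod_morphism (stars q).
Proof.
elim: q => [//|c q IH] X Y; rewrite /stars /= -!/(stars q _) -IH; congr (stars q _).
exact: raddfB.
Qed.

HB.instance Definition _ q := GRing.isZmodMorphism.Build L L (stars q) (stars_additive q).

Lemma stars_cons c q t m : stars q (star_op c << (t, m) >>) =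
  stars q << (upd t c.1.1 (Some c.2), madd m c.1.2) >> -
  stars q << (upd t c.1.1 (Some c.1.2), madd m c.2) >>.
Proof.
rewrite -raddfB; apply: (congr1 (stars q)); exact: linU.
Qed.

Definition star_data q : bool :=
  all (fun c => (c.1.2 \in down c.1.1) && (c.2 \in down c.1.1)) q.

Lemma proj_stars v q X : star_data q -> v \notin [seq c.1.1 | c <- q] ->
  lin (proj v) (stars q X) = stars q (lin (proj v) X).
Proof.
elim: q X => [//|c q IH] X /= /andP[/andP[ad bd] qd].
rewrite inE negb_or => /andP[vc vq].
rewrite (IH _ qd vq); apply: (congr1 (stars q)).
rewrite /star_op.
apply: (@malg_ext _ _ (lin (proj v) \o lin (star1 c.1.1 c.1.2 c.2))
  (lin (star1 c.1.1 c.1.2 c.2) \o lin (proj v))) => x /=.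
rewrite linU [X in _ = lin _ X]linU; apply: (proj_star down_disjoint) => //.
by rewrite eq_sym.
Qed.

Definition basis_elt i n (X : L) : Prop := exists t m,
  [/\ X = << (t, m) >>, adm t, #|occ t| = i & (mdegree m + #|occ t|)%N = n].

(** A star adds one occupied vertex and one variable, hence one to the homological degree and two to
    the number of strands. *)
Definition star_elt A i n (X : L) : Prop := exists q t m,
  [/\ X = stars q << (t, m) >>, star_data q, uniq [seq c.1.1 | c <- q] &
      {subset [seq c.1.1 | c <- q] <= A}] /\
  [/\ adm t, (forall v, v \in A -> t v = None),
      (#|occ t| + size q)%N = i & (mdegree m + #|occ t| + (size q).*2)%N = n].

Lemma card_occ_some t v e : t v = None -> #|occ (upd t v (Some e))| = #|occ t|.+1.
Proof. by move=> tv; rewrite occ_some cardsU1 occ_in tv. Qed.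

Lemma card_occ_none t v e : t v = Some e -> #|occ (upd t v None)|.+1 = #|occ t|.
Proof.
by move=> tv; rewrite occ_none [in RHS](cardsD1 v) occ_in tv.
Qed.

Lemma stars_basis q t m i n : adm t -> star_data q -> uniq [seq c.1.1 | c <- q] ->
  (forall c, c \in q -> t c.1.1 = None) -> (#|occ t| + size q)%N = i ->
  (mdegree m + #|occ t| + (size q).*2)%N = n ->
  zspan (basis_elt i n) (stars q << (t, m) >>).
Proof.
elim: q t m => [|c q IH] t m adt.
  move=> _ _ _ /=; rewrite !addn0 => ti mn; apply: zspan_gen.
  by exists t, m.
move=> /= /andP[/andP[ad bd] qd] /andP[cq uq] tq ti mn.
have tc : t c.1.1 = None by apply: tq; rewrite mem_head.
have tq' e (c' : V * E * E) : c' \in q -> upd t c.1.1 (Some e) c'.1.1 = None.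
  move=> c'q; rewrite upd_other; first by apply: tq; rewrite inE c'q orbT.
  by apply: contraNneq cq => <-; exact: map_f.
rewrite stars_cons; apply: zspanB; apply: IH => //.
- exact: admissible_upd.
- exact: tq'.
- by rewrite card_occ_some // addSnnS.
- by rewrite mdegree_add card_occ_some // -mn doubleS; lia.
- exact: admissible_upd.
- exact: tq'.
- by rewrite card_occ_some // addSnnS.
- by rewrite mdegree_add card_occ_some // -mn doubleS; lia.
Qed.

Lemma star_elt_basis A i n X : star_elt A i n X -> zspan (basis_elt i n) X.
Proof.
move=> [q [t [m [[-> qd uq qA] [adt tA ti mn]]]]]; apply: stars_basis => //.
by move=> c cq; apply: tA; apply: qA; exact: map_f.
Qed.

Lemma homot_basis v i n X : basis_elt i n X -> zspan (basis_elt i.+1 n) (lin (homot v) X).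
Proof.
move=> [t [m [-> adt ti mn]]]; rewrite linU.
case tv: (t v) => [e|]; first by rewrite (homot_some _ _ _ tv); exact: zspan0.
case pa: (pivot down v m) => [a|]; last by rewrite (homot_nopivot _ tv pa); exact: zspan0.
rewrite (homot_pivot _ tv pa); apply/zspanMz/zspan_gen.
have [ad ma] := pivotP pa.
exists (upd t v (Some a)), (msub m a); split=> //.
- exact: admissible_upd.
- by rewrite card_occ_some // ti.
- by rewrite card_occ_some // -mn -(mdegree_sub ma) addSnnS.
Qed.

(** The projection at [v] commutes with the stars already present and leaves either a star at [v] or
    an empty symbol. *)
Lemma proj_star_elt v A i n X : v \notin A -> star_elt A i n X ->
  zspan (star_elt (v |: A)%SET i n) (lin (proj v) X).
Proof.
move=> vA [q [t [m [[-> qd uq qA] [adt tA ti mn]]]]].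
have vq : v \notin [seq c.1.1 | c <- q] by apply: contra vA => /qA.
have qA' : {subset [seq c.1.1 | c <- q] <= (v |: A)%SET}.
  by move=> u /qA uA; rewrite finset.in_setU1 uA orbT.
rewrite (proj_stars _ qd vq) linU.
case tv: (t v) => [e|]; last first.
  have -> : proj v (t, m) = if pivot down v m is Some _ then 0 else << (t, m) >>.
    by rewrite /proj_at /= tv.
  case: (pivot down v m) => [a|]; first by rewrite raddf0; exact: zspan0.
  apply: zspan_gen; exists q, t, m; split; split=> //.
  by move=> u; rewrite finset.in_setU1 => /orP[/eqP->|/tA].
have ed := admissibleP adt tv.
have [a pa] := pivot_madd_exists m ed.
have -> : proj v (t, m) = << (t, m) >> - << (upd t v (Some a), msub (madd m e) a) >>.
  by rewrite /proj_at /= tv pa.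
(* If the pivot is the recorded edge itself, the two terms of the projection coincide. *)
have [ea|ae] := eqVneq a e.
  by rewrite ea maddK -tv upd_id subrr raddf0; exact: zspan0.
have [ad ma] := pivotP pa; rewrite maddE (negPf ae) addn0 in ma.
pose t0 := upd t v None.
have E1 : (t, m) = (upd t0 v (Some e), madd (msub m a) a).
  by rewrite upd_upd -tv upd_id msubK.
have E2 : (upd t v (Some a), msub (madd m e) a) = (upd t0 v (Some a), madd (msub m a) e).
  by rewrite upd_upd madd_msub.
rewrite E1 E2 raddfB -(stars_cons (v, a, e)).
(* The variable [a] divides [m]; it is taken out of the monomial and reappears in the star with [a]
   and [e]. *)
apply: zspan_gen; exists ((v, a, e) :: q), t0, (msub m a); split; split=> //=.
- by rewrite ad ed.
- by rewrite vq.
- by move=> u; rewrite inE => /orP[/eqP->|/qA']; rewrite ?finset.setU11.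
- exact: admissible_none.
- move=> u; rewrite finset.in_setU1; have [->|uv] := eqVneq u v; first by rewrite upd_same.
  by move=> /= uA; rewrite upd_other // tA.
- by rewrite -addSnnS (card_occ_none tv).
- by rewrite -mn -(mdegree_sub ma) -(card_occ_none tv) -/t0 doubleS; lia.
Qed.

Lemma diff_diff (X : L) : lin diff0 (lin diff0 X) = 0.
Proof.
apply: (@malg_ext _ L (lin diff0 \o lin diff0) \0%R) => x /=.
by rewrite [X in lin _ X]linU diff0_diff0.
Qed.

Lemma homotopy_span v i n (X : L) : zspan (basis_elt i n) X -> lin diff0 X = 0 ->
  X - lin (proj v) X = lin diff0 (lin (homot v) X).
Proof.
move=> Xs dX.
have : lin diff0 (lin (homot v) X) + lin (homot v) (lin diff0 X) = X - lin (proj v) X.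
  apply: (@zspan_eq _ _ _ ((lin diff0 \o lin (homot v)) \+ (lin (homot v) \o lin diff0))
    (idfun \- lin (proj v)) _ _ Xs) => _ [t [m [-> adt _ _]]] /=.
  rewrite [X in lin _ X + _]linU [X in _ + lin _ X]linU [X in _ = _ - X]linU.
  exact: homotopy.
by rewrite dX raddf0 addr0.
Qed.

(* The homotopies are applied to the vertices one after the other; [A] is the set
   of vertices already treated, at which only stars or empty symbols remain. *)
Lemma star_reduction A (s : seq V) i n (X : L) : uniq s -> [disjoint s & A] ->
  zspan (star_elt A i n) X -> lin diff0 X = 0 ->
  exists X' W, [/\ zspan (star_elt (A :|: [set v in s])%SET i n) X',
                zspan (basis_elt i.+1 n) W & X - X' = lin diff0 W].
Proof.
elim: s A X => [|v s IH] A X.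
  move=> _ _ Xs dX; exists X, 0; split; [|exact: zspan0|by rewrite subrr raddf0].
  suff -> : (A :|: [set v in [::]] = A)%SET by [].
  by apply/finset.setP => u; rewrite !inE orbF.
move=> /andP[vs us]; rewrite disjoint_cons => /andP[vA sA] Xs dX.
have Xb : zspan (basis_elt i n) X by apply: zspan_sub Xs => Y; exact: star_elt_basis.
have hom := homotopy_span v Xb dX.
have Ps : zspan (star_elt (v |: A)%SET i n) (lin (proj v) X).
  by apply: zspan_image Xs => Y; exact: proj_star_elt.
have dP : lin diff0 (lin (proj v) X) = 0.
  have -> : lin (proj v) X = X - lin diff0 (lin (homot v) X) by rewrite -hom subKr.
  by rewrite raddfB /= dX diff_diff subrr.
have dj : [disjoint s & (v |: A)%SET].
  rewrite disjoint_sym disjoint_subset; apply/fintype.subsetP => u.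
  rewrite finset.in_setU1 inE /= => /orP[/eqP->//|uA].
  by apply: contraL uA => us'; move/disjointFr: sA => /(_ u us') ->.
have [X' [W [X's Ws E1]]] := IH _ _ us dj Ps dP.
exists X', (lin (homot v) X + W); split.
- suff <- : ((v |: A) :|: [set v in s] = A :|: [set v0 in v :: s])%SET by [].
  by apply/finset.setP => u; rewrite !inE; case: (u == v); case: (u \in A).
- by apply: (zspanD _ Ws); apply: zspan_image Xb => Y; exact: homot_basis.
- by rewrite raddfD /= -hom -E1 addrA subrK.
Qed.

Lemma cycle_reduction i n (X : L) : zspan (basis_elt i n) X -> lin diff0 X = 0 ->
  exists X' W, [/\ zspan (star_elt finset.setT i n) X',
                zspan (basis_elt i.+1 n) W & X - X' = lin diff0 W].
Proof.
move=> Xs dX.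
have Xs' : zspan (star_elt finset.set0 i n) X.
  apply: zspan_sub Xs => Y [t [m [-> adt ti mn]]]; apply: zspan_gen.
  by exists [::], t, m; split; split=> //=; rewrite ?addn0 // => v; rewrite inE.
have [||X' [W [X's Ws E1]]] := star_reduction (s := enum V) _ _ Xs' dX.
- exact: enum_uniq.
- by rewrite disjoint_sym disjoint_subset; apply/fintype.subsetP => u; rewrite inE.
exists X', W; split=> //; suff <- : (finset.set0 :|: [set v in enum V] = finset.setT)%SET by [].
by apply/finset.setP => u; rewrite !inE mem_enum.
Qed.
End StarBasis.

Section Hdeg0.
Variable I : choiceType.

Lemma hdeg_nat (k : nat) : hdeg 0 (k%:R : {malg int[{cmonom I}]}).
Proof. by rewrite pmulrn; apply: hdegMz; exact: hdeg1. Qed.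
End Hdeg0.

Section RingSums.
Variables (R : comNzRingType) (I : finType).

Lemma sum_mul_delta (F : I -> R) e : \sum_k F k * (e == k)%:R = F e.
Proof.
rewrite (bigD1 e) //= eqxx mulr1 big1 ?addr0 // => k ke.
by rewrite eq_sym (negPf ke) mulr0.
Qed.

Lemma star_zero (a b x y z : R) : x = 0 -> y = 0 -> z = 0 ->
  a * (x - y) - b * (z - y) = 0.
Proof. by move=> -> -> ->; rewrite subrr !mulr0 subrr. Qed.

(** The sum equals [(a - c) * (b - c) - (b - c) * (a - c)]. With the three edges for [a], [b] and
    [c], this is why [star3] is a cycle. *)
Lemma sum_star_var (F x y z : I -> R) (a b c : R) :
  \sum_i F i * x i = b -> \sum_i F i * y i = c -> \sum_i F i * z i = a ->
  \sum_i F i * ((a - c) * (x i - y i) - (b - c) * (z i - y i)) = 0.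
Proof.
move=> xb yc za.
rewrite (eq_bigr (fun i => (a - c) * (F i * x i - F i * y i) - (b - c) * (F i * z i - F i * y i))); last first.
  by move=> i _; rewrite mulrBr [F i * (_ * _)]mulrCA [F i * ((b - c) * _)]mulrCA !mulrBr.
by rewrite sumrB -!mulr_sumr !sumrB xb yc za mulrC subrr.
Qed.

Lemma sum_zero_mul (F x : I -> R) : (forall i, x i = 0) -> \sum_i F i * x i = 0.
Proof. by move=> x0; rewrite big1 // => i _; rewrite x0 mulr0. Qed.

Lemma mul_zero_mid (a b c d : R) : b = 0 -> d * (a * (b * c)) = 0.
Proof. by move=> ->; rewrite mul0r !mulr0. Qed.

Lemma mul_suml_sumr (a p : R) (F x : I -> R) (y : I -> R) :
  (forall i, y i = a * (x i * p)) ->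
  \sum_i F i * y i = a * ((\sum_i F i * x i) * p).
Proof.
by move=> h; rewrite mulr_suml mulr_sumr; apply: eq_bigr => i _; rewrite h mulrCA !mulrA.
Qed.

Lemma prod_madd (F : I -> R) (m : {ffun I -> nat}) e :
  \prod_j F j ^+ madd m e j = \prod_j F j ^+ m j * F e.
Proof.
under eq_bigr do rewrite maddE exprD.
rewrite big_split; apply: (congr1 ( *%R _)) => /=.
by rewrite (bigD1 e) //= eqxx expr1 big1 ?mulr1 // => j /negPf->.
Qed.

Lemma sum_mul_delta2 (F : I -> R) e j :
  \sum_k F k * ((e == k)%:R - (j == k)%:R) = F e - F j.
Proof. by under eq_bigr do rewrite mulrBr; rewrite sumrB !sum_mul_delta. Qed.

Lemma ffun_comb (a b : R) (x y z w : {ffun I -> R^o}) o :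
  (a *: (x - y) - b *: (z - w)) o = a * (x o - y o) - b * (z o - w o).
Proof. by rewrite !ffunE. Qed.
End RingSums.

(** * Star cycles *)

Section LocalSums.
Variable T : tree.

Lemma symb_some (e k : edge T) : symb (Some e) (Some k) = (e == k)%:R.
Proof. by rewrite ffunE. Qed.

Lemma sum_var_symb (e : edge T) : \sum_k edge_var k * symb (Some e) (Some k) = edge_var e.
Proof.
by under eq_bigr do rewrite symb_some; exact: sum_mul_delta.
Qed.

Lemma sw_diff_pure (a : edge_ring T) y (s : state T) :
  sw_diff (a *: pure_tensor y) s = \sum_(v | s v == None) koszul_sign s v *
    (a * ((\sum_e edge_var e * y v (Some e)) * \prod_(u | u != v) y u (s u))).
Proof.
rewrite sw_diffE; apply: eq_bigr => v _; apply: (congr1 ( *%R _)).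
apply: mul_suml_sumr => e; by rewrite scale_pureE (prod_upd (fun u b => y u b)).
Qed.

(** The class of two points exchanging places at a trivalent vertex, with [c.1.1] as reference leg
    [k]. Expanded, it is the sum of the cyclic permutations of [a * (b - k)], where the first factor
    is an edge and the others are half-edges. *)
Definition star3 (c : edge T * edge T * edge T) : local_mod T :=
  (edge_var c.1.2 - edge_var c.1.1) *: (symb (Some c.2) - symb (Some c.1.1)) -
  (edge_var c.2 - edge_var c.1.1) *: (symb (Some c.1.2) - symb (Some c.1.1)).

Lemma star3E c b : star3 c b =
  (edge_var c.1.2 - edge_var c.1.1) * (symb (Some c.2) b - symb (Some c.1.1) b) -
  (edge_var c.2 - edge_var c.1.1) * (symb (Some c.1.2) b - symb (Some c.1.1) b).
Proof. exact: ffun_comb. Qed.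

Lemma star3_none c : star3 c None = 0.
Proof. by rewrite star3E; apply: star_zero; rewrite ffunE. Qed.

Lemma star3_off c e : e != c.1.1 -> e != c.1.2 -> e != c.2 -> star3 c (Some e) = 0.
Proof.
move=> h1 h2 h3; rewrite star3E; apply: star_zero; rewrite symb_some eq_sym.
- by rewrite (negPf h3).
- by rewrite (negPf h1).
by rewrite (negPf h2).
Qed.

Lemma sum_var_star3 c : \sum_e edge_var e * star3 c (Some e) = 0.
Proof.
under eq_bigr do rewrite star3E.
by apply: sum_star_var; exact: sum_var_symb.
Qed.

Lemma hdeg_var (e : edge T) : hdeg 1 (edge_var e).
Proof. by have := @hdegU _ (ucm e); rewrite mdegU. Qed.

Lemma hdegB (I : choiceType) d (a b : {malg int[{cmonom I}]}) :
  hdeg d a -> hdeg d b -> hdeg d (a - b).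
Proof. by move=> ha hb; apply: hdegD => //; exact: hdegN. Qed.

Lemma hdeg_star3 c b : hdeg 1 (star3 c b).
Proof.
rewrite star3E; have hs (e e' : edge T) : hdeg 0 (symb (Some e) b - symb (Some e') b).
  by apply: hdegB; rewrite ffunE; exact: hdeg_nat.
have hv (e e' : edge T) : hdeg 1 (edge_var e - edge_var e').
  by apply: hdegB; exact: hdeg_var.
by apply: hdegB; [exact: (hdegM (hv _ _) (hs _ _)) | exact: (hdegM (hv _ _) (hs _ _))].
Qed.

Lemma star3_reduced (v : T) (c : edge T * edge T * edge T) : v \in val c.1.1 -> v \in val c.1.2 -> v \in val c.2 ->
  sw_reduced_local v (star3 c).
Proof.
move=> h1 h2 h3; apply: spannedB; apply/spannedZ/spanned_gen; right.
  by exists c.2, c.1.1.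
by exists c.1.2, c.1.1.
Qed.

Definition star_product (d : {ffun T -> option (edge T * edge T * edge T)})
    (m : {cmonom edge T}) : tensor_mod T :=
  << m >> *: pure_tensor (fun v => if d v is Some c then star3 c else symb None).

Definition star_incident (d : {ffun T -> option (edge T * edge T * edge T)}) : Prop :=
  forall (v : T) (c : edge T * edge T * edge T), d v = Some c -> [/\ v \in val c.1.1, v \in val c.1.2 & v \in val c.2].

Definition star_support (d : {ffun T -> option (edge T * edge T * edge T)}) : {set T} :=
  finset (fun v => d v != None).

(** The differential of a pure tensor acts on one factor at a time, and every factor is a cycle. A
    star has degree one in the edges and carries one half-edge, whence [i.*2]. *)
Lemma star_product_cycle d m i n : star_incident d -> #|star_support d| = i ->
  (mdeg m + i.*2)%N = n -> sw_cycle_prop n i (star_product d m).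
Proof.
move=> inc di mn; set y := fun v => if d v is Some c then star3 c else symb None.
split.
- apply/spannedZ/spanned_gen; exists y; split=> // v; rewrite /y.
  case dv: (d v) => [c|]; last by apply: spanned_gen; left.
  by have [h1 h2 h3] := inc v c dv; exact: star3_reduced.
- move=> s m'; rewrite scale_pureE => nz.
  have os : occupied s = star_support d.
    apply/finset.setP => v; rewrite !inE.
    have yv : y v (s v) != 0.
      apply: contraNneq nz => E0.
      by rewrite (@prod_eq0 _ _ (fun v => y v (s v)) v E0) mulr0 mcoeff0.
    move: yv; rewrite /y; case: (d v) => [c|]; case: (s v) => [e|] //.
      by rewrite star3_none eqxx.
    by rewrite ffunE /= eqxx.
  split; first by rewrite os.
  rewrite os di -mn -addnn addnA; congr (_ + _)%N.
  have : hdeg (mdeg m + \sum_v (d v != None)) (<< m >> * \prod_v y v (s v)).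
    apply: hdegM; first exact: hdegU.
    apply: hdeg_prod => v _; rewrite /y; case: (d v) => [c|] /=; first exact: hdeg_star3.
    by rewrite ffunE; exact: hdeg_nat.
  move=> /(_ m' nz) ->; congr (_ + _)%N; rewrite -di -sum1_card [RHS]big_mkcond /=.
  by apply: eq_bigr => v _; rewrite inE; case: (d v).
- apply/ffunP => s; rewrite sw_diff_pure [RHS]ffunE big1 // => v _.
  have -> : \sum_e edge_var e * y v (Some e) = 0; last exact: mul_zero_mid.
  rewrite /y; case: (d v) => [c|]; first exact: sum_var_star3.
  by apply: sum_zero_mul => e; rewrite ffunE.
Qed.
End LocalSums.

Section FinMonomials.
Variable I : finType.

Definition mkc (m : {ffun I -> nat}) : {cmonom I} :=
  mkcmonom [fsfun i in [fset i | i in enum I]%fset => m i | 0%N].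

Lemma mkcE m i : mkc m i = m i.
Proof. by rewrite cmE fsfunE inE mem_enum. Qed.

Lemma mkc_inj : injective mkc.
Proof. by move=> m1 m2 E; apply/ffunP => i; rewrite -!mkcE E. Qed.

Lemma mkc_mdeg m : mdeg (mkc m) = mdegree m.
Proof. by rewrite mdeg_sum; apply: eq_bigr => i _; rewrite mkcE. Qed.

Lemma mkc_surj (m : {cmonom I}) : mkc [ffun i => m i] = m.
Proof. by apply/eqP/cmP => i; rewrite mkcE ffunE. Qed.

Lemma scale_monomials (U : lmodType {malg int[{cmonom I}]}) (a : {malg int[{cmonom I}]}) (p : U) :
  a *: p = \sum_(m <- msupp a) (<< m >> *: p) *~ mcoeff m a.
Proof.
rewrite {1}(malg_expand a) scaler_suml; apply: eq_bigr => m _.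
by rewrite scalerMzl.
Qed.

Lemma mcoeff_delta (m1 m2 : {cmonom I}) (b : bool) :
  mcoeff m1 (<< m2 >> * b%:R : {malg int[{cmonom I}]}) = ((m2 == m1) && b)%:R.
Proof.
case: b; last by rewrite mulr0 mcoeff0 andbF.
by rewrite mulr1 andbT mcoeffU1.
Qed.

Lemma scale_monomial_zspan (U : lmodType {malg int[{cmonom I}]}) (G : U -> Prop) d
    (a : {malg int[{cmonom I}]}) (p : U) : hdeg d a ->
  (forall m, mdeg m = d -> zspan G (<< m >> *: p)) -> zspan G (a *: p).
Proof.
move=> ha h; rewrite scale_monomials big_seq; apply: zspan_sum => m ma.
by apply/zspanMz/h/ha; rewrite mcoeff_neq0.
Qed.
End FinMonomials.

Lemma zspan_lin (K : choiceType) (V : zmodType) (phi : K -> V) (G : {malg int[K]} -> Prop) y :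
  zspan (fun y => exists2 b, G << b >> & y = phi b) y ->
  exists2 X, zspan G X & y = lin phi X.
Proof.
elim=> [|{}y y' _ [X Xs ->] _ [X' X's ->]|_ [b Gb ->]].
- by exists 0; [exact: zspan0 | rewrite raddf0].
- by exists (X - X'); [exact: zspanB | rewrite raddfB].
by exists << b >>; [exact: zspan_gen | rewrite linU].
Qed.

(** * The change of variables *)

Section Coordinates.
Variables (T : tree) (r : T).
Local Notation ring := (edge_ring T).
Local Notation mono := {ffun edge T -> nat}.
Local Notation basis := (state T * mono)%type.
Local Notation adm := (admissible (down r)).

(** The coordinate of [e] as a polynomial in the edges; the edge chosen at the root lies in no
    [down r v] and is kept. *)
Definition fvar (e : edge T) : ring :=
  if [pick v | e \in down r v] is Some v then
    if up r v is Some k then edge_var e - edge_var k else edge_var e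
  else edge_var e.

Lemma down_up (e : edge T) v : e \in down r v -> exists k, up r v = Some k.
Proof. by rewrite inE => /andP[ve _]; have [k] := up_exists r ve; exists k. Qed.

Lemma fvar_down (e k : edge T) v : e \in down r v -> up r v = Some k ->
  fvar e = edge_var e - edge_var k.
Proof.
move=> ev uk; rewrite /fvar; case: pickP => [w ew|/(_ v)]; last by rewrite ev.
by rewrite (down_uniq ew ev) uk.
Qed.

Lemma fvar_root (e : edge T) : (forall v, e \notin down r v) -> fvar e = edge_var e.
Proof. by move=> h; rewrite /fvar; case: pickP => // v; rewrite (negPf (h v)). Qed.

Definition anc_sum (F : edge T -> ring) e : ring := \sum_(j in anc r e) F j.

Lemma anc_sum_down F (e k : edge T) v : e \in down r v -> up r v = Some k ->
  anc_sum F e = F e + anc_sum F k.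
Proof.
move=> ev uk; have [aE ne] := anc_down ev uk.
by rewrite /anc_sum aE big_setU1.
Qed.

Lemma root_or_down (e : edge T) : (exists v, e \in down r v) \/
  (up r r = Some e /\ forall v, e \notin down r v).
Proof.
have [[v ev]|h] := pselect (exists v, e \in down r v); first by left; exists v.
right; split; last by move=> v; apply/negP => ev; apply: h; exists v.
by apply/eqP/negPn/negP => /down_exists.
Qed.

Lemma anc_sum_root F (e : edge T) : up r r = Some e -> anc_sum F e = F e.
Proof. by move=> ue; rewrite /anc_sum anc_root // big_set1. Qed.

(* The substitution [e |-> e - up v] is inverted by sending [e] to the sum of the
   edges between [e] and the root. *)
Definition to_fvar : ring -> ring := ev fvar.
Definition of_fvar : ring -> ring := ev (anc_sum (@edge_var T)).
HB.instance Definition _ := GRing.RMorphism.copy to_fvar (ev fvar).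
HB.instance Definition _ := GRing.RMorphism.copy of_fvar (ev (anc_sum (@edge_var T))).

Lemma subDK (V : zmodType) (x y z w : V) : z = x + y -> w = y -> z - w = x.
Proof. by move=> -> ->; rewrite addrK. Qed.

Lemma addBK (V : zmodType) (x y z w : V) : z = x - y -> w = y -> z + w = x.
Proof. by move=> -> ->; rewrite subrK. Qed.

Lemma of_fvar_var e : of_fvar (edge_var e) = anc_sum (@edge_var T) e.
Proof. exact: ev_var. Qed.

Lemma of_fvar_fvar e : of_fvar (fvar e) = edge_var e.
Proof.
have [[v ed]|[ue nd]] := root_or_down e; last first.
  by rewrite fvar_root // of_fvar_var anc_sum_root.
have [k uk] := down_up ed; rewrite (fvar_down ed uk).
apply: etrans (rmorphB of_fvar _ _) _.
by apply: subDK; [apply: etrans (of_fvar_var e) _; exact: (anc_sum_down _ ed uk) | exact: of_fvar_var].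
Qed.

(** The differences telescope along the way from [e] to the root, and the chosen edge there cancels
    the last term. *)
Lemma anc_sum_fvar e : anc_sum fvar e = edge_var e.
Proof.
have [N] := ubnP #|anc r e|; elim: N e => // N IH e.
have [[v ed]|[ue nd]] := root_or_down e; last by rewrite anc_sum_root // fvar_root.
have [k uk] := down_up ed; have [aE ne] := anc_down ed uk.
rewrite aE cardsU1 ne add1n ltnS => /IH kE.
by rewrite (anc_sum_down _ ed uk); apply: addBK (fvar_down ed uk) _.
Qed.

Lemma to_fvarK a : to_fvar (of_fvar a) = a.
Proof.
rewrite [RHS](rmorph_ev (idfun : {rmorphism ring -> ring})).
apply: etrans (rmorph_ev (to_fvar \o of_fvar) a) _; apply: eq_ev => e.
apply: etrans (congr1 to_fvar (of_fvar_var e)) _.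
apply: etrans (rmorph_sum to_fvar _ _ _) _.
rewrite -[RHS](anc_sum_fvar e); apply: eq_bigr => j _; exact: ev_var.
Qed.

Definition fmon (m : mono) : ring := \prod_e fvar e ^+ m e.

Lemma to_fvarU (m : {cmonom edge T}) : to_fvar << m >> = fmon [ffun e => m e].
Proof. by apply: etrans (evU _ m) _; apply: eq_bigr => e _; rewrite ffunE. Qed.

Lemma of_fvar_fmon m : of_fvar (fmon m) = << mkc m >>.
Proof.
rewrite [RHS]monomial_ev; apply: etrans (rmorph_prod of_fvar _ _ _) _.
apply: eq_bigr => e _; rewrite mkcE; apply: etrans (rmorphXn of_fvar _ _) _.
by apply: (congr1 (fun x => x ^+ m e)); exact: of_fvar_fvar.
Qed.

Lemma fmon_madd m e : fmon (madd m e) = fmon m * fvar e.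
Proof.
exact: prod_madd.
Qed.

Lemma hdeg_fvar e : hdeg 1 (fvar e).
Proof.
rewrite /fvar; case: pickP => [v _|_]; last exact: hdeg_var.
by case: (up r v) => [k|]; [apply: hdegB; exact: hdeg_var | exact: hdeg_var].
Qed.

Lemma hdeg_fmon m : hdeg (mdegree m) (fmon m).
Proof.
have -> : mdegree m = (\sum_e m e * 1)%N by apply: eq_bigr => e _; rewrite muln1.
by apply: hdeg_prod => e _; apply: hdegX; exact: hdeg_fvar.
Qed.
End Coordinates.

(** One summand in the comparison of the differentials. The signs [d] and [z] are compared only for
    a nonzero product, because only then do the occupied vertices match. *)
Lemma diff_term (R : comNzRingType) (I : finType) (B : I -> R) (a b d q : R) (z : int) v (c : bool) :
  B v = c%:R -> (c -> \prod_i B i != 0 -> d = z%:~R) ->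
  q = \prod_(i | i != v) B i ->
  (if c then d * (a * (b * q)) else 0) = (a * b * \prod_i B i) *~ z.
Proof.
move=> Bv dz ->; rewrite (bigD1 v) //= Bv in dz *; case: c dz {Bv} => dz /=.
  rewrite mul1r in dz *; set P := \prod_(i | _) _ in dz *.
  have [->|/dz->//] := eqVneq P 0; first by rewrite !mulr0 mul0rz.
  by rewrite mulrzl mulrA.
by rewrite mul0r !mulr0 mul0rz.
Qed.

Lemma ffun_mulrz (I : finType) (V : zmodType) (f : {ffun I -> V}) (z : int) i :
  (f *~ z) i = f i *~ z.
Proof. by case: z => n; rewrite ?NegzE ?mulrNz ?ffunE; exact: ffunMnE || (congr (- _); exact: ffunMnE). Qed.

Lemma ffun_sub (I : finType) (V : zmodType) (f g : {ffun I -> V}) i : (f - g) i = f i - g i.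
Proof. by rewrite !ffunE. Qed.

Lemma zspan_scale_sum (A : comNzRingType) (U : lmodType A) (G : U -> Prop) (J : eqType) (s : seq J)
    (F : J -> A) (c : J -> int) (a : A) (p : U) :
  a = \sum_(j <- s) F j *~ c j -> (forall j, j \in s -> zspan G (F j *: p)) ->
  zspan G (a *: p).
Proof.
move=> -> h; rewrite scaler_suml big_seq; apply: zspan_sum => j js.
by rewrite -scalerMzl; apply: zspanMz; exact: h.
Qed.

Lemma star_term (R : comNzRingType) (m a b x y p p' : R) : p = p' ->
  m * a * (x * p) - m * b * (y * p) = m * ((a * x - b * y) * p').
Proof. by move=> ->; rewrite mulrBl mulrBr !mulrA. Qed.

Lemma ffun_scale_sub (R : comNzRingType) (I : finType) (f g h : {ffun I -> R^o}) (a b c : R) :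
  (forall i, a * f i - b * g i = c * h i) -> a *: f - b *: g = c *: h.
Proof. by move=> E; apply/ffunP => i; rewrite !ffunE; exact: E. Qed.

Lemma pure_tensorE (T : tree) (y : T -> local_mod T) s : pure_tensor y s = \prod_v y v (s v).
Proof. by rewrite ffunE. Qed.

Lemma prod_split (R : comNzRingType) (I : finType) (F G : I -> R) v x :
  F v = x -> (forall u, u != v -> F u = G u) -> \prod_u F u = x * \prod_(u | u != v) G u.
Proof. by move=> <- FG; rewrite (bigD1 v) //=; congr (_ * _); apply: eq_bigr. Qed.

(** * From Koszul coordinates to the reduced complex *)

Section Transport.
Variables (T : tree) (r : T).
Local Notation ring := (edge_ring T).
Local Notation mono := {ffun edge T -> nat}.
Local Notation basis := (state T * mono)%type.
Local Notation adm := (admissible (down r)).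
Local Notation diff0 := (diff0 (E := edge T) (@vrank T)).

Definition of_basis (x : basis) : tensor_mod T := fmon r x.2 *: basis_state r x.1.

Lemma of_basisE (x : basis) (s : state T) :
  of_basis x s = fmon r x.2 * \prod_v basis_local r v (x.1 v) (s v).
Proof. exact: scale_pureE. Qed.

Lemma basis_local_none v (a b : option (edge T)) :
  basis_local r v a b != 0 -> (a == None) = (b == None).
Proof.
case: a => [e|] /=; case: b => [k|] //.
  case: ifP => [ed|_]; last by rewrite ffunE eqxx.
  by have [k uk] := down_up ed; rewrite uk !ffunE /= subrr eqxx.
by rewrite ffunE eqxx.
Qed.

Lemma basis_state_occ (t s : state T) :
  \prod_v basis_local r v (t v) (s v) != 0 -> occupied s = occ t.
Proof.
move=> nz; apply/finset.setP => v; rewrite !inE; congr (~~ _); apply/esym.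
apply: (@basis_local_none v); apply: contraNneq nz => E0; apply/eqP.
exact: (@prod_eq0 _ _ (fun v => basis_local r v (t v) (s v)) v E0).
Qed.

Lemma hdeg_basis_local v (a b : option (edge T)) : hdeg 0 (basis_local r v a b).
Proof.
have hs (o : option (edge T)) : hdeg 0 (symb o b) by rewrite ffunE; exact: hdeg_nat.
case: a => [e|]; last exact: hs.
rewrite /basis_local; case: ifP => _; last by rewrite ffunE; exact: hdeg0.
have -> : (symb (Some e) - symb (up r v)) b = symb (Some e) b - symb (up r v) b.
  by rewrite !ffunE.
by apply: hdegB; exact: hs.
Qed.

Lemma of_basis_homogeneous t m i n : #|occ t| = i -> (mdegree m + #|occ t|)%N = n ->
  bihomogeneous i n (of_basis (t, m)).
Proof.
move=> ti mn s m'; rewrite of_basisE /= => nz.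
have pn : \prod_v basis_local r v (t v) (s v) != 0.
  by apply: contraNneq nz => ->; rewrite mulr0 mcoeff0.
have os := basis_state_occ pn; rewrite os; split=> //; rewrite -mn; congr (_ + _)%N.
rewrite -[mdegree m]addn0.
have h : hdeg (\sum_(v : T) 0) (\prod_v basis_local r v (t v) (s v)).
  by apply: hdeg_prod => v _; exact: hdeg_basis_local.
rewrite big1 // in h.
have hm := @hdeg_fmon T r m; exact: (hdegM hm h nz).
Qed.

Lemma of_basis_reduced x : sw_reduced (of_basis x).
Proof. by apply: spannedZ; exact: basis_state_reduced. Qed.

Lemma sum_basis_local v (e : edge T) : e \in down r v ->
  \sum_k edge_var k * basis_local r v (Some e) (Some k) = fvar r e.
Proof.
move=> ed; have [j uj] := down_up ed; rewrite (fvar_down ed uj) /= ed uj.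
have E k : (symb (Some e) - symb (Some j)) (Some k) = (e == k)%:R - (j == k)%:R :> ring.
  by rewrite !ffunE.
under eq_bigr do rewrite E.
exact: sum_mul_delta2.
Qed.

Lemma sum_basis_none v :
  \sum_(k : edge T) edge_var k * basis_local r v None (Some k) = 0.
Proof. by apply: sum_zero_mul => k; rewrite ffunE. Qed.

(** An edge of [down r v] is not rootward at [v], so the correction [symb (up r v)] does not
    show. *)
Lemma basis_local_delta v (a b : option (edge T)) :
  (if a is Some e then e \in down r v else true) ->
  (if b is Some e then e \in down r v else true) ->
  basis_local r v a b = (a == b)%:R.
Proof.
case: a => [e ed|_ _] /=; last by rewrite ffunE.
have [k uk] := down_up ed; rewrite ed uk; case: b => [j jd|_]; last first.
  by rewrite !ffunE subrr.
rewrite !ffunE; have -> : (Some k == Some j) = false; last by rewrite subr0.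
by apply/negP => /eqP[E]; move: jd; rewrite inE uk E eqxx andbF.
Qed.

Lemma basis_state_delta (t s : state T) : adm t -> adm s ->
  \prod_v basis_local r v (t v) (s v) = (t == s)%:R.
Proof.
move=> /forallP at0 /forallP as0; rewrite -prod_delta; apply: eq_bigr => v _.
by rewrite basis_local_delta.
Qed.

Lemma basis_state_zero (t : state T) : ~~ adm t -> basis_state r t = 0.
Proof.
case/forallPn => v; case tv: (t v) => [e|//] ed; apply/ffunP => s; rewrite [LHS]ffunE [RHS]ffunE.
by apply: (@prod_eq0 _ _ _ v); rewrite tv /= (negPf ed) ffunE.
Qed.

Lemma upd_occ_sgn (s t : state T) v : occupied s = occ (upd t v None) ->
  koszul_sign s v = (sgn (@vrank T) t v)%:~R.
Proof.
move=> os; rewrite koszul_signE os -(sgn_upd (@vrank T) t v None) /sgn.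
by apply/esym; exact: rmorph_sign.
Qed.

Lemma of_basis_diff t m : adm t ->
  sw_diff (of_basis (t, m)) = lin of_basis (diff0 (t, m)).
Proof.
move=> adt; apply/ffunP => s; rewrite [LHS]sw_diff_pure /=.
rewrite raddf_sum sum_ffunE [LHS]big_mkcond; apply: eq_bigr => v _.
case tv: (t v) => [e|]; last first.
  rewrite (diff_at_none _ _ tv) raddf0 [RHS]ffunE; case: ifP => // _.
  by apply: mul_zero_mid; exact: sum_basis_none.
have ed := admissibleP adt tv.
rewrite (diff_at_some _ _ tv).
apply: (etrans _ (esym (congr1 (fun y : tensor_mod T => y s) (linUz of_basis _ _)))).
apply: (etrans _ (esym (ffun_mulrz _ _ _))); rewrite of_basisE fmon_madd.
rewrite -(sum_basis_local ed).
apply: (@diff_term ring T (fun u => basis_local r u (upd t v None u) (s u)) _ _ _ _ _ v).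
- by rewrite upd_same [LHS]ffunE eq_sym.
- by move=> _ /basis_state_occ; exact: upd_occ_sgn.
by apply: eq_bigr => u uv; rewrite upd_other.
Qed.

Definition adm_gen (X : {malg int[basis]}) : Prop := exists2 x : basis, adm x.1 & X = << x >>.

(** Coordinate functionals dual to [of_basis]: evaluation at an admissible state isolates one basis
    state, and [of_fvar] turns its coefficient into a polynomial whose monomials can be read off. *)
Definition basis_coef (x : basis) (y : tensor_mod T) : int :=
  mcoeff (mkc x.2) (of_fvar r (y x.1)).

Lemma basis_coef_additive x : zmod_morphism (basis_coef x).
Proof.
move=> y z; rewrite /basis_coef.
have -> : (y - z) x.1 = y x.1 - z x.1 by exact: ffun_sub.
apply: etrans (congr1 (mcoeff _) (raddfB (of_fvar r) _ _)) _.
by rewrite mcoeffB.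
Qed.

HB.instance Definition _ x := GRing.isZmodMorphism.Build (tensor_mod T) int
  (basis_coef x) (basis_coef_additive x).

Lemma basis_coef_of_basis x y : adm x.1 -> adm y.1 -> basis_coef x (of_basis y) = (y == x)%:R.
Proof.
move=> ax ay; rewrite /basis_coef of_basisE basis_state_delta //.
have -> : of_fvar r (fmon r y.2 * (y.1 == x.1)%:R) = << mkc y.2 >> * (y.1 == x.1)%:R.
  apply: etrans (rmorphM (of_fvar r) _ _) _.
  exact: (congr2 *%R (@of_fvar_fmon _ r _) (rmorph_nat (of_fvar r) _)).
apply: etrans (mcoeff_delta _ _ _) _; rewrite (inj_eq (@mkc_inj _)).
by case: x y {ax ay} => t m [t' m'] /=; rewrite andbC.
Qed.

Lemma of_basis_inj X : zspan adm_gen X -> lin of_basis X = 0 -> X = 0.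
Proof.
move=> Xs X0.
have H x : adm x.1 -> basis_coef x (lin of_basis X) = mcoeff x X.
  move=> ax; apply: (@zspan_eq _ _ _ (basis_coef x \o lin of_basis) (mcoeff x) _ _ Xs).
  move=> _ [y ay ->] /=; apply: etrans (congr1 (basis_coef x) (linU _ _)) _.
  by rewrite basis_coef_of_basis //; apply/esym; exact: mcoeffU.
have H' x : ~~ adm x.1 -> 0 = mcoeff x X.
  move=> ax; apply: (@zspan_eq _ _ _ \0%R (mcoeff x) _ _ Xs).
  move=> _ [y ay ->] /=; apply: (etrans _ (esym (mcoeffU _ _ _))); case: eqP => // E.
  by rewrite -E ay in ax.
apply/malgP => x; rewrite mcoeff0; have [ax|/H'//] := boolP (adm x.1).
by rewrite -H // X0 raddf0.
Qed.

Lemma basis_elt_adm i n X : basis_elt (down r) i n X -> adm_gen X.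
Proof. by move=> [t [m [-> adt _ _]]]; exists (t, m). Qed.

Lemma diff0_adm X : adm_gen X -> zspan adm_gen (lin diff0 X).
Proof.
move=> [[t m] adt ->]; rewrite linU; apply: zspan_sum => v _.
case tv: (t v) => [e|]; last by rewrite (diff_at_none _ _ tv); exact: zspan0.
rewrite (diff_at_some _ _ tv); apply/zspanMz/zspan_gen.
by exists (upd t v None, madd m e) => //=; exact: admissible_none.
Qed.

(** The chain is expanded in basis states, and each coefficient is rewritten as a polynomial in the
    [fvar r e]; this preserves degrees since [of_fvar] sends edges to linear forms. *)
Lemma of_basis_surj i n x : sw_reduced x -> bihomogeneous i n x ->
  exists2 X, zspan (basis_elt (down r) i n) X & x = lin of_basis X.
Proof.
move=> /sw_reduced_coord xr xh; apply: zspan_lin.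
rewrite (reduced_expand r xr); apply: zspan_sum => t _.
have [adt|] := boolP (adm t); last first.
  by move=> /basis_state_zero->; rewrite scaler0; exact: zspan0.
have [-> |x0] := eqVneq (x t) 0; first by rewrite scale0r; exact: zspan0.
have [m0 m0s] : exists m0, mcoeff m0 (x t) != 0.
  apply/not_existsP => h; case/eqP: x0; apply/malgP => k; rewrite mcoeff0.
  by apply/eqP/negPn/negP => /h.
have [ot nt] := xh _ _ m0s.
have ht : hdeg (n - #|occ t|) (of_fvar r (x t)).
  apply: hdeg_ev; first by move=> e; apply: hdeg_sum => j _; exact: hdeg_var.
  by move=> m /xh [_ <-]; rewrite addnK.
apply: (@zspan_scale_sum _ _ _ _ (msupp (of_fvar r (x t)))
  (fun m : {cmonom edge T} => fmon r [ffun e => m e]) (mcoeff^~ (of_fvar r (x t)))).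
  rewrite -[LHS](to_fvarK r) {1}(malg_expand (of_fvar r (x t))).
  apply: etrans (raddf_sum (to_fvar r) _ _ _) _; apply: eq_bigr => m _.
  apply: etrans (raddfMz (to_fvar r) _ _) _.
  exact: (congr1 (fun z : ring => z *~ _) (to_fvarU _ _)).
move=> m ms; apply: zspan_gen.
exists (t, [ffun e => m e]) => //; exists t, [ffun e => m e]; split=> //.
by rewrite -mkc_mdeg mkc_surj ht ?mcoeff_neq0 // subnK // -nt leq_addl.
Qed.

Local Notation star := (edge T * edge T * edge T)%type.

(** The default [c.1.2] never occurs for star data, since an edge in [down r v] makes [up r v]
    exist. *)
Fixpoint star_map (q : seq (T * edge T * edge T)) (v : T) : option star :=
  if q is c :: q' then
    if v == c.1.1 then Some (odflt c.1.2 (up r v), c.1.2, c.2) else star_map q' v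
  else None.

Lemma star_map_none q v : (star_map q v == None) = (v \notin [seq c.1.1 | c <- q]).
Proof.
elim: q => //= c q IH; rewrite inE negb_or; case: (v == c.1.1) => //=.
Qed.

Definition star_local q (t : state T) v : local_mod T :=
  if star_map q v is Some c then star3 c else basis_local r v (t v).

Lemma star3_basis (k a b : edge T) v o : up r v = Some k -> a \in down r v -> b \in down r v ->
  fvar r a * basis_local r v (Some b) o - fvar r b * basis_local r v (Some a) o =
  star3 (k, a, b) o.
Proof.
move=> uk ad bd; rewrite star3E (fvar_down ad uk) (fvar_down bd uk) /= ad bd uk.
exact: (congr2 (fun x y : ring => _ * x - _ * y) (ffun_sub _ _ _) (ffun_sub _ _ _)).
Qed.

Lemma of_basis_stars q (t : state T) m : star_data (down r) q -> uniq [seq c.1.1 | c <- q] ->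
  lin of_basis (stars q << (t, m) >>) = fmon r m *: pure_tensor (star_local q t).
Proof.
elim: q t m => [|c q IH] t m; first by move=> _ _; exact: linU.
move=> /= /andP[/andP[ad bd] qd] /andP[cq uq].
rewrite stars_cons; apply: etrans (raddfB (lin of_basis) _ _) _.
apply: etrans (congr2 (fun x y : tensor_mod T => x - y) (IH _ _ qd uq) (IH _ _ qd uq)) _.
apply: ffun_scale_sub => s; rewrite !pure_tensorE !fmon_madd.
have locE (a : edge T) : \prod_v star_local q (upd t c.1.1 (Some a)) v (s v) =
    basis_local r c.1.1 (Some a) (s c.1.1) * \prod_(v | v != c.1.1) star_local q t v (s v).
  apply: prod_split => [|v vc]; last by rewrite /star_local upd_other.
  by rewrite /star_local upd_same; have /eqP-> : star_map q c.1.1 == None by rewrite star_map_none.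
have [k uk] := down_up ad.
have locE' : \prod_v star_local (c :: q) t v (s v) =
    star3 (k, c.1.2, c.2) (s c.1.1) * \prod_(v | v != c.1.1) star_local q t v (s v).
  apply: prod_split => [|v vc]; last by rewrite /star_local /= (negPf vc).
  by rewrite /star_local /= eqxx uk.
rewrite !locE locE' -(star3_basis _ uk ad bd).
exact: star_term.
Qed.
End Transport.

Lemma lin_zspan (K : choiceType) (V : zmodType) (phi : K -> V) (P : V -> Prop)
    (G : {malg int[K]} -> Prop) : P 0 -> (forall x y, P x -> P y -> P (x - y)) ->
  (forall X, G X -> exists2 b, X = << b >> & P (phi b)) ->
  forall X, zspan G X -> P (lin phi X).
Proof.
move=> P0 PB PG X; elim=> [|{}X Y _ PX _ PY|_ /PG[b -> Pb]].
- by rewrite raddf0.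
- by rewrite raddfB; exact: PB.
by rewrite linU.
Qed.

Lemma star_map_some (T : tree) (r : T) q (v : T) (c : edge T * edge T * edge T) :
  star_data (down r) q -> star_map r q v = Some c ->
  [/\ up r v = Some c.1.1, c.1.2 \in down r v & c.2 \in down r v].
Proof.
elim: q => //= c' q IH /andP[/andP[ad bd] qd].
have [->|_] := eqVneq v c'.1.1; last exact: IH.
by have [k uk] := down_up ad; rewrite uk /= => -[<-].
Qed.

Lemma card_star_support (T : tree) (r : T) (q : seq (T * edge T * edge T)) :
  uniq [seq c.1.1 | c <- q] -> #|star_support [ffun v => star_map r q v]| = size q.
Proof.
move=> uq; rewrite -(size_map (fun c => c.1.1) q) -(card_uniqP uq); apply: eq_card => v.
by rewrite inE ffunE star_map_none negbK.
Qed.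

Definition star_rooted (T : tree) (r : T) (d : {ffun T -> option (edge T * edge T * edge T)}) :=
  forall (v : T) (c : edge T * edge T * edge T), d v = Some c ->
  [/\ up r v = Some c.1.1, c.1.2 \in down r v & c.2 \in down r v].

Definition star_gen (T : tree) (r : T) i n (x : tensor_mod T) : Prop :=
  exists d m, [/\ x = star_product d m, star_rooted r d, #|star_support d| = i &
                 (mdeg m + i.*2)%N = n].

(** [of_basis] identifies the reduced complex with the Koszul coordinates, where [cycle_reduction]
    applies; the stars found there become [star3] with the rootward edge as reference leg. *)
Lemma star_generators (T : tree) (r : T) n i x : sw_cycle_prop n i x ->
  exists2 x', zspan (star_gen r i n) x' & sw_boundary_prop n i (x - x').
Proof.
move=> [xr xh xd]; have [X Xs xE] := of_basis_surj r xr xh.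
have Xa : zspan (adm_gen r) X by apply: zspan_sub Xs => Y /basis_elt_adm; exact: zspan_gen.
have dE Y : zspan (adm_gen r) Y ->
    sw_diff (lin (of_basis r) Y) = lin (of_basis r) (lin (diff0 (@vrank T)) Y).
  move=> Ys; apply: (@zspan_eq _ _ _ (sw_diff (T := T) \o lin (of_basis r))
    (lin (of_basis r) \o lin (diff0 (@vrank T))) _ _ Ys) => _ [[t m] adt ->] /=.
  apply: etrans (congr1 (sw_diff (T := T)) (linU (of_basis r) (t, m))) _.
  apply: etrans (of_basis_diff m adt) _.
  exact: (congr1 (lin (of_basis r)) (esym (linU _ _))).
(* By injectivity of [of_basis], the cycle is also a cycle in coordinates. *)
have dX : lin (diff0 (@vrank T)) X = 0.
  apply: (@of_basis_inj T r); first exact: zspan_image (@diff0_adm T r) _ Xa.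
  by apply: etrans (esym (dE X Xa)) _; rewrite -xE.
have [X' [W [X's Ws XW]]] := cycle_reduction (@down_uniq T r) (@vrank_inj T) Xs dX.
have Wa : zspan (adm_gen r) W by apply: zspan_sub Ws => Y /basis_elt_adm; exact: zspan_gen.
exists (lin (of_basis r) X').
  apply: (zspan_image _ X's) => _ [q [t [m [[-> qd uq _] [adt tT ti mn]]]]].
  suff : zspan (star_gen r i n) (fmon r m *: pure_tensor (star_local r q t)).
    by rewrite -(of_basis_stars t m qd uq).
  (* [fmon r m] is a polynomial in differences of edges; expanding it into monomials in the edges
     gives genuine star products of the same degree. *)
  apply: (@scale_monomial_zspan _ _ _ (mdegree m)).
    exact: hdeg_fmon.
  move=> m' m'd; apply: zspan_gen; exists [ffun v => star_map r q v], m'; split.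
  - apply: (congr1 (fun y => << m' >> *: pure_tensor y)).
    apply: functional_extensionality_dep => v; rewrite ffunE /star_local.
    by case: (star_map r q v) => // ; rewrite tT ?inE.
  - by move=> v c; rewrite ffunE; exact: star_map_some.
  - rewrite card_star_support // -ti; suff -> : #|occ t| = 0%N by [].
    by apply: eq_card0 => v; rewrite inE tT ?inE.
  - rewrite m'd -mn -ti; suff -> : #|occ t| = 0%N by rewrite addn0.
    by apply: eq_card0 => v; rewrite inE tT ?inE.
exists (lin (of_basis r) W); split.
- have [h0 hB] := spanned_zmod (fun x => exists y : T -> local_mod T,
    (forall v, sw_reduced_local v (y v)) /\ x = pure_tensor y).
  apply: (lin_zspan h0 hB) Ws => _ [t [m [-> _ _ _]]]; exists (t, m) => //.
  exact: of_basis_reduced.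
- have [h0 hB] := @bihomogeneous_zmod T i.+1 n.
  apply: (lin_zspan h0 hB) Ws => _ [t [m [-> _ ti mn]]]; exists (t, m) => //.
  exact: of_basis_homogeneous.
apply: (etrans _ (esym (dE W Wa))); rewrite -XW [X in X - _]xE.
by apply/esym; exact: (raddfB (lin (of_basis r))).
Qed.

(** * Contracting an unused edge *)

Section QuotientTree.
Variables (T : tree) (V : finType) (f : {ffun T -> V}).
Hypothesis f_surj : forall w, exists v, f v = w.
Hypothesis f_fiber : forall u v, f u = f v -> connect [rel x y | adj x y && (f x == f y)] u v.

Definition quotient_adj : rel V := [rel x y | (x != y) &&
  [exists u, exists v, [&& adj u v, f u == x & f v == y]]].

Lemma quotient_adjP x y : reflect (x != y /\ exists u v, [/\ adj u v, f u = x & f v = y])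
  (quotient_adj x y).
Proof.
apply: (iffP andP) => -[xy h]; split=> //.
  by case/existsP: h => u /existsP[v /and3P[uv /eqP fu /eqP fv]]; exists u, v.
case: h => u [v [uv fu fv]]; apply/existsP; exists u; apply/existsP; exists v.
by rewrite uv fu fv !eqxx.
Qed.

Lemma quotient_adj_sym : symmetric quotient_adj.
Proof.
have h x y : quotient_adj x y -> quotient_adj y x.
  case/quotient_adjP => xy [u [v [uv fu fv]]]; apply/quotient_adjP.
  by rewrite eq_sym; split=> //; exists v, u; rewrite adj_sym.
by move=> x y; apply/idP/idP; exact: h.
Qed.

Lemma quotient_adj_irr : irreflexive quotient_adj.
Proof. by move=> x; apply/quotient_adjP; rewrite eqxx => -[]. Qed.

Lemma quotient_nonempty : (0 < #|V|)%N.
Proof. by have /card_gt0P[v _] := tree_nonempty T; apply/card_gt0P; exists (f v). Qed.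

Lemma quotient_connected x y : connect quotient_adj x y.
Proof.
have [u <-] := f_surj x; have [v <-] := f_surj y.
have /connectP[p pp ->] := tree_connected u v.
elim: p u pp => [|w p IH] u /=; first by rewrite connect0.
case/andP => uw /IH; apply: connect_trans.
have [->|n] := eqVneq (f u) (f w); first exact: connect0.
by apply: connect1; apply/quotient_adjP; split=> //; exists u, w.
Qed.

(** A path avoiding the edge from [x] to [y] would lift to [T], through fibers and edges over its
    steps, and bypass the bridge [k]. *)
Lemma quotient_bridge x y : quotient_adj x y ->
  ~~ connect [rel a b | quotient_adj a b && ([set a; b]%SET != [set x; y]%SET)] x y.
Proof.
case/quotient_adjP => xy [u [v [uv fu fv]]]; apply/negP => /connectP[p pp yE].
pose k := mk_edge uv; have kE : val k = [set u; v]%SET by [].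
have step a b : adj a b -> [set f a; f b]%SET != [set x; y]%SET -> adjx k a b.
  move=> ab; rewrite adjxE ab /=; apply: contraNneq => E.
  rewrite -fu -fv -!imset_set1 -!imsetU.
  by have -> : [set a; b]%SET = [set u; v]%SET by [].
have fib a b : f a = f b -> connect (adjx k) a b.
  move/f_fiber; apply: connect_sub => c d /andP[cd /eqP E]; apply: connect1.
  apply: step => //; rewrite E finset.setUid; apply: contraNneq xy => F.
  have : x \in [set x; y]%SET by rewrite set21.
  have : y \in [set x; y]%SET by rewrite set22.
  by rewrite -F !inE => /eqP-> /eqP->.
move: (sep_bridge kE); rewrite /sep => /negP; apply.
have lift w0 a : f w0 = a -> path [rel a b | quotient_adj a b && ([set a; b]%SET != [set x; y]%SET)] a p ->
    forall w, last a p = f w -> connect (adjx k) w0 w.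
  elim: p a w0 {pp yE} => [|b p IH] a w0 fa /=; first by move=> _ w; rewrite -fa; exact: fib.
  case/andP => /andP[/quotient_adjP[ab [c [d [cd fc fd]]]] ne] /IH h w /(h d fd).
  apply: connect_trans; apply: (@connect_trans _ _ c); first by apply: fib; rewrite fa.
  by apply: connect1; apply: step; rewrite // fc fd.
by apply: (lift _ _ fu pp); rewrite -yE fv.
Qed.

(** A cycle through [x] and [y] connects them the other way round, against [quotient_bridge]: its
    step from [y] to [z] avoids [x], and its later steps avoid [y]. *)
Lemma quotient_acyclic (p : seq V) : (2 < size p)%N -> ~ ucycle quotient_adj p.
Proof.
case: p => [|x [|y [|z p]]] // _ /andP[/= /andP[xy /andP[yz zp]]].
rewrite !inE !negb_or => /and3P[/and3P[xy' xz xp] /andP[yz' yp] _].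
move/negP: (quotient_bridge xy); apply.
rewrite (sym_connect_sym (e := [rel a b | quotient_adj a b && ([set a; b]%SET != [set x; y]%SET)])); last first.
  by move=> a b; rewrite /= -!/(quotient_adj _ _) quotient_adj_sym finset.setUC.
apply/connectP; exists (z :: rcons p x); last by rewrite /= last_rcons.
have neq a b c : c \in [set x; y]%SET -> c != a -> c != b -> [set a; b]%SET != [set x; y]%SET.
  by move=> cxy ca cb; apply: contraTneq cxy => <-; rewrite !inE negb_or ca.
apply/andP; split; first by apply/andP; split=> //; apply: (neq _ _ x); rewrite ?set21.
apply: (sub_in_path (P := predC1 y) (e := quotient_adj)) zp.
  move=> a b ay bY ab; apply/andP; split=> //; apply: (neq _ _ y); rewrite ?set22 //;
    by rewrite eq_sym.
rewrite /= eq_sym yz' all_rcons /= xy'; apply/allP => w wp /=.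
by apply: contraNneq yp => <-.
Qed.

Definition quotient_tree : tree :=
  Tree quotient_adj_sym quotient_adj_irr quotient_nonempty quotient_connected quotient_acyclic.

Lemma quotient_contraction_subproof : is_contraction (f : {ffun T -> quotient_tree}).
Proof.
apply/andP; split; apply/forallP => w; last first.
  apply/forallP => y; apply/implyP => wy; have [//|n] := eqVneq (f w) (f y).
  by apply/quotient_adjP; split=> //; exists w, y.
apply/andP; split; first by have [v fv] := f_surj w; apply/set0Pn; exists v; rewrite inE fv.
apply/forall_inP => x; rewrite inE => /eqP fx; apply/forall_inP => y; rewrite inE => /eqP fy.
have : f x = f y by rewrite fx fy.
move/f_fiber/connectP => [p pp ->]; elim: p x fx pp {fy} => [|a p IH] x fx /=.
  by rewrite connect0.
case/andP => /andP[xa /eqP E] /IH h; apply: connect_trans (h _); last by rewrite -E.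
by apply: connect1; apply/and3P; split=> //; rewrite inE -?E fx.
Qed.

Definition quotient_contraction : contraction T quotient_tree :=
  Contraction quotient_contraction_subproof.
End QuotientTree.

Section Collapse.
Variables (T : tree) (e : edge T) (a b : T).
Hypothesis eE : val e = [set a; b]%SET.

Let ab : a != b. Proof. exact/neq_adj/(adj_edge eE). Qed.
Let V : finType := {v : T | v != b}.
Let f : {ffun T -> V} := [ffun v => insubd (Sub a ab : V) v].

Lemma val_collapse v : val (f v) = if v != b then v else a.
Proof. by rewrite ffunE val_insubd. Qed.

Lemma collapse_surj w : exists v, f v = w.
Proof. by exists (val w); apply: val_inj; rewrite val_collapse (valP w). Qed.

Lemma collapse_eq u v : (f u == f v) = (u == v) || ([set u; v]%SET == val e).
Proof.
rewrite -val_eqE !val_collapse eE.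
have [->|ub] := eqVneq u b; have [->|vb] := eqVneq v b; rewrite ?eqxx //=.
- have [<-|av] := eqVneq a v; first by rewrite finset.setUC eqxx.
  apply/esym/negbTE; apply: contraNneq av => E.
  have : v \in [set a; b]%SET by rewrite -E set22.
  by rewrite !inE (negPf vb) orbF eq_sym.
- have [->|ua] := eqVneq u a; first by rewrite eqxx orbT.
  rewrite (negPf ub) /=; apply/esym/negbTE; apply: contraNneq ua => E.
  have : u \in [set a; b]%SET by rewrite -E set21.
  by rewrite !inE (negPf ub) orbF.
have [//|uv] := eqVneq u v; apply/esym/negbTE; apply: contraNneq ub => E.
have : b \in [set u; v]%SET by rewrite E set22.
by rewrite !inE ![b == _]eq_sym (negPf vb) orbF.
Qed.

Lemma collapse_fiber u v : f u = f v -> connect [rel x y | adj x y && (f x == f y)] u v.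
Proof.
move=> E; have : f u == f v by rewrite E.
rewrite collapse_eq => /orP[/eqP->|/eqP uv]; first exact: connect0.
by apply: connect1; rewrite /= (adj_edge (esym uv)) E eqxx.
Qed.

Definition collapse_tree : tree := quotient_tree collapse_surj collapse_fiber.

Definition collapse : contraction T collapse_tree :=
  quotient_contraction collapse_surj collapse_fiber.

Lemma contracted_collapse : contracted collapse = [set e]%SET.
Proof.
apply/finset.setP => k; have [u [v [uv kE]]] := edgeP k.
rewrite (contractedP _ kE) inE; apply: etrans (collapse_eq u v) _.
by rewrite (negPf (neq_adj uv)) -kE.
Qed.

Lemma card_collapse : (#|collapse_tree| < #|T|)%N.
Proof.
rewrite card_sig; apply: proper_card; apply/properP; split; first exact/fintype.subsetP.
by exists b; rewrite // inE eqxx.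
Qed.
End Collapse.

Lemma card_edge_contraction (T T' : tree) (f : contraction T T') :
  #|{: edge T}| = (#|{: edge T'}| + #|contracted f|)%N.
Proof.
have <- := cardsC (contracted f); rewrite addnC; congr (_ + _)%N.
rewrite -cardsT -(card_imset _ (@lift_edge_inj _ _ f)); apply: eq_card => k.
rewrite finset.in_setC; apply/idP/imsetP => [/lift_edge_surj[k' <-]|[k' _ ->]].
  by exists k'.
exact: lift_not_contracted.
Qed.

Lemma iso_contraction_subproof (T S : tree) (h : {ffun T -> S}) : bijective h ->
  (forall x y, adj (h x) (h y) = adj x y) -> is_contraction h.
Proof.
move=> [h' hK h'K] ha; apply/andP; split; apply/forallP => w; last first.
  by apply/forallP => y; rewrite ha; apply/implyP => ->; rewrite orbT.
apply/andP; split; first by apply/set0Pn; exists (h' w); rewrite inE h'K.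
apply/forall_inP => x; rewrite inE => /eqP fx; apply/forall_inP => y; rewrite inE => /eqP fy.
by rewrite -(hK x) -(hK y) fx fy; exact: connect0.
Qed.

(** A one-sided inverse is enough for generation: every element at [T] is then pulled back from [S]
    along [f]. *)
Definition same_shape (T S : tree) : Prop :=
  exists (f : contraction T S) (g : contraction S T), contr_comp g f = contr_id T.

(** The size and the adjacency matrix in the enumeration order: a code in a finite type that
    determines a tree with at most [N] vertices up to isomorphism. *)
Definition tree_code N (T : tree) : 'I_N.+1 * {ffun 'I_N.+1 * 'I_N.+1 -> bool} :=
  (inord #|T|, [ffun p : 'I_N.+1 * 'I_N.+1 => [exists x : T, exists y : T,
     [&& adj x y, enum_rank x == p.1 :> nat & enum_rank y == p.2 :> nat]]]).

Lemma tree_code_same N (T S : tree) : (#|T| <= N)%N -> (#|S| <= N)%N ->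
  tree_code N T = tree_code N S -> same_shape T S.
Proof.
move=> TN SN [cE aE].
have TS : #|T| = #|S| by have := congr1 val cE; rewrite /= !inordK.
pose h : {ffun T -> S} := [ffun x => enum_val (cast_ord TS (enum_rank x))].
pose h' : {ffun S -> T} := [ffun x => enum_val (cast_ord (esym TS) (enum_rank x))].
have hK : cancel h h' by move=> x; rewrite !ffunE enum_valK cast_ordK enum_rankK.
have h'K : cancel h' h by move=> x; rewrite !ffunE enum_valK cast_ordKV enum_rankK.
have codeE (U : tree) (x y : U) : (#|U| <= N)%N ->
    adj x y = (tree_code N U).2 (inord (enum_rank x), inord (enum_rank y)).
  move=> UN; have lt (z : U) : (enum_rank z < N.+1)%N.
    by apply: leq_trans (ltn_ord _) _; exact: leqW.
  rewrite ffunE /= !inordK //; apply/idP/existsP => [xy|[u /existsP[v /and3P[uv]]]].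
    by exists x; apply/existsP; exists y; rewrite xy !eqxx.
  by move=> /eqP/ord_inj/enum_rank_inj <- /eqP/ord_inj/enum_rank_inj <-.
have ha x y : adj (h x) (h y) = adj x y.
  by rewrite (codeE S) // (codeE T) // /= aE !ffunE !enum_valK.
have ha' x y : adj (h' x) (h' y) = adj x y by rewrite -ha !h'K.
exists (Contraction (iso_contraction_subproof (Bijective hK h'K) ha)).
exists (Contraction (iso_contraction_subproof (Bijective h'K hK) ha')).
by apply/val_inj/ffunP => x; rewrite [LHS]ffunE [RHS]ffunE; exact: hK.
Qed.

Section Point.
Let no_adj : rel unit := fun _ _ => false.

Lemma point_acyclic (p : seq unit) : (2 < size p)%N -> ~ ucycle no_adj p.
Proof. by case: p => [|x [|y p]] // _ /andP[]. Qed.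

Lemma point_nonempty : (0 < #|{: unit}|)%N. Proof. by rewrite card_unit. Qed.

Lemma point_connected x y : connect no_adj x y.
Proof. by case: x; case: y; exact: connect0. Qed.

Definition point : tree := @Tree unit no_adj (fun _ _ => erefl) (fun _ => erefl)
  point_nonempty point_connected point_acyclic.

Lemma card_edge_point : #|{: edge point}| = 0%N.
Proof. by apply: eq_card0 => k; have [u [v []]] := edgeP k. Qed.
End Point.

(* Testing on these states only spares the correction terms of the contraction of
   an unused edge: they involve this edge as the rootward one. *)
Lemma reduced_eq (T : tree) (r : T) (x y : tensor_mod T) : reduced_coord x -> reduced_coord y ->
  (forall s, admissible (down r) s -> x s = y s) -> x = y.
Proof.
move=> xr yr E; rewrite (reduced_expand r xr) (reduced_expand r yr).
apply: eq_bigr => t _; have [/E->//|/basis_state_zero->] := boolP (admissible (down r) t).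
by rewrite !scaler0.
Qed.

(** * Star products under a contraction *)

Section StarLift.
Variables (T T' : tree) (f : contraction T T').
Local Notation star := (edge T * edge T * edge T)%type.
Local Notation star' := (edge T' * edge T' * edge T')%type.

Definition lift_star (c : star') : star :=
  (lift_edge f c.1.1, lift_edge f c.1.2, lift_edge f c.2).

Lemma edge_map_symb (e k : edge T') :
  edge_map f (symb (Some e) (Some k)) = symb (Some (lift_edge f e)) (Some (lift_edge f k)).
Proof.
rewrite !symb_some (inj_eq (@lift_edge_inj _ _ f)).
exact: (rmorph_nat (edge_map f)).
Qed.

Lemma rmorph_star (R S : comNzRingType) (phi : {rmorphism R -> S}) (a a' b x y z : R)
    (u u' v p q w : S) :
  phi a = u -> phi a' = u' -> phi b = v -> phi x = p -> phi y = q -> phi z = w ->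
  phi ((a - b) * (x - y) - (a' - b) * (z - y)) = (u - v) * (p - q) - (u' - v) * (w - q).
Proof. by rewrite rmorphB !rmorphM !rmorphB => -> -> -> -> -> ->. Qed.

Lemma edge_map_star3 c (k : edge T') :
  edge_map f (star3 c (Some k)) = star3 (lift_star c) (Some (lift_edge f k)).
Proof.
rewrite !star3E; apply: (rmorph_star (phi := edge_map f));
  by [exact: edge_map_var | exact: edge_map_symb].
Qed.

Lemma star3_comp (U : tree) (c : edge U * edge U * edge U) k : star3 c (Some k) != 0 ->
  [\/ k = c.1.1, k = c.1.2 | k = c.2].
Proof.
move=> nz; have [->|h1] := eqVneq k c.1.1; first by constructor 1.
have [->|h2] := eqVneq k c.1.2; first by constructor 2.
have [->|h3] := eqVneq k c.2; first by constructor 3.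
by rewrite star3_off // eqxx in nz.
Qed.

Lemma big_lift (R : Type) (idx : R) (op : Monoid.com_law idx) (F : edge T -> R) :
  \big[op/idx]_(e | e \notin contracted f) F e = \big[op/idx]_e' F (lift_edge f e').
Proof.
rewrite (eq_bigl (fun e => e \in lift_edge f @: [set: edge T'])%SET); last first.
  move=> e; apply/idP/imsetP => [/lift_edge_surj[e' <-]|[e' _ ->]]; first by exists e'.
  exact: lift_not_contracted.
rewrite big_imset => [|e e' _ _]; last exact: lift_edge_inj.
by apply: eq_bigl => e'; rewrite inE.
Qed.

Lemma prod_notin (R : comNzRingType) (I : finType) (A : {set I}) (F : I -> R) :
  (forall i, i \in A -> F i = 1) -> \prod_i F i = \prod_(i | i \notin A) F i.
Proof. by move=> F1; rewrite (bigID (mem A)) /= big1 ?mul1r. Qed.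

Lemma edge_map_monomial (m : {cmonom edge T}) (m' : {cmonom edge T'}) :
  (forall e', m' e' = m (lift_edge f e')) -> (forall e, e \in contracted f -> m e = 0%N) ->
  edge_map f << m' >> = << m >> /\ mdeg m' = mdeg m.
Proof.
move=> m'E m0; split.
  rewrite edge_mapE; apply: etrans (evU _ m') _; rewrite [RHS]monomial_ev /evm.
  apply: (etrans _ (esym (prod_notin (A := contracted f) _))); last first.
    by move=> e ec; rewrite m0 // expr0.
  by rewrite big_lift; apply: eq_bigr => e' _; rewrite m'E.
rewrite !mdeg_sum [RHS](bigID (mem (contracted f))) /= [X in _ = (X + _)%N]big1 //.
by rewrite add0n big_lift; apply: eq_bigr => e' _; rewrite m'E.
Qed.
End StarLift.

Lemma prod_transfer (R S : comNzRingType) (phi : {rmorphism R -> S}) (I J : finType) (f : I -> J)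
    (A : {set I}) (F : I -> S) (G : J -> R) :
  {in A &, injective f} -> (forall i, i \notin A -> F i = 1) ->
  (forall j, j \notin f @: A -> G j = 1) -> (forall i, i \in A -> phi (G (f i)) = F i) ->
  phi (\prod_j G j) = \prod_i F i.
Proof.
move=> fA F1 G1 FG; rewrite rmorph_prod (bigID (mem (f @: A))) /= [X in _ * X]big1; last first.
  by move=> j /G1->; rewrite rmorph1.
rewrite [RHS](bigID (mem A)) /= [X in _ = _ * X]big1 // !mulr1 big_imset //.
by apply: eq_bigr => i /FG.
Qed.

Section StarProducts.
Variables (T : tree).
Local Notation star := (edge T * edge T * edge T)%type.
Implicit Type d : {ffun T -> option star}.

Lemma star_rooted_incident (r : T) d : star_rooted r d -> star_incident d.
Proof.
move=> rd v c /rd[uk ad bd]; split; first exact: up_in uk.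
  by move: ad; rewrite inE => /andP[].
by move: bd; rewrite inE => /andP[].
Qed.

Lemma star_productE d m s : star_product d m s =
  << m >> * \prod_v (if d v is Some c then star3 c else symb None) (s v).
Proof. exact: scale_pureE. Qed.

Lemma star_product_nz d m s : star_product d m s != 0 -> forall v,
  if s v is Some k then exists2 c, d v = Some c & [\/ k = c.1.1, k = c.1.2 | k = c.2]
  else d v = None.
Proof.
rewrite star_productE => nz v.
have : (if d v is Some c then star3 c else symb None) (s v) != 0.
  apply: contraNneq nz => E0; apply/eqP; rewrite (@prod_eq0 _ _ _ v E0); exact: mulr0.
case: (d v) => [c|]; case: (s v) => [k|] //.
- by move=> /star3_comp; exists c.
- by rewrite star3_none eqxx.
by rewrite ffunE eqxx.
Qed.

Lemma star_product_occ d m s : star_product d m s != 0 -> occupied s = star_support d.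
Proof.
move=> /star_product_nz nz; apply/finset.setP => v; rewrite !inE; move: (nz v).
by case: (s v) => [k [c -> _]|->].
Qed.
End StarProducts.

Lemma opp_scaleN1 (A : comNzRingType) (U : lmodType A) (x y : U) : x = -1 *: y -> - x = y.
Proof. by move=> ->; rewrite scaleN1r opprK. Qed.

Section Unused.
Variables (T T' : tree) (f : contraction T T').
Local Notation star := (edge T * edge T * edge T)%type.
Local Notation star' := (edge T' * edge T' * edge T')%type.
Hypothesis simple : (#|contracted f| <= 1)%N.
Variables (e : edge T) (ec : e \in contracted f).
Variables (r : T) (d : {ffun T -> option star}) (m : {cmonom edge T}).
Hypotheses (rd : star_rooted r d) (me : m e = 0%N).
Hypothesis de : forall (v : T) (c : star), d v = Some c -> [/\ e != c.1.1, e != c.1.2 & e != c.2].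

(** The star whose lift sits at a vertex over [v']; by [support_inj] at most one vertex over [v']
    carries a star. *)
Definition push_star : {ffun T' -> option star'} :=
  [ffun v' => [pick c' | [exists v, (f v == v') && (d v == Some (lift_star f c'))]]].

Definition push_monomial : {cmonom edge T'} := mkc [ffun e' => m (lift_edge f e')].

Lemma lift_other (k : edge T) : e != k -> exists k' : edge T', lift_edge f k' = k.
Proof.
move=> ek; have : k \notin contracted f.
  by apply: contraNN ek => kc; rewrite (contracted_uniq simple ec kc).
by case/lift_edge_surj => k' <-; exists k'.
Qed.

Lemma fiber_ends u v : u != v -> f u = f v -> val e = [set u; v]%SET.
Proof.
move=> uv fuv; have [k kc <-] := fiber_edge simple uv fuv.
by rewrite (contracted_uniq simple ec kc).
Qed.

Lemma up_unused v c : d v = Some c -> up r v != Some e.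
Proof.
move=> dv; have [-> _ _] := rd dv; have [h _ _] := de dv.
by apply: contraNneq h => -[->].
Qed.

(** Two stars in one fiber would sit at the two ends of [e]; at one of these [e] is rootward, so the
    star there would use [e]. *)
Lemma support_inj u v : d u != None -> d v != None -> f u = f v -> u = v.
Proof.
case du: (d u) => [c|//] _; case dv: (d v) => [c'|//] _ fuv.
apply/eqP/negPn/negP => uv; have eE := fiber_ends uv fuv.
by case: (edge_up_end r eE) => E; [move: (up_unused du) | move: (up_unused dv)];
  rewrite E eqxx.
Qed.

Lemma push_starP v' c' : push_star v' = Some c' ->
  exists2 v, f v = v' & d v = Some (lift_star f c').
Proof.
rewrite ffunE; case: pickP => // c /existsP[v /andP[/eqP fv /eqP dv]] [<-].
by exists v.
Qed.

Lemma push_star_some v c : d v = Some c ->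
  exists2 c', push_star (f v) = Some c' & lift_star f c' = c.
Proof.
move=> dv; have [h1 h2 h3] := de dv.
have [k1 E1] := lift_other h1; have [k2 E2] := lift_other h2; have [k3 E3] := lift_other h3.
rewrite ffunE; case: pickP => [c' /existsP[u /andP[/eqP fu /eqP du]]|].
  exists c' => //; suff uv : u = v by move: du; rewrite uv dv => -[].
  by apply: support_inj; rewrite ?du ?dv.
move=> /(_ (k1, k2, k3)) /existsP[]; exists v; rewrite eqxx dv /=.
by case: c {dv h1 h2 h3} E1 E2 E3 => -[a b] g /= <- <- <-.
Qed.

Lemma push_support : star_support push_star = f @: star_support d.
Proof.
apply/finset.setP => v'; rewrite inE; apply/idP/imsetP => [|[v]].
  case E: (push_star v') => [c'|//] _; have [v fv dv] := push_starP E.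
  by exists v; rewrite // inE dv.
by rewrite inE; case dv: (d v) => [c|//] _ ->; have [c' ->] := push_star_some dv.
Qed.

Lemma push_star_incident : star_incident push_star.
Proof.
move=> v' c' /push_starP[v <- dv]; have [h1 h2 h3] := star_rooted_incident rd dv.
by split; exact: lift_edge_f.
Qed.

Lemma card_push_support : #|star_support push_star| = #|star_support d|.
Proof.
rewrite push_support card_in_imset // => u v; rewrite !inE; exact: support_inj.
Qed.

Lemma push_monomialP : edge_map f << push_monomial >> = << m >> /\ mdeg push_monomial = mdeg m.
Proof.
apply: edge_map_monomial => [e'|k kc]; first by rewrite mkcE ffunE.
by rewrite (contracted_uniq simple kc ec).
Qed.

Let x := star_product d m.
Let x' := star_product push_star push_monomial.

(* [s] and [s'] occur in the products of stars upstairs and downstairs and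
   correspond to each other. *)
Definition match_up (s : state T) (s' : state T') : Prop :=
  [/\ forall v, d v = None -> s v = None,
      forall v, d v != None -> s v = omap (lift_edge f) (s' (f v)) &
      forall v', push_star v' = None -> s' v' = None].

Lemma match_up_eval s s' : match_up s s' -> edge_map f (x' s') = x s.
Proof.
move=> [M1 M2 M3]; rewrite /x /x' !star_productE.
apply: etrans (rmorphM (edge_map f) _ _) _.
apply: (congr2 *%R (proj1 push_monomialP)).
apply: (prod_transfer (phi := edge_map f) (f := f) (A := star_support d)).
- by move=> u v; rewrite !inE; exact: support_inj.
- by move=> v; rewrite inE negbK => /eqP dv; rewrite dv M1 // ffunE.
- move=> v'; rewrite -push_support inE negbK => /eqP dv'.
  by rewrite dv' M3 // ffunE.
move=> v; rewrite inE => dv; rewrite (M2 v dv).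
case E: (d v) dv => [c|//] _; have [c' -> <-] := push_star_some E.
case: (s' (f v)) => [k|] /=; first exact: edge_map_star3.
rewrite !star3_none; exact: (raddf0 (edge_map f)).
Qed.

Lemma compat_match_up s s' : admissible (down r) s -> compat f s s' -> x' s' != 0 -> match_up s s'.
Proof.
move=> adm /compatP[inj im dir] /star_product_nz nz.
have H v kv : s v = Some kv -> exists c' e',
    [/\ d v = Some (lift_star f c'), s' (f v) = Some e' & kv = lift_edge f e'].
  move=> sv; have := dir v; rewrite occupied_in sv => /(_ isT).
  move: (nz (f v)); case: (s' (f v)) => [e'|//] [c' dc' e'c] [kvE].
  have [u fu du] := push_starP dc'.
  have ue' : u \in val (lift_edge f e').
    have [h1 h2 h3] := star_rooted_incident rd du.
    by case: e'c => ->.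
  have [uv|uv] := eqVneq u v.
    by subst u; exists c', e'; rewrite kvE edge_dir_id.
  (* Otherwise [v] is the other end of [e] and its half-edge is [e]. As [s] is admissible, [e] is
     not rootward at [v], so it is rootward at [u], whose star would then contain it. *)
  have eE := fiber_ends uv fu.
  have kve : kv = e.
    rewrite kvE; apply: (edge_dirE ue' uv); first by rewrite eE set22.
    by rewrite sepC; exact: sep_bridge.
  have := admissibleP adm sv; rewrite kve inE => /andP[_ nup].
  by case: (edge_up_end r eE) => E; [move: (up_unused du); rewrite E eqxx | rewrite E eqxx in nup].
split.
- by move=> v dv; case sv: (s v) => [kv|//]; have [c' [e' [E _ _]]] := H v kv sv; rewrite E in dv.
- move=> v dv; have : f v \in occupied s'.
    case E: (d v) dv => [c|//] _; have [c' pc _] := push_star_some E.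
    by rewrite occupied_in; move: (nz (f v)); case: (s' (f v)) => // pn; rewrite pn in pc.
  rewrite -im => /imsetP[u us fuv]; move: us; rewrite occupied_in.
  case su: (s u) => [ku|//] _; have [c' [e' [E1 E2 E3]]] := H u ku su.
  have uv : u = v by apply: support_inj => //; rewrite E1.
  by subst u; rewrite su E2 E3.
by move=> v' pn; move: (nz v'); case: (s' v') => // k [c]; rewrite pn.
Qed.

Lemma match_up_uniq s s1 s2 : match_up s s1 -> match_up s s2 -> s1 = s2.
Proof.
move=> [_ A2 A3] [_ B2 B3]; apply/ffunP => v'.
case E: (push_star v') => [c'|]; last by rewrite A3 // B3.
have [v <- dv] := push_starP E.
have : omap (lift_edge f) (s1 (f v)) = omap (lift_edge f) (s2 (f v)).
  by rewrite -A2 -?B2 // dv.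
by case: (s1 (f v)) => [a|]; case: (s2 (f v)) => [b|] //= [/lift_edge_inj->].
Qed.

Lemma match_up_exists s : x s != 0 -> exists2 s', compat f s s' & match_up s s'.
Proof.
move=> /[dup] /star_product_occ os /star_product_nz nz.
have sd v k : s v = Some k -> exists2 c, d v = Some c & [\/ k = c.1.1, k = c.1.2 | k = c.2].
  by move=> sv; move: (nz v); rewrite sv.
have dN v : (d v != None) = (s v != None).
  by move/finset.setP/(_ v): os; rewrite !inE.
pose s' : state T' := [ffun v' => [pick k' | [exists v, (f v == v') && (s v == Some (lift_edge f k'))]]].
have s'P v' k' : s' v' = Some k' -> exists2 v, f v = v' & s v = Some (lift_edge f k').
  by rewrite ffunE; case: pickP => // k /existsP[v /andP[/eqP fv /eqP sv]] [<-]; exists v.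
have ss' v k : s v = Some k -> exists2 k', s' (f v) = Some k' & lift_edge f k' = k.
  move=> sv; have [c dv kc] := sd v k sv; have [h1 h2 h3] := de dv.
  have [k0 k0E] : exists k' : edge T', lift_edge f k' = k.
    by apply: lift_other; case: kc => ->.
  case E: (s' (f v)) => [k'|].
    exists k' => //; have [u fu su] := s'P _ _ E.
    have uv : u = v by apply: support_inj; rewrite ?dN ?sv ?su.
    by move: su; rewrite uv sv => -[].
  move: E; rewrite ffunE; case: pickP => // /(_ k0) /existsP[]; exists v.
  by rewrite eqxx sv k0E /=.
exists s'.
  apply/compatP; split.
  - by move=> u v; rewrite !occupied_in -!dN; exact: support_inj.
  - apply/finset.setP => v'; rewrite occupied_in; apply/imsetP/idP => [[v]|].
      by rewrite occupied_in; case sv: (s v) => [k|//] _ ->; have [k' ->] := ss' v k sv.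
    case E: (s' v') => [k'|//] _; have [v fv sv] := s'P _ _ E.
    by exists v; rewrite // occupied_in sv.
  - move=> v; rewrite occupied_in; case sv: (s v) => [k|//] _.
    have [k' -> kE] := ss' v k sv; rewrite /= kE edge_dir_id //.
    have [c dv kc] := sd v k sv; have [h1 h2 h3] := star_rooted_incident rd dv.
    by case: kc => ->.
split.
- by move=> v dv; apply/eqP/negPn; rewrite -dN dv.
- move=> v; rewrite dN; case sv: (s v) => [k|//] _.
  by have [k' -> <-] := ss' v k sv.
move=> v' pn; case E: (s' v') => [k'|//]; have [v fv sv] := s'P _ _ E.
have [c dv _] := sd _ _ sv; have [c' pc _] := push_star_some dv.
by rewrite -fv pc in pn.
Qed.

(** On an admissible state at most one compatible state contributes, namely the matching one; the
    sign is that of reordering the vertices of the stars. *)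
Lemma chain_pull_push : chain_pull f x' = (-1) ^+ ninv f (star_support d) *: x.
Proof.
have xc := star_product_cycle (star_rooted_incident rd) (erefl #|star_support d|)
  (erefl (mdeg m + #|star_support d|.*2)%N).
have x'c := star_product_cycle push_star_incident (erefl #|star_support push_star|)
  (erefl (mdeg push_monomial + #|star_support push_star|.*2)%N).
apply: (@reduced_eq _ r).
- by apply: chain_pull_reduced; apply/sw_reducedP; case: x'c.
- by apply/sw_reducedP/spannedZ; case: xc.
move=> s adm; rewrite [LHS]ffunE [RHS]ffunE.
have -> : \sum_(s' | compat f s s') edge_map f (x' s') = x s.
  have [x0|nz] := eqVneq (x s) 0.
    rewrite x0 big1 // => s' c; have [->|nz'] := eqVneq (x' s') 0; first exact: (raddf0 (edge_map f)).
    by rewrite (match_up_eval (compat_match_up adm c nz')).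
  have [s0 c0 M0] := match_up_exists nz.
  rewrite (bigD1 s0) //= (match_up_eval M0) big1 ?addr0 // => s' /andP[c ne].
  have [->|nz'] := eqVneq (x' s') 0; first exact: (raddf0 (edge_map f)).
  by rewrite (match_up_uniq (compat_match_up adm c nz') M0) eqxx in ne.
have [->|/star_product_occ->//] := eqVneq (x s) 0.
by rewrite scaler0; exact: mulr0.
Qed.

Lemma star_product_pull n i : #|star_support d| = i -> (mdeg m + i.*2)%N = n ->
  exists2 x1 : tensor_mod T', sw_cycle_prop n i x1 & sw_pull f x1 = star_product d m.
Proof.
move=> di mn.
have x'c : sw_cycle_prop n i x'.
  apply: star_product_cycle; first exact: push_star_incident.
    by rewrite card_push_support.
  by rewrite (proj2 push_monomialP).
(* An odd reordering is absorbed by taking the opposite cycle downstairs. *)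
have := chain_pull_push; rewrite -signr_odd; case: (odd _); rewrite ?expr1 ?expr0 => E.
  have x'N : sw_cycle_prop n i (- x').
    have : - x' \in sw_cycles n i by rewrite rpredN; exact/asboolP.
    by move/asboolP.
  exists (- x'); first exact: x'N.
  have h : reduced_coord (- x') by apply/sw_reducedP; case: x'N.
  apply: etrans (sw_pull_simple simple h) _; apply: etrans (raddfN (chain_pull f) x') _.
  exact: opp_scaleN1 E.
exists x'; first exact: x'c.
have h : reduced_coord x' by apply/sw_reducedP; case: x'c.
by apply: etrans (sw_pull_simple simple h) _; apply: etrans E _; exact: scale1r.
Qed.
End Unused.

(** * Generation of tree modules *)

Lemma card_bigcup_leq (I J : finType) (A : {set I}) (F : I -> {set J}) k :
  (forall i, i \in A -> #|F i| <= k)%N -> (#|\bigcup_(i in A) F i| <= #|A| * k)%N.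
Proof.
move=> h; rewrite -sum_nat_const.
elim/big_rec2: _ => [|i n B iA IH]; first by rewrite cards0.
by apply: leq_trans (leq_card_setU _ _) _; apply: leq_add; first exact: h.
Qed.

Lemma unused_edge (T : tree) (d : {ffun T -> option (edge T * edge T * edge T)})
    (m : {cmonom edge T}) : (mdeg m + #|star_support d| * 3 < #|{: edge T}|)%N ->
  exists2 e : edge T, m e = 0%N & forall (v : T) c, d v = Some c ->
    [/\ e != c.1.1, e != c.1.2 & e != c.2].
Proof.
move=> lt; pose A : {set edge T} := [set e | m e != 0%N].
pose B : {set edge T} := \bigcup_(v in star_support d)
  (if d v is Some c then [set c.1.1; c.1.2; c.2] else finset.set0)%SET.
have cA : (#|A| <= mdeg m)%N.
  rewrite mdeg_sum -sum1_card big_mkcond; apply: leq_sum => e _.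
  by rewrite inE; case: (m e).
have cB : (#|B| <= #|star_support d| * 3)%N.
  apply: card_bigcup_leq => v _; case: (d v) => [c|]; last by rewrite cards0.
  by apply: leq_trans (leq_card_setU _ _) _; rewrite cards1 cards2 addn1; case: (_ != _).
have : ~~ ([set: edge T] \subset (A :|: B))%SET.
  apply: contraTN lt => /subset_leq_card; rewrite cardsT -leqNgt => h.
  by apply: leq_trans h _; apply: leq_trans (leq_card_setU _ _) _; exact: leq_add.
case/subsetPn => e _; rewrite finset.in_setU negb_or => /andP[eA eB]; exists e.
  by apply/eqP; move: eA; rewrite inE negbK.
move=> v c dv; have : e \notin [set c.1.1; c.1.2; c.2]%SET.
  apply: contra eB => ec; apply/bigcupP; exists v; first by rewrite inE dv.
  by rewrite dv.
by rewrite !inE !negb_or => /andP[/andP[]].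
Qed.

Lemma star_gen_collapse (T : tree) (r : T) n i x : star_gen r i n x ->
  (n + i < #|{: edge T}|)%N -> exists (T1 : tree) (f : contraction T T1),
  [/\ (#|contracted f| <= 1)%N, (#|T1| < #|T|)%N, #|{: edge T}| = #|{: edge T1}|.+1 &
      exists2 x1 : tensor_mod T1, sw_cycle_prop n i x1 & sw_pull f x1 = x].
Proof.
move=> [d [m [-> rd di mn]]] lt.
have [|e me de] := @unused_edge T d m.
  (* With three edges per star, [mdeg m + 3 * i] equals [n + i], since [mdeg m + 2 * i = n]. *)
  by apply: leq_ltn_trans lt; rewrite di -mn -addnn; lia.
have [a [b [_ eE]]] := edgeP e.
have cE := contracted_collapse eE.
exists (collapse_tree eE), (collapse eE).
have c1 : (#|contracted (collapse eE)| <= 1)%N by rewrite cE cards1.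
split=> //; first exact: card_collapse.
  by rewrite (card_edge_contraction (collapse eE)) cE cards1 addn1.
have ec : e \in contracted (collapse eE) by rewrite cE set11.
exact: (star_product_pull c1 ec rd me de).
Qed.

Section Generators.
Variables (M : tree_module) (I : finType) (S : I -> tree) (g : forall i, M (S i)).

Definition translate (T : tree) (y : M T) : Prop :=
  exists i (h : contraction T (S i)), y = tact (mact M) h (g i).

Lemma translate_act (T T' : tree) (f : contraction T T') (y : M T') :
  zspan (@translate T') y -> zspan (@translate T) (tact (mact M) f y).
Proof.
apply: zspan_image => _ [i [h ->]]; apply: zspan_gen.
by exists i, (contr_comp h f); rewrite act_comp.
Qed.

(** The morphism that the Yoneda lemma attaches to the elements [g i]. *)
Definition yoneda_fun (T : tree) (x : dsum_obj (fun i => principal (S i) T)) : M T :=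
  \sum_i \sum_(h : contraction T (S i)) tact (mact M) h (g i) *~ x i h.

Lemma yoneda_additive T : zmod_morphism (@yoneda_fun T).
Proof.
move=> x y; rewrite /yoneda_fun -sumrB; apply: eq_bigr => i _.
by rewrite -sumrB; apply: eq_bigr => h _; rewrite -mulrzBr !ffunE.
Qed.

HB.instance Definition _ T := GRing.isZmodMorphism.Build
  (dsum_obj (fun i => principal (S i) T)) (M T) (@yoneda_fun T) (@yoneda_additive T).

Lemma yoneda_nat (T T' : tree) (f : contraction T T')
    (x : dsum (fun i => principal (S i)) T') :
  yoneda_fun (tact (mact (dsum (fun i => principal (S i)))) f x) =
  tact (mact M) f (yoneda_fun x).
Proof.
rewrite /yoneda_fun raddf_sum; apply: eq_bigr => i _; rewrite raddf_sum /=.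
transitivity (\sum_(h : contraction T (S i)) \sum_(k : contraction T' (S i) | contr_comp k f == h)
   tact (mact M) h (g i) *~ x i k).
  by apply: eq_bigr => h _; rewrite ffunE mulrz_sumr.
rewrite (exchange_big_dep predT) //=; apply: eq_bigr => k _.
rewrite (big_pred1 (contr_comp k f)) => [|h]; last by rewrite eq_sym.
by rewrite act_comp raddfMz.
Qed.

Definition yoneda : tree_mor (dsum (fun i => principal (S i))) M :=
  TreeMor (fun T T' f x => yoneda_nat f x).

Lemma yoneda_surj : (forall T (y : M T), zspan (@translate T) y) ->
  quotient_of (dsum (fun i => principal (S i))) M.
Proof.
move=> h; exists yoneda => T y; elim: (h T y) => [|{}y z _ [x <-] _ [x' <-]|_ [i [k ->]]].
- by exists 0; exact: raddf0.
- by exists (x - x'); exact: raddfB.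
exists (fun j => [ffun h : contraction T (S j) =>
  (Tagged (fun j => contraction T (S j)) h == Tagged (fun j => contraction T (S j)) k)%:R]).
rewrite /= /yoneda_fun.
rewrite (sig_big_dep _ _ (fun j (h : contraction T (S j)) => _)) /=.
rewrite (bigD1 (Tagged (fun j => contraction T (S j)) k)) //= ffunE eqxx big1 ?addr0 // => p pk.
by case: p pk => j k' pk; rewrite ffunE (negPf pk).
Qed.
End Generators.

(** Means finitely generated as an abelian group, not finite. *)
Definition finite_group (V : zmodType) : Prop :=
  exists s : seq V, forall y, zspan (fun y => y \in s) y.

(** * Descent to trees with few edges *)

Section Generation.
Variables (M : tree_module) (n i b D : nat).
Variable theta : forall T, {additive M T -> sw_homology T n i}.
Hypotheses (nD : (n + i <= D)%N) (bD : (b <= D)%N).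
Hypothesis theta_bij : forall T, (b <= #|{: edge T}|)%N -> bijective (theta T).
Hypothesis theta_nat : forall (T T' : tree) (f : contraction T T'),
  (b <= #|{: edge T'}|)%N -> (#|contracted f| <= 1)%N ->
  exists F : sw_homology T' n i -> sw_homology T n i,
    induced_by_pull f F /\ forall x, theta T (tact (mact M) f x) = F (theta T' x).
Hypothesis few_edges : forall T, (#|{: edge T}| < b)%N -> finite_group (M T).

(** Lets the descent work with explicit cycles, while the action is known only through [theta]. *)
Definition represents (T : tree) (y : M T) (x : tensor_mod T) : Prop :=
  exists2 z : sw_cycle T n i, val z = x & theta T y = sw_class z.

Lemma represents_exists (T : tree) (x : tensor_mod T) : (b <= #|{: edge T}|)%N ->
  sw_cycle_prop n i x -> exists y, represents y x.
Proof.
move=> bT xc; have xs : x \in sw_cycles n i by exact/asboolP.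
have [h _ hK] := theta_bij bT.
exists (h (sw_class (Sub x xs : sw_cycle T n i))); exists (Sub x xs) => //.
Qed.

Lemma represents_uniq (T : tree) (x x' : tensor_mod T) y y' : (b <= #|{: edge T}|)%N ->
  represents y x -> represents y' x' -> sw_boundary_prop n i (x - x') -> y = y'.
Proof.
move=> bT [z <- yE] [z' <- yE'] bd; apply: (bij_inj (theta_bij bT)).
rewrite yE yE'; apply/eqP; rewrite classE; exact/asboolP.
Qed.

Lemma represents_span (T : tree) (G : tensor_mod T -> Prop) (H : M T -> Prop) :
  (forall x, G x -> exists2 y, H y & represents y x) ->
  forall x, zspan G x -> exists2 y, zspan H y & represents y x.
Proof.
move=> GH x; elim=> [|{}x x' _ [y Hy [z <- E]] _ [y' Hy' [z' <- E']]|{}x /GH[y Hy yx]].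
- exists 0; first exact: zspan0.
  by exists 0; [exact: raddf0 | rewrite raddf0; exact/esym/raddf0].
- exists (y - y'); first exact: zspanB.
  by exists (z - z'); [exact: raddfB | rewrite raddfB E E'; exact/esym/classB].
by exists y => //; exact: zspan_gen.
Qed.

Lemma star_span (T : tree) (H : M T -> Prop) r : (b <= #|{: edge T}|)%N ->
  (forall x, star_gen r i n x -> exists2 y, H y & represents y x) ->
  forall y, zspan H y.
Proof.
move=> bT h y; have [z zE] := class_surj (theta T y).
have zc : sw_cycle_prop n i (val z) by exact/asboolP/(valP z).
have [x' x's bd] := star_generators r zc.
have [y' y's yx'] := represents_span h x's.
by rewrite (represents_uniq (y := y) (x := val z) bT _ yx' bd) //; exists z.
Qed.

(** In a fixed bidegree there are finitely many star products, because the exponents of the monomial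
    are at most [n]. *)
Lemma finite_values (T : tree) : finite_group (M T).
Proof.
have [bT|/few_edges//] := leqP b #|{: edge T}|.
have /card_gt0P[r _] := tree_nonempty T.
pose D' := {ffun T -> option (edge T * edge T * edge T)}.
pose E' := {ffun edge T -> 'I_n.+1}.
(* Some of these products are not cycles of the right degree; for them the choice is arbitrary. *)
have ex (p : D' * E') : exists y, sw_cycle_prop n i (star_product p.1 (mkc [ffun e => nat_of_ord (p.2 e)])) ->
    represents y (star_product p.1 (mkc [ffun e => nat_of_ord (p.2 e)])).
  have [/(represents_exists bT)[y yE]|h] := pselect (sw_cycle_prop n i
    (star_product p.1 (mkc [ffun e => nat_of_ord (p.2 e)]))); first by exists y.
  by exists 0.
have [Y YE] := choice ex.
exists [seq Y p | p <- enum {: D' * E'}].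
apply: (star_span (r := r) bT) => x [d [m [-> rd di mn]]].
pose k : E' := [ffun e => inord (m e)].
have mE : m = mkc [ffun e => nat_of_ord (k e)].
  apply/eqP/cmP => e; rewrite mkcE !ffunE inordK // ltnS -mn.
  apply: leq_trans (leq_addr _ _); rewrite mdeg_sum (bigD1 e) //=; exact: leq_addr.
exists (Y (d, k)); first by apply: map_f; rewrite mem_enum.
rewrite mE; apply: (YE (d, k)); rewrite /= -mE.
exact: star_product_cycle (star_rooted_incident rd) di mn.
Qed.

(** The bound [b] delimits the trees that [theta] controls: it is 0 for the complex itself and 1 for
    configuration spaces. Since [b <= D], contracting one edge of a tree with more than [D] edges
    stays in the controlled range. *)
Lemma generation : exists (r : nat) (S : 'I_r -> tree),
  (forall j, (#|{: edge (S j)}| <= D)%N) /\ quotient_of (dsum (fun j => principal (S j))) M.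
Proof.
(* A tree with at most [D] edges has at most [D.+1] vertices, whence codes over ['I_D.+2]. *)
pose code := ('I_D.+2 * {ffun 'I_D.+2 * 'I_D.+2 -> bool})%type.
have ex (c : code) : exists p : {S : tree & seq (M S)},
    [/\ (#|{: edge (tag p)}| <= D)%N, forall y, zspan (fun y => y \in tagged p) y &
        forall T : tree, (#|{: edge T}| <= D)%N -> tree_code D.+1 T = c -> same_shape T (tag p)].
  have sz (T : tree) : (#|{: edge T}| <= D)%N -> (#|T| <= D.+1)%N.
    by move=> TD; apply: leq_trans (card_vert_le T) _.
  have [[S [SD Sc]]|h] := pselect (exists S : tree, (#|{: edge S}| <= D)%N /\ tree_code D.+1 S = c).
    have [s sE] := finite_values S; exists (existT _ S s); split=> //= T TD Tc.
    by apply: tree_code_same; [exact: sz | exact: sz | rewrite Tc Sc].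
  (* A code that belongs to no such tree is given the one-vertex tree, which only adds generators of
     degree 0. *)
  have [s sE] := finite_values point; exists (existT _ point s); split=> //=.
    by rewrite card_edge_point.
  by move=> T TD Tc; case: h; exists T.
have [P PE] := choice ex.
pose I := {c : code & 'I_(size (tagged (P c)))}.
pose S (p : I) := tag (P (tag p)).
pose g (p : I) : M (S p) := nth 0 (tagged (P (tag p))) (tagged p).
suff gen T (y : M T) : zspan (translate g (T := T)) y.
  exists #|{: I}|, (fun j => S (enum_val j)); split.
    by move=> j; have [] := PE (tag (enum_val j)).
  apply: (@yoneda_surj M _ (fun j => S (enum_val j)) (fun j => g (enum_val j))) => T y.
  apply: zspan_sub (gen T y) => {}y [p [h yE]]; apply: zspan_gen.
  by exists (enum_rank p); rewrite /translate enum_rankK; exists h.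
have [N] := ubnP #|T|; elim: N T y => // N IH T y; rewrite ltnS => TN.
have [TD|DT] := leqP #|{: edge T}| D.
  have [_ sE shape] := PE (tree_code D.+1 T).
  have [f [h hf]] := shape T TD erefl.
  (* Up to the bound, [y] is pulled back from the chosen tree of the same shape. *)
  rewrite -[y](act_id (mact M)) -hf act_comp.
  apply: translate_act; apply: zspan_sub (sE _) => {}y /(nthP 0)[k ks <-].
  apply: zspan_gen; exists (Tagged (fun c => 'I_(size (tagged (P c)))) (Ordinal ks)).
  exists (contr_id _); exact/esym/act_id.
have /card_gt0P[r _] := tree_nonempty T.
have bT : (b <= #|{: edge T}|)%N by apply: leq_trans bD (ltnW DT).
apply: zspan_sub (star_span (r := r) bT (H := zspan (translate g (T := T))) _ y); first by [].
(* Beyond the bound, each star product comes from a tree with one edge less, where the induction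
   hypothesis applies. *)
move=> x /star_gen_collapse[|T1 [f [f1 T1T eT [x1 x1c <-]]]].
  exact: leq_ltn_trans nD DT.
have bT1 : (b <= #|{: edge T1}|)%N by rewrite -ltnS -eT; exact: leq_ltn_trans bD DT.
have [y1 [z1 z1E y1E]] := represents_exists bT1 x1c.
have [F [pF FE]] := theta_nat bT1 f1; have [z [zE Fz]] := pF z1.
exists (tact (mact M) f y1).
  by apply: translate_act; apply: IH; exact: leq_trans TN.
exists z; first by apply: etrans zE _; exact: congr1.
apply: etrans (FE y1) _; apply: etrans (congr1 F y1E) _; exact: Fz.
Qed.
End Generation.

Lemma quotient_refl (M : tree_module) : quotient_of M M.
Proof.
have nat T T' (f : contraction T T') (x : M T') :
  (idfun : {additive M T -> M T}) (tact (mact M) f x) =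
  tact (mact M) f ((idfun : {additive M T' -> M T'}) x) by [].
by exists (TreeMor nat) => T y; exists y.
Qed.

Lemma submodule_refl (M : tree_module) : submodule_of M M.
Proof.
have nat T T' (f : contraction T T') (x : M T') :
  (idfun : {additive M T -> M T}) (tact (mact M) f x) =
  tact (mact M) f ((idfun : {additive M T' -> M T'}) x) by [].
by exists (TreeMor nat) => T x y.
Qed.

Lemma small_generated d (M : tree_module) : generated_in_degrees_le d M -> small d M.
Proof.
move=> h; exists M; split=> //; exists M; split; first exact: submodule_refl.
exact: quotient_refl.
Qed.

Lemma generated_finitely d (M : tree_module) : generated_in_degrees_le d M -> finitely_generated M.
Proof. by move=> [r [S [_ h]]]; exists r, S. Qed.

Lemma sw_generated n i (M : tree_action (fun T => sw_homology T n i)) : sw_action M ->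
  generated_in_degrees_le (n + i) (TreeModule M).
Proof.
move=> MP; have bij T : (0 <= #|{: edge T}|)%N ->
    bijective (idfun : {additive sw_homology T n i -> sw_homology T n i}) by exists idfun.
apply: (@generation (TreeModule M) n i 0 _ _ (leqnn _) (leq0n _) bij) => //.
by move=> T T' f _ f1; exists (tact M f); split=> //; exact: MP.
Qed.

(** * Configuration spaces *)

Section OneVertex.
Variable R : realType.

Lemma malg_torsion (K : choiceType) (x : {malg int[K]}) (z : int) : x *~ z = 0 -> z != 0 -> x = 0.
Proof.
move=> xz z0; apply/malgP => k; have := congr1 (mcoeff k) xz.
rewrite raddfMz /= mcoeff0 -mulrzl => /eqP.
by rewrite mulf_eq0 intr_eq0 (negPf z0) /= => /eqP.
Qed.

Lemma sing_cycles_torsion (X : topologicalType) i (c : sing_chain R X i) (z : int) :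
  c *~ z \in @sing_cycles R X i -> z != 0 -> c \in @sing_cycles R X i.
Proof.
case: i c => [//|i] c; rewrite !unfold_in /= raddfMz => /eqP h z0.
by rewrite (malg_torsion h z0).
Qed.

(** There is at most one singular simplex in each degree. Either it is a cycle and its class
    generates, or no nonzero multiple of it is a cycle, as chains have no torsion. *)
Lemma sing_homology_finite (X : topologicalType) i : (forall x y : X, x = y) ->
  finite_group (sing_homology R X i).
Proof.
move=> X1.
have S1 (s t : continuousType (simplex R i) X) : s = t by apply/continuousEP => x; exact: X1.
have cE (c : sing_chain R X i) s : c = << s >> *~ mcoeff s c.
  by apply/malgP => t; rewrite (S1 t s) raddfMz /= mcoeffUU intz.
have [[s sc]|h] := pselect (exists s, (<< s >> : sing_chain R X i) \in @sing_cycles R X i).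
  exists [:: subquotient_class _ (Sub (<< s >> : sing_chain R X i) sc)] => y.
  have [z ->] := class_surj y.
  have -> : z = Sub (<< s >> : sing_chain R X i) sc *~ mcoeff s (val z).
    by apply: val_inj; rewrite raddfMz /=; exact: cE.
  rewrite /subquotient_class raddfMz; apply/zspanMz/zspan_gen; exact: mem_head.
exists [::] => y; have [z ->] := class_surj y.
suff -> : z = 0 by rewrite /subquotient_class raddf0; exact: zspan0.
apply: val_inj => /=; apply/malgP => s; rewrite mcoeff0; apply/eqP/negPn/negP => nz.
apply: h; exists s; have := valP z; rewrite (cE (val z) s).
by move=> /sing_cycles_torsion; apply.
Qed.

Lemma edgeless_eq (T : tree) (u v : T) : #|{: edge T}| = 0%N -> u = v.
Proof.
move=> T0; have := card_vert_le T; rewrite T0 => /card_le1P h.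
by have := h u isT v; rewrite !inE => /esym/eqP.
Qed.

Lemma realization_eq (T : tree) (x y : realization R T) : #|{: edge T}| = 0%N -> x = y.
Proof.
move=> T0; apply: val_inj => /=.
have [_ x1 _] := set_mem (valP x); have [_ y1 _] := set_mem (valP y).
have one (t : T -> R) v : \sum_v t v = 1 -> t v = 1.
  by rewrite (big_pred1 v) // => u /=; rewrite (edgeless_eq u v T0) eqxx.
by apply: functional_extensionality_dep => v; rewrite (one _ v x1) (one _ v y1).
Qed.

Lemma uconf_eq n (X : topologicalType) (x y : uconf n X) : (forall a b : X, a = b) -> x = y.
Proof.
move=> X1; rewrite -[x]reprK -[y]reprK; congr (\pi _)%qT.
by apply: val_inj; apply: functional_extensionality_dep => j; exact: X1.
Qed.

Lemma uconf_finite n i (T : tree) : (#|{: edge T}| < 1)%N -> finite_group (uconf_homology R n i T).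
Proof.
rewrite ltnS leqn0 => /eqP T0; apply: sing_homology_finite => x y.
by apply: uconf_eq => a b; exact: realization_eq.
Qed.

Lemma uconf_generated n i D (M : tree_action (uconf_homology R n i)) : uconf_action M ->
  (n + i <= D)%N -> (0 < D)%N -> generated_in_degrees_le D (TreeModule M).
Proof.
move=> [theta [bij nat]] nD D0; apply: (@generation (TreeModule M) n i 1 _ theta) => //.
by move=> T; exact: uconf_finite.
Qed.
End OneVertex.

Lemma contraction_descend (T T1 T' : tree) (q : contraction T T1) (f : contraction T T') :
  (forall u v, q u = q v -> f u = f v) -> exists g : contraction T1 T', f = contr_comp g q.
Proof.
move=> qf; have [h hE] := choice (contr_surj q).
pose g : {ffun T1 -> T'} := [ffun w => f (h w)].
have gq v : g (q v) = f v by rewrite ffunE; apply: qf; exact: hE.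
have gc : is_contraction g.
  apply/andP; split; apply/forallP => w; last first.
    apply/forallP => y; apply/implyP => wy; have [a [b [ab <- <-]]] := contr_edge_lift q wy.
    by rewrite !gq; have [->|->] := contr_adj f ab; rewrite ?eqxx ?orbT.
  have [v fv] := contr_surj f w.
  apply/andP; split; first by apply/set0Pn; exists (q v); rewrite inE gq fv.
  apply/forall_inP => a; rewrite inE => /eqP ga; apply/forall_inP => b; rewrite inE => /eqP gb.
  rewrite -(hE a) -(hE b); have : f (h a) = f (h b) by rewrite -!gq !hE ga gb.
  have : f (h a) = w by rewrite -gq hE.
  move=> faw /contr_fiber; rewrite faw => /connectP[p pp ->].
  elim: p (h a) pp {faw} => [|c p IH] x /=; first by rewrite connect0.
  case/andP => /and3P[xc]; rewrite !inE => fx fc /IH; apply: connect_trans.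
  have [->|qxc] := contr_adj q xc; first exact: connect0.
  by apply: connect1; apply/and3P; split; rewrite // inE gq.
exists (Contraction gc); apply/val_inj/ffunP => v; rewrite [RHS]ffunE; exact/esym/gq.
Qed.

(** Serves to pass from simple contractions, with which [theta] is compatible, to arbitrary ones:
    collapsing one contracted edge first leaves fewer to contract. *)
Lemma contraction_factor (T T' : tree) (f : contraction T T') : (1 < #|contracted f|)%N ->
  exists (T1 : tree) (q : contraction T T1) (g : contraction T1 T'),
    [/\ f = contr_comp g q, (#|contracted q| <= 1)%N & (#|contracted g| < #|contracted f|)%N].
Proof.
move=> f1; have /card_gt0P[e ef] : (0 < #|contracted f|)%N by exact: ltnW.
have [a [b [_ eE]]] := edgeP e; pose q := collapse eE.
have cq : contracted q = [set e]%SET by exact: contracted_collapse.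
have q1 : (#|contracted q| <= 1)%N by rewrite cq cards1.
have qf u v : q u = q v -> f u = f v.
  move=> quv; have [->//|uv] := eqVneq u v.
  have [k] := fiber_edge q1 uv quv; rewrite cq inE => /eqP-> /(contractedP f).
  by rewrite ef => /esym/eqP.
have [g fE] := contraction_descend qf; exists (collapse_tree eE), q, g; split=> //.
have := card_edge_contraction q; have := card_edge_contraction f.
have := card_edge_contraction g; rewrite cq cards1; lia.
Qed.

Section UnitChain.
Variable T : tree.

(** The empty configuration, the only star product in bidegree [(0, 0)]. *)
Definition unit_chain : tensor_mod T := pure_tensor (fun _ => symb None).

Lemma unit_chainE s : unit_chain s = (s == [ffun=> None])%:R.
Proof.
rewrite ffunE eq_sym -prod_delta; apply: eq_bigr => v _; by rewrite !ffunE.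
Qed.

Lemma unit_chain_star d : #|star_support d| = 0%N -> star_product d mone = unit_chain.
Proof.
move=> /card0_eq d0; rewrite -[RHS]scale1r; apply: (congr1 (fun y => _ *: pure_tensor y)).
apply: functional_extensionality_dep => v; have := d0 v; rewrite inE.
by case: (d v).
Qed.

Lemma unit_chain_cycle : sw_cycle_prop 0 0 unit_chain.
Proof.
have s0 : #|star_support [ffun=> None : option (edge T * edge T * edge T)]| = 0%N.
  by apply: eq_card0 => v; rewrite inE ffunE.
rewrite -(unit_chain_star s0); apply: star_product_cycle => //; last by rewrite mdeg1.
by move=> v c; rewrite ffunE.
Qed.

Lemma unit_chain_gen r x : star_gen r 0 0 x -> x = unit_chain.
Proof.
move=> [d [m [-> _ d0 /eqP]]]; rewrite addn0 mdeg_eq0 => /eqP->.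
exact: unit_chain_star.
Qed.
End UnitChain.

Lemma unit_chain_pull (T T' : tree) (f : contraction T T') : (#|contracted f| <= 1)%N ->
  sw_pull f (unit_chain T') = unit_chain T.
Proof.
move=> f1; rewrite sw_pull_simple //; last by apply/sw_reducedP; case: (unit_chain_cycle T').
have occ0 (U : tree) (s : state U) : (s == [ffun=> None]) = (occupied s == finset.set0).
  apply/eqP/eqP => [->|E]; first by apply/finset.setP => v; rewrite !inE ffunE.
  apply/ffunP => v; rewrite ffunE; move/finset.setP/(_ v): E; rewrite !inE.
  by move/negbT; rewrite negbK => /eqP.
apply/ffunP => s; rewrite ffunE unit_chainE occ0.
transitivity ((-1) ^+ ninv f (occupied s) *
    \sum_(s' | compat f s s' && (s' == [ffun=> None])) 1 : edge_ring T).
  apply: (congr1 ( *%R _)); rewrite [RHS]big_mkcondr /=; apply: eq_bigr => s' _.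
  by rewrite unit_chainE; case: eqP => _; [exact: (rmorph1 (edge_map f)) | exact: (raddf0 (edge_map f))].
have [E|/eqP nE] := eqVneq (occupied s) finset.set0.
  rewrite E; have -> : ninv f finset.set0 = 0%N by rewrite /ninv big_set0.
  rewrite mul1r (big_pred1 [ffun=> None]) // => s' /=.
  rewrite andb_idl // => /eqP->; apply/compatP; rewrite E; split=> [u v|| v]; rewrite ?inE //.
  by rewrite imset0; apply/finset.setP => v; rewrite !inE ffunE.
rewrite big_pred0 ?mulr0 // => s'; apply/negP => /andP[/compatP[_ im _]].
by rewrite occ0 -im imset_eq0 => /eqP.
Qed.

Section ToPoint.
Variable T : tree.

Lemma to_point_subproof : is_contraction [ffun _ : T => tt : point].
Proof.
apply/andP; split; apply/forallP => w; last first.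
  by apply/forallP => y; rewrite !ffunE eqxx implybT.
case: w; apply/andP; split.
  have /card_gt0P[v _] := tree_nonempty T; apply/set0Pn; exists v.
  by rewrite inE ffunE.
apply/forall_inP => x _; apply/forall_inP => y _.
apply: connect_sub (tree_connected x y) => a b ab; apply: connect1.
by apply/and3P; split; rewrite // inE ffunE.
Qed.

Definition to_point : contraction T point := Contraction to_point_subproof.

Lemma to_point_uniq (f g : contraction T point) : f = g.
Proof. by apply/val_inj/ffunP => v; case: (val f v); case: (val g v). Qed.

Lemma edgeless_point : #|{: edge T}| = 0%N -> same_shape T point.
Proof.
move=> T0; have noadj (x y : T) : adj x y = false.
  by apply/negP => xy; have := card0_eq T0 (mk_edge xy).
have /card_gt0P[v _] := tree_nonempty T.
pose h : {ffun point -> T} := [ffun _ => v].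
have hc : is_contraction h.
  apply: iso_contraction_subproof => [|x y]; last by rewrite noadj.
  exists (fun _ => tt) => [[]//|x]; rewrite ffunE; exact: edgeless_eq.
exists to_point, (Contraction hc); apply/val_inj/ffunP => x; exact: edgeless_eq.
Qed.
End ToPoint.

Section Submodule.
Variables (N : tree_module) (P : forall T, zmodClosed (N T)).
Hypothesis P_act : forall (T T' : tree) (f : contraction T T') x,
  x \in P T' -> tact (mact N) f x \in P T.

Definition sub_obj (T : tree) : zmodType := subgrp (P T).

Definition sub_map (T T' : tree) (f : contraction T T') : sub_obj T' -> sub_obj T :=
  cycle_map (P_act f).

Lemma sub_map_additive (T T' : tree) (f : contraction T T') : zmod_morphism (sub_map f).
Proof. by move=> x y; apply: val_inj; rewrite /= !raddfB. Qed.

HB.instance Definition _ T T' (f : contraction T T') := GRing.isZmodMorphism.Build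
  (sub_obj T') (sub_obj T) (sub_map f) (sub_map_additive f).

Lemma sub_map_id T x : sub_map (contr_id T) x = x.
Proof. by apply: val_inj; exact: act_id. Qed.

Lemma sub_map_comp T T' T'' (f : contraction T T') (g : contraction T' T'') x :
  sub_map (contr_comp g f) x = sub_map f (sub_map g x).
Proof. by apply: val_inj; exact: act_comp. Qed.

Definition submodule : tree_module := TreeModule (@TreeAction sub_obj
  (fun T T' f => sub_map f : {additive _ -> _}) sub_map_id sub_map_comp).

Lemma submodule_val_nat (T T' : tree) (f : contraction T T') (x : sub_obj T') :
  (val : {additive sub_obj T -> N T}) (sub_map f x) =
  tact (mact N) f ((val : {additive sub_obj T' -> N T'}) x).
Proof. by []. Qed.

Lemma submoduleP : submodule_of submodule N.
Proof.
by exists (@TreeMor submodule N (fun T => val : {additive sub_obj T -> N T}) submodule_val_nat)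
  => T; exact: val_inj.
Qed.
End Submodule.

Lemma principal_map_to_point (T T' : tree) (f : contraction T T') (a : principal_obj point T') :
  principal_map f a (to_point T) = a (to_point T').
Proof.
rewrite ffunE (big_pred1 (to_point T')) // => g /=.
by rewrite (to_point_uniq g (to_point T')) (to_point_uniq (contr_comp _ f) (to_point T)) !eqxx.
Qed.

Section PointSum.
Variable r : nat.

(* One summand maps onto the value at the class of the empty configuration, which
   the action relates to the complex on trees with an edge only; the others map
   onto the values at one-vertex trees, from which the maps are arbitrary. *)
Definition point_sum : tree_module := dsum (fun _ : 'I_r.+1 => principal point).

(** The summand of the empty configuration is cut off at edgeless trees: its image there would have
    to be carried to the classes on larger trees by maps that may be zero. *)
Definition point_sum_pred (T : tree) : {pred dsum_obj (fun _ : 'I_r.+1 => principal_obj point T)} :=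
  fun x => (#|{: edge T}| == 0%N) ==> (x ord0 == 0).

Arguments point_sum_pred T : clear implicits.

Lemma point_sum_pred_closed T : zmod_closed (point_sum_pred T).
Proof.
split=> [|x y]; rewrite !unfold_in; first by rewrite eqxx implybT.
case: eqP => // _ /= /eqP x0 /eqP y0.
by apply/eqP; apply: etrans (congr2 (fun a b => a - b) x0 y0) (subr0 _).
Qed.

HB.instance Definition _ T := GRing.isZmodClosed.Build
  (dsum_obj (fun _ : 'I_r.+1 => principal_obj point T)) (point_sum_pred T)
  (point_sum_pred_closed T).

(** A contraction out of an edgeless tree ends in an edgeless tree, so the condition is
    preserved. *)
Lemma point_sum_act (T T' : tree) (f : contraction T T') (x : point_sum T') :
  x \in point_sum_pred T' -> tact (mact point_sum) f x \in point_sum_pred T.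
Proof.
rewrite !unfold_in => h; apply/implyP => /eqP T0; move: h.
have -> : #|{: edge T'}| == 0%N.
  by have := card_edge_contraction f; rewrite T0 => /esym/eqP; rewrite addn_eq0 => /andP[].
by move=> /= /eqP x0; apply/eqP; rewrite /= /dsum_map x0; exact: (raddf0 (principal_map f)).
Qed.

Definition half_point_sum : tree_module :=
  submodule (N := point_sum) (P := fun T => point_sum_pred T) point_sum_act.

Lemma point_sum_generated : generated_in_degrees_le 0 point_sum.
Proof.
exists r.+1, (fun _ => point); split; first by move=> j; rewrite card_edge_point.
exact: quotient_refl.
Qed.
End PointSum.
Arguments point_sum_pred r T : clear implicits.

Section PointCover.
Variables (M : tree_module) (s : seq (M point)) (c : forall T, M T).
Let r := size s.

Definition point_cover (T : tree) (x : half_point_sum r T) : M T :=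
  \sum_(k < r) tact (mact M) (to_point T) (nth 0 s k) *~ (val x (lift ord0 k) (to_point T)) +
  c T *~ (val x ord0 (to_point T)).

Lemma point_cover_additive T : zmod_morphism (@point_cover T).
Proof.
move=> x y; rewrite /point_cover opprD addrACA -sumrB; congr (_ + _).
  by apply: eq_bigr => k _; rewrite -mulrzBr; congr (_ *~ _); rewrite raddfB; exact: ffun_sub.
by rewrite -mulrzBr; congr (_ *~ _); rewrite raddfB; exact: ffun_sub.
Qed.

HB.instance Definition _ T := GRing.isZmodMorphism.Build (half_point_sum r T) (M T)
  (@point_cover T) (@point_cover_additive T).

Hypothesis c_act : forall (T T' : tree) (f : contraction T T'), (0 < #|{: edge T'}|)%N ->
  tact (mact M) f (c T') = c T.

Lemma point_cover_nat (T T' : tree) (f : contraction T T') (x : half_point_sum r T') :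
  point_cover (tact (mact (half_point_sum r)) f x) = tact (mact M) f (point_cover x).
Proof.
rewrite /point_cover raddfD raddf_sum /=; congr (_ + _).
  apply: eq_bigr => k _; rewrite raddfMz /= -act_comp.
  by rewrite (to_point_uniq (contr_comp _ f) (to_point T)) /dsum_map principal_map_to_point.
rewrite /dsum_map principal_map_to_point raddfMz /=.
have [T'0|] := posnP #|{: edge T'}|; last by move=> T'0; rewrite c_act.
have := valP x; rewrite unfold_in T'0 eqxx /= => /eqP x0.
have -> : sval x ord0 (to_point T') = 0.
  apply: etrans (congr1 (fun a : principal_obj point T' => a (to_point T')) x0) _.
  exact: ffunE.
by rewrite !mulr0z.
Qed.

Definition point_delta (T : tree) (j : 'I_r.+1) : point_sum r T :=
  fun k => [ffun _ => (k == j)%:R].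

Lemma point_cover_delta (T : tree) (j : 'I_r.+1) (mem : point_delta T j \in point_sum_pred r T) :
  point_cover (Sub (point_delta T j) mem) =
  if unlift ord0 j is Some k then tact (mact M) (to_point T) (nth 0 s k) else c T.
Proof.
rewrite /point_cover /= /point_delta ffunE.
case: unliftP => [k ->|->].
  rewrite (bigD1 k) //= ffunE eqxx big1 ?addr0 //=.
  by move=> l lk; rewrite ffunE (inj_eq (@lift_inj _ _)) (negPf lk).
by rewrite big1 ?add0r // => k _; rewrite ffunE.
Qed.
End PointCover.

Section ZeroDegree.
Variables (M : tree_module) (theta : forall T, {additive M T -> sw_homology T 0 0}).
Hypothesis theta_bij : forall T, (1 <= #|{: edge T}|)%N -> bijective (theta T).
Hypothesis theta_nat : forall (T T' : tree) (f : contraction T T'),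
  (1 <= #|{: edge T'}|)%N -> (#|contracted f| <= 1)%N ->
  exists F : sw_homology T' 0 0 -> sw_homology T 0 0,
    induced_by_pull f F /\ forall x, theta T (tact (mact M) f x) = F (theta T' x).
Hypothesis point_finite : finite_group (M point).

Lemma unit_value_exists : exists c : forall T, M T, forall T,
  if (0 < #|{: edge T}|)%N then represents theta (c T) (unit_chain T) else c T = 0.
Proof.
suff h T : exists y : M T, if (0 < #|{: edge T}|)%N then represents theta y (unit_chain T) else y = 0.
  by exists (fun T => sval (cid (h T))) => T; exact: (svalP (cid (h T))).
have [T0|T0] := boolP (0 < #|{: edge T}|)%N; last by exists 0.
exact: (represents_exists theta_bij T0 (unit_chain_cycle T)).
Qed.

(** For simple contractions this is [unit_chain_pull] read through [theta]; in general [f] is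
    factored. *)
Lemma unit_value_act (c : forall T, M T) : (forall T,
    if (0 < #|{: edge T}|)%N then represents theta (c T) (unit_chain T) else c T = 0) ->
  forall (T T' : tree) (f : contraction T T'), (0 < #|{: edge T'}|)%N ->
  tact (mact M) f (c T') = c T.
Proof.
move=> cP T T' f T'0.
have edges (T1 T2 : tree) (g : contraction T1 T2) : (0 < #|{: edge T2}|)%N -> (0 < #|{: edge T1}|)%N.
  by rewrite (card_edge_contraction g) addn_gt0 => ->.
have cR (U : tree) : (0 < #|{: edge U}|)%N -> represents theta (c U) (unit_chain U).
  by move=> U0; have := cP U; rewrite U0.
have act1 (T1 T2 : tree) (g : contraction T1 T2) : (0 < #|{: edge T2}|)%N ->
    (#|contracted g| <= 1)%N -> tact (mact M) g (c T2) = c T1.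
  move=> T2e g1; have [z zE thE] := cR T2 T2e.
  have [F [pF FE]] := theta_nat T2e g1; have [z' [z'E Fz]] := pF z.
  apply: (represents_uniq theta_bij (edges _ _ g T2e) (x := unit_chain T1) (x' := unit_chain T1)).
  - exists z'; first by rewrite z'E zE unit_chain_pull.
    by apply: etrans (FE _) _; apply: etrans (congr1 F thE) _.
  - exact/cR/(edges _ _ g).
  have /asboolP := rpred0 (sw_boundaries (T := T1) 0 0); by rewrite subrr.
have [N] := ubnP #|contracted f|.
elim: N T f => // N IH T f; rewrite ltnS => fN.
have [f1|/contraction_factor[T1 [q [g [fE q1 gf]]]]] := leqP #|contracted f| 1.
  exact: act1.
rewrite fE act_comp IH; last exact: leq_trans gf fN.
exact: act1 (edges _ _ g T'0) q1.
Qed.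

Lemma unit_value_span (c : forall T, M T) (T : tree) : (forall T,
    if (0 < #|{: edge T}|)%N then represents theta (c T) (unit_chain T) else c T = 0) ->
  (0 < #|{: edge T}|)%N -> forall y, zspan (fun y => y = c T) y.
Proof.
move=> cP T0; have /card_gt0P[r _] := tree_nonempty T.
apply: (star_span theta_bij (r := r) T0) => x /unit_chain_gen->.
by exists (c T) => //; have := cP T; rewrite T0.
Qed.

(** One summand, cut off at edgeless trees, covers the trees with an edge; the others cover the
    edgeless trees. The cut makes the source a proper submodule of a sum of principal modules in
    degree 0. *)
Lemma small_zero : small 0 M.
Proof.
have [s sP] := point_finite; have [c cP] := unit_value_exists.
have c_act (T T' : tree) (f : contraction T T') : (0 < #|{: edge T'}|)%N ->
    tact (mact M) f (c T') = c T by exact: unit_value_act.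
exists (point_sum (size s)); split; first exact: point_sum_generated.
exists (half_point_sum (size s)); split; first exact: submoduleP.
exists (TreeMor (@point_cover_nat M s c c_act)) => T y /=.
have [T0|T0] := posnP #|{: edge T}|.
  have [f [g fg]] := edgeless_point T0.
  rewrite -[y](act_id (mact M)) -fg act_comp (to_point_uniq f (to_point T)).
  move: (tact (mact M) g y) => z0; elim: {z0}(sP z0) => [|z z' _ [x E] _ [x' E']|_ /(nthP 0)[k ks <-]].
  - by exists 0; rewrite [RHS]raddf0; exact: raddf0.
  - exists (x - x'); apply: etrans (raddfB (@point_cover M s c T) _ _) _.
    by rewrite raddfB; exact: (congr2 (fun a b => a - b) E E').
  have mem : point_delta T (lift ord0 (Ordinal ks)) \in point_sum_pred (size s) T.
    by rewrite unfold_in /point_delta eq_sym; apply/implyP.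
  exists (Sub (point_delta T (lift ord0 (Ordinal ks))) mem).
  apply: etrans (point_cover_delta c mem) _; last by rewrite liftK.
elim: {y}(unit_value_span cP T0 y) => [|z z' _ [x <-] _ [x' <-]|_ ->].
- by exists 0; exact: raddf0.
- by exists (x - x'); exact: (raddfB (@point_cover M s c T)).
have mem : point_delta T ord0 \in point_sum_pred (size s) T.
  by rewrite unfold_in eqn0Ngt T0.
exists (Sub (point_delta T ord0) mem).
by apply: etrans (point_cover_delta c mem) _; rewrite unlift_none.
Qed.
End ZeroDegree.

Theorem theorem1p5 (R : realType) (n i : nat) :
  (exists M : tree_action (fun T => sw_homology T n i), sw_action M) /\
  (forall M : tree_action (fun T => sw_homology T n i), sw_action M ->
     small (n + i) (TreeModule M) /\ finitely_generated (TreeModule M)) /\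
  (forall M : tree_action (uconf_homology R n i), uconf_action M ->
     small (n + i) (TreeModule M) /\ finitely_generated (TreeModule M)).
Proof.
split; first by exists (homology_action n i); exact: homology_actionP.
split=> M MP.
  have gen := sw_generated MP; split; first exact: small_generated.
  exact: generated_finitely gen.
split; last first.
  (* Finite generation asks for no particular degree, so the bound [maxn (n + i) 1] serves in all
     cases. *)
  by apply: generated_finitely (uconf_generated MP (leq_maxl (n + i) 1) (leq_maxr _ _)).
(* Only for [n + i = 0] does the lower bound 1 of the descent exceed the degree that is claimed. *)
have [E|ni] := posnP (n + i)%N; last first.
  exact: small_generated (uconf_generated MP (leqnn _) ni).
move: M MP; rewrite E; have [-> ->] : n = 0%N /\ i = 0%N by move: E; case: n; case: i.
move=> M [theta [bij nat]].
apply: (@small_zero (TreeModule M) theta bij nat).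
by apply: uconf_finite; rewrite card_edge_point.
Qed.
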